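(* If $X \subset S^1$ is nonempty and finite and $0\leq r<\frac12$, then the ambient Čech complex $\mathrm{\check{C}ech}(X,S^1;r)$ and the Vietoris–Rips complex $\mathrm{VR}(X,r)$ each have the homotopy type of a point, an odd-dimensional sphere, or a wedge sum of spheres of the same even dimension.
   Context: $S^1=\mathbb{R}/\mathbb{Z}$ is the circle of circumference $1$ with the arc-length metric (diameter $\frac12$). The ambient Čech complex $\mathrm{\check{C}ech}(X,S^1;r)$ is the nerve of the closed balls $\{B(x,r)\mid x\in X\}$, where $B(x,r)=\{y\in S^1\mid d(x,y)\le r\}$: its vertex set is $X$ and a finite nonempty $\sigma\subseteq X$ is a simplex iff $\bigcap_{x\in\sigma}B(x,r)\neq\emptyset$. The Vietoris–Rips complex $\mathrm{VR}(X,r)$ has vertex set $X$ and a finite $\sigma\subseteq X$ is a simplex iff any two points of $\sigma$ are at distance at most $r$. *)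

(* Defs.v *)
From HB Require Import structures.
From mathcomp Require Import all_boot all_order all_algebra finmap.
From mathcomp Require Import generic_quotient ring_quotient.
From mathcomp Require Import mathcomp_extra boolp classical_sets functions.
From mathcomp Require Import reals interval_inference topology.
From mathcomp Require Import normedtype wedge_sigT.
From mathcomp Require Import ring lra.

Set Implicit Arguments.
Unset Strict Implicit.
Unset Printing Implicit Defensive.

Import Order.TTheory GRing.Theory Num.Theory.
Import numFieldNormedType.Exports.

Local Open Scope classical_set_scope.
Local Open Scope quotient_scope.
Local Open Scope ring_scope.

(* [Num.int_num_subdef] is the predicate underlying [Num.int]. *)
Definition Z_subgroup (R : realType) : zmodClosed R :=
  GRing.ZmodClosed.clone R Num.int_num_subdef _.

(* [{ideal_quot I}] only requires [I] to be an additive subgroup, so this is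
   the quotient group R/Z; see [circle_eqP]. *)
Definition circle (R : realType) : Type := {ideal_quot (Z_subgroup R)}.

HB.instance Definition _ (R : realType) := GRing.Zmodule.on (circle R).
HB.instance Definition _ (R : realType) :=
  EqQuotient.copy (circle R) {ideal_quot (Z_subgroup R)}.

Section circle_metric.
Context {R : realType}.
Implicit Types (a b : R) (x y z : circle R).

Definition rep_dists x y : set R :=
  [set d | exists a b, [/\ \pi_(circle R) a = x, \pi_(circle R) b = y
                         & d = `|a - b|]].

(* The quotient metric of R/Z, which is the arc length on a circle of
   circumference 1; see [mdist_circleE]. *)
Definition arc_dist x y : R := inf (rep_dists x y).

Lemma circle_eqP a b :
  (\pi_(circle R) a = \pi_(circle R) b) <-> exists m : int, a - b = m%:~R.
Proof.
split=> [/eqP|[m abm]].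
  by rewrite -[_ == _]Quotient.idealrBE => /intrP[m ->]; exists m.
by apply/eqP; rewrite -[_ == _]Quotient.idealrBE abm; apply/intrP; exists m.
Qed.

Let rep_dists_neq0 x y : rep_dists x y !=set0.
Proof.
by exists `|repr x - repr y|, (repr x), (repr y); split => //; rewrite reprK.
Qed.

Let rep_dists_ge0 x y : lbound (rep_dists x y) 0.
Proof. by move=> _ [a [b [_ _ ->]]]. Qed.

Let rep_dists_inf x y : has_inf (rep_dists x y).
Proof. by split=> //; exists 0. Qed.

Let arc_dist_le a b : arc_dist (\pi a) (\pi b) <= `|a - b|.
Proof.
by apply: ge_inf; [case: (rep_dists_inf (\pi a) (\pi b))|exists a, b].
Qed.

Let arc_dist_adherent (e : R) x y : 0 < e -> exists a b,
  [/\ \pi_(circle R) a = x, \pi_(circle R) b = y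
    & `|a - b| < arc_dist x y + e].
Proof.
move=> e0; have [_ [a [b [ax by_ ->]]]] := inf_adherent e0 (rep_dists_inf x y).
by exists a, b.
Qed.

Let arc_distE a b : `|a - b| <= 2^-1 -> arc_dist (\pi a) (\pi b) = `|a - b|.
Proof.
move=> ab2; apply/eqP; rewrite eq_le arc_dist_le/=.
apply: lb_le_inf; first exact: rep_dists_neq0.
move=> _ [a' [b' [/circle_eqP[m am] /circle_eqP[n bn] ->]]].
have -> : a' - b' = (a - b) + (m - n)%:~R.
  by rewrite intrD mulrNz -am -bn !opprD !opprK; ring.
have [->|mn] := eqVneq (m - n) 0; first by rewrite addr0.
have mn1 : 1 <= `|(m - n)%:~R : R|.
  rewrite -intr_norm (_ : 1 = 1%:~R)// ler_int.
  by rewrite -gtz0_ge1 normr_gt0.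
have := lerB_normD (m - n)%:~R (a - b) => /=; rewrite [_ + (a - b)]addrC.
by apply: le_trans; lra.
Qed.

Let arc_distxx x : arc_dist x x = 0.
Proof.
by rewrite -[x]reprK arc_distE subrr normr0// invr_ge0.
Qed.

Let arc_dist_sym x y : arc_dist x y = arc_dist y x.
Proof.
by congr inf; apply/seteqP; split=> _ [a [b [<- <- ->]]]; exists b, a; split;
  rewrite // distrC.
Qed.

Let arc_dist_triangle y x z : arc_dist x z <= arc_dist x y + arc_dist y z.
Proof.
apply/ler_addgt0Pr => e e0.
have e20 : 0 < e / 2 by rewrite divr_gt0.
have [a [b [<- by_ ab]]] := arc_dist_adherent x y e20.
have [b' [c [by' <- bc]]] := arc_dist_adherent y z e20.
have [m bm] : exists m : int, b - b' = m%:~R by apply/circle_eqP; rewrite by_.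
have {1}-> : \pi_(circle R) c = \pi_(circle R) (c + (b - b')).
  by apply/circle_eqP; exists (- m); rewrite mulrNz -bm opprD addNKr.
apply: (le_trans (arc_dist_le _ _)).
have -> : a - (c + (b - b')) = (a - b) + (b' - c) by ring.
apply: (le_trans (ler_normD _ _)).
by apply: (le_trans (lerD (ltW ab) (ltW bc))); rewrite addrACA -splitr.
Qed.

Let arc_dist_eq0 x y : arc_dist x y = 0 -> x = y.
Proof.
have half_gt0 : 0 < 2^-1 :> R by rewrite invr_gt0.
move=> xy0; have [a [b [ax by_]]] := arc_dist_adherent x y half_gt0.
rewrite xy0 add0r => /ltW /arc_distE.
by rewrite ax by_ xy0 => /esym/normr0_eq0/subr0_eq ab; rewrite -ax -by_ ab.
Qed.

HB.instance Definition _ := @isMetric.Build R (circle R) arc_dist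
  arc_distxx arc_dist_eq0 arc_dist_sym arc_dist_triangle.

Lemma mdist_circleE a b : `|a - b| <= 2^-1 ->
  mdist (\pi_(circle R) a) (\pi_(circle R) b) = `|a - b|.
Proof. exact: arc_distE. Qed.

End circle_metric.

(* Not every [v : V] needs to be a vertex: the vertices are the [v] such that
   [[set v]%SET] is a simplex. *)
Record simplicial_complex (V : finType) := SimplicialComplex {
  simplex :> set {set V};
  simplex_neq0 : forall s, simplex s -> s != finset.set0;
  simplex_face : forall s t : {set V},
    simplex s -> t \subset s -> t != finset.set0 -> simplex t }.

Section nerve.
Context (I : finType) (T : Type) (F : I -> set T).

Definition nerve_set : set {set I} :=
  [set s | s != finset.set0 /\ \bigcap_(i in [set` s]) F i !=set0].

Lemma nerve_neq0 s : nerve_set s -> s != finset.set0.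
Proof. by case. Qed.

Lemma nerve_face (s t : {set I}) :
  nerve_set s -> t \subset s -> t != finset.set0 -> nerve_set t.
Proof.
move=> [_ [x xF]] /fintype.subsetP ts t0; split=> //; exists x => i /ts.
exact: xF.
Qed.

Definition nerve := SimplicialComplex nerve_neq0 nerve_face.

End nerve.

Section metric_complexes.
Context {R : realType} {M : metricType R}.

(* Unlike [closed_ball], which is the closure of an open ball, this is [[set x]]
   and not empty for [r = 0]. *)
Definition mdist_ball (x : M) (r : R) : set M := [set y | mdist x y <= r].

Context (X : {fset M}) (r : R).

Definition cech : simplicial_complex X :=
  nerve (fun x : X => mdist_ball (val x) r).

Definition VR_set : set {set X} := [set s : {set X} | s != finset.set0 /\
  forall x y : X, x \in s -> y \in s -> mdist (val x) (val y) <= r].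

Lemma VR_neq0 s : VR_set s -> s != finset.set0.
Proof. by case. Qed.

Lemma VR_face (s t : {set X}) :
  VR_set s -> t \subset s -> t != finset.set0 -> VR_set t.
Proof.
by move=> [_ sr] /fintype.subsetP ts t0; split=> // x y /ts xs /ts; exact: sr.
Qed.

Definition VR : simplicial_complex X := SimplicialComplex VR_neq0 VR_face.

End metric_complexes.

(* As [V] is finite, the coherent topology on the realization is the one
   induced by the product topology of R^V. *)
Definition realization (R : realType) (V : finType) (K : simplicial_complex V)
    : topologicalType :=
  [set t : {ptws V -> R} | [/\ forall v, 0 <= t v, \sum_(v : V) t v = 1
     & simplex K [set v | t v != 0]%SET]] : set _.

Definition homotopic (R : realType) (T U : topologicalType) (f g : T -> U) :=
  exists H : T * R -> U,
    [/\ {within [set: T] `*` `[0, 1], continuous H},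
        forall x, H (x, 0) = f x & forall x, H (x, 1) = g x].

Definition homotopy_equivalent (R : realType) (T U : topologicalType) :=
  exists (f : T -> U) (g : U -> T),
    [/\ continuous f, continuous g,
        homotopic R (g \o f) idfun & homotopic R (f \o g) idfun].

Definition sphere_set (R : realType) (n : nat) : set 'rV[R]_n.+1 :=
  [set x | \sum_i x ord0 i ^+ 2 = 1].
Arguments sphere_set : clear implicits.

Definition sphere (R : realType) (n : nat) : topologicalType := sphere_set R n.

Lemma delta_in_sphere (R : realType) (n : nat) :
  delta_mx ord0 ord0 \in sphere_set R n.
Proof.
apply/mem_set; rewrite /sphere_set/= (bigD1 ord0)//= big1 => [|i /negPf i0].
  by rewrite addr0 mxE !eqxx expr1n.
by rewrite mxE i0 andbF expr0n.
Qed.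

Definition sphere_base (R : realType) (n : nat) : sphere R n :=
  exist (fun x => x \in sphere_set R n) _ (delta_in_sphere R n).

(* The wedge sum of [k.+1] copies of the [n]-sphere ([wedge] is empty, not a
   point, on an empty family). *)
Definition sphere_wedge (R : realType) (n k : nat) : topologicalType :=
  wedge (fun _ : 'I_k.+1 => sphere_base R n).

Definition point_space : topologicalType := discrete_topology unit.

Definition point_sphere_or_wedge (R : realType) (T : topologicalType) : Prop :=
  [\/ homotopy_equivalent R T point_space,
      exists l : nat, homotopy_equivalent R T (sphere R l.*2.+1)
    | exists l k : nat, homotopy_equivalent R T (sphere_wedge R l.*2 k)].

(* Main.v *)
(** List the points of [X] in circular order as a sequence of period [n], and
    let [G i] be the first index at arc length at least [u] ahead of [i], with
    [u = 1 - 2r] for the Čech and [u = 1 - r] for the Vietoris-Rips complex. A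
    set is a Čech simplex iff it misses some arc [(i, G i)], and [i < j < i + n]
    span a Vietoris-Rips edge iff [G j <= i + n] or [G i <= j].

    For [Y] a subset of [X], let [g Y i] be the first index of [Y] from [G i] on.
    Like any monotone map of degree 1 of the circle, [g Y] has a rotation number.
    A greedy matching of the link of [x] in the complex induced on [Y] leaves at
    most one face unmatched, and if there is one, its size shows how the orbit
    of [x] (or of its successor) closes up at [x]. Removing one point after the
    other, and using that rotation numbers of orbits agree, one gets an acyclic
    matching with either one critical simplex of odd dimension, or critical
    simplices of the same even dimension.

    Such a matching is reordered so that the pairs in high dimension are
    collapsed first; the critical simplices become facets of the remaining
    complex, and deleting them leaves a contractible one. A complex with a
    contractible subcomplex obtained by deleting facets of the same dimension is
    a wedge of spheres, by explicit maps and homotopies: the contraction is run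
    along the radii of the enlarged facets. *)
Require Import Defs.
From mathcomp Require Import all_boot all_order zify.

Set Implicit Arguments.
Unset Strict Implicit.
Unset Printing Implicit Defensive.

(** * Matchings and collapses *)

(** Why one dimension only: a face left unmatched in the link of [x] comes with an orbit statement
    about [w m] turns in [h m] steps, and [w m / h m] strictly decreases in [m]. Once one orbit is
    periodic of type [m], comparison of rotation numbers forces every later unmatched face to have
    that same [m]. An unmatched face of odd dimension appears only just before such an orbit is
    created, by deleting [x] and closing up the orbit of its successor; all other points then fall
    into this orbit, so nothing else remains critical.

    The obstacle on the topological side is that a matching says nothing about attaching maps. It is
    avoided by arranging that the critical simplices are facets whose removal leaves a contractible
    polyhedron: its contraction then serves all cells at once, and no attaching map has to be
    computed. *)

Section families.
Context {V : finType}.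
Implicit Types (A D L M S : {set {set V}}) (s t : {set V}) (b x : V).

Definition down_closed A := forall s t, s \in A -> t \subset s -> t \in A.

(** Families are meant to include the empty set: the link of an isolated vertex is then
    [[set set0]], with one unmatched set, whereas the link of a point that is no vertex is empty. *)
Definition lk x A := [set s : {set V} | (x \notin s) && (x |: s \in A)].
Definition del x A := [set s in A | x \notin s].

(* [tree A c]: tests [x \in s] split [A] into cones and copies of [{set0}]; [c]
   collects the sizes (dimension plus one) of the sets of [A] left unmatched. *)
Inductive tree : {set {set V}} -> seq nat -> Prop :=
| tree_cone b A : (forall s, s \in A -> b |: s \in A) -> tree A [::]
| tree_top : tree [set set0] [:: 0]
| tree_split x A c c' :
    tree (lk x A) c -> tree (del x A) c' -> tree A (map S c ++ c').

(** [t] may be empty; then [A] consists of [set0] and [[set b]] only, and the pair is the last one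
    of a removal. *)
Definition free_pair A t b :=
  [/\ b \notin t, t \in A, b |: t \in A
    & forall s, s \in A -> t \subset s -> s = t \/ s = b |: t].

Definition maximal_in A s := s \in A /\ forall t, t \in A -> s \subset t -> t = s.

(** The existence of an order of removal from the top stands for the acyclicity of the matching. *)
Inductive removal : {set {set V}} -> seq nat -> Prop :=
| removal_nil : removal set0 [::]
| removal_pair A t b c : free_pair A t b ->
    removal (A :\: [set t; b |: t]) c -> removal A c
| removal_crit A s c : maximal_in A s ->
    removal (A :\ s) c -> removal A (#|s| :: c).

Inductive collapse (e : nat) : {set {set V}} -> {set {set V}} -> Prop :=
| collapse_refl A : collapse e A A
| collapse_step A t b L : free_pair A t b -> e <= #|t| ->
    collapse e (A :\: [set t; b |: t]) L -> collapse e A L.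

Lemma down_closed_lk x A : down_closed A -> down_closed (lk x A).
Proof.
move=> Ad s t; rewrite !inE => /andP[xs xsA] ts; apply/andP; split.
  by apply: contra xs => /(subsetP ts).
by apply: Ad xsA _; apply: setUS.
Qed.

Lemma down_closed_del x A : down_closed A -> down_closed (del x A).
Proof.
move=> Ad s t; rewrite !inE => /andP[sA xs] ts; apply/andP; split.
  exact: Ad sA ts.
by apply: contra xs => /(subsetP ts).
Qed.

Lemma down_closed_pair A t b : down_closed A -> free_pair A t b ->
  down_closed (A :\: [set t; b |: t]).
Proof.
move=> Ad [bt tA btA tmax] s u; rewrite !inE negb_or -andbA => /and3P[st sbt sA] us.
have uA := Ad _ _ sA us.
rewrite uA andbT negb_or; apply/andP; split; apply/eqP => uE; subst u.
  by have [E|E] := tmax _ sA us; move: st sbt; rewrite E eqxx.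
have tus : t \subset s by apply: subset_trans us; apply: subsetUr.
by have [E|E] := tmax _ sA tus; move: st sbt; rewrite E eqxx.
Qed.

(** Toggling [b] matches all of [A]. A largest set [t] of [A] without [b] lies in no other set of
    [A] than [b |: t], so this pair is free, and what remains is again a cone. *)
Lemma removal_cone b A : down_closed A ->
  (forall s, s \in A -> b |: s \in A) -> removal A [::].
Proof.
have [m] := ubnP #|A|; elim: m A => // m IH A Am Ad Ab.
have [->|[s0 s0A]] := set_0Vmem A; first exact: removal_nil.
pose P := [pred s : {set V} | (s \in A) && (b \notin s)].
have P0 : P (s0 :\ b).
  rewrite /= !inE eqxx andbT; apply: Ad s0A _; exact: subD1set.
case: (arg_maxnP (fun s : {set V} => #|s|) P0) => t /andP[tA bt] tmax.
have free : free_pair A t b.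
  split=> //; first exact: Ab.
  move=> s sA ts; have [bs|bs] := boolP (b \in s); last first.
    left; apply/esym/eqP; rewrite eqEcard ts /=; apply: tmax.
    by rewrite inE sA bs.
  right; have sbA : s :\ b \in A by apply: Ad sA _; exact: subD1set.
  have tsb : t \subset s :\ b by rewrite subsetD1 ts bt.
  have E : t = s :\ b.
    apply/eqP; rewrite eqEcard tsb; apply: tmax.
    by rewrite inE sbA !inE eqxx.
  by rewrite E setD1K.
apply: (removal_pair free); apply: IH.
- rewrite -ltnS; apply: leq_trans Am; rewrite ltnS; apply: proper_card.
  apply/properP; split; first exact: subsetDl.
  by exists t => //; rewrite !inE eqxx.
- exact: down_closed_pair.
- move=> s; rewrite !inE negb_or -andbA => /and3P[st sbt sA].
  rewrite Ab // andbT negb_or; apply/andP; split.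
    by apply: contraNneq bt => <-; rewrite !inE eqxx.
  apply/eqP => E; have [bs|bs] := boolP (b \in s).
    by move: sbt; rewrite -E (setUidPr _) ?eqxx // sub1set.
  by move: st; rewrite -(setU1K bs) E (setU1K bt) eqxx.
Qed.

(** The sets containing [x] can go first: none of them lies in a set avoiding [x], so freeness and
    maximality pass from the link to [A]. *)
Lemma removal_star x Lk c D c' A :
  removal Lk c -> removal D c' ->
  (forall s, s \in D -> x \notin s) -> (forall s, s \in Lk -> x \notin s) ->
  A = D :|: [set x |: s | s in Lk] ->
  removal A (map S c ++ c').
Proof.
move=> HL HD xD; elim: HL A => {Lk c} [|Lk t b c [bt tL btL tmax] _ IH
  |Lk s c [sL smax] _ IH] A xL AE.
- by rewrite imset0 setU0 in AE; rewrite AE.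
- have xt : x \notin t by apply: xL.
  have xb : b != x.
    by apply/eqP => E; have := xL _ btL; rewrite E !inE eqxx.
  have inA s : x \in s -> s \in A -> exists2 u, u \in Lk & s = x |: u.
    move=> xs; rewrite AE !inE => /orP[/xD|]; first by rewrite xs.
    by case/imsetP => u uL ->; exists u.
  have AL u : u \in Lk -> x |: u \in A.
    by move=> uL; rewrite AE inE; apply/orP; right; apply/imsetP; exists u.
  have E : b |: (x |: t) = x |: (b |: t) by rewrite setUCA.
  apply: (@removal_pair _ (x |: t) b).
    split.
    + by rewrite !inE negb_or xb.
    + exact: AL.
    + by rewrite E; apply: AL.
    + move=> s sA xts; have xs : x \in s by apply: (subsetP xts); rewrite !inE eqxx.
      have [u uL su] := inA s xs sA.
      have tu : t \subset u.
        have : t \subset s by apply: subset_trans xts; apply: subsetUr.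
        by rewrite su => /subsetP H; apply/subsetP => v vt; have := H _ vt;
          rewrite !inE => /orP[/eqP vx|//]; rewrite -vx vt in xt.
      by case: (tmax _ uL tu) => uE; rewrite su uE; [left|right; rewrite E].
  apply: IH; first by move=> s /setDP[/xL].
  apply/setP => s; rewrite E AE !inE.
  apply/andP/orP.
    case=> H /orP[->|]; first by left.
    case/imsetP => u uL su; right; apply/imsetP; exists u => //.
    rewrite !inE uL andbT; apply: contra H => /orP[]/eqP uE; rewrite su uE eqxx //.
    by rewrite orbT.
  have inj u v : u \in Lk -> v \in Lk -> x |: u = x |: v -> u = v.
    by move=> /xL xu /xL xv uv; rewrite -(setU1K xu) uv setU1K.
  case=> [sD|/imsetP[u]].
    split; last by rewrite sD.
    by apply/negP => /orP[]/eqP sE; have := xD _ sD; rewrite sE !inE eqxx.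
  rewrite !inE negb_or -andbA => /and3P[ut ubt uL] ->.
  split; last by apply/orP; right; apply/imsetP; exists u.
  by apply/negP => /orP[]/eqP /inj; [move/(_ uL tL)/eqP|move/(_ uL btL)/eqP];
    rewrite ?(negPf ut) ?(negPf ubt).
- have xs := xL _ sL.
  rewrite /= (_ : #|s|.+1 = #|x |: s|); last by rewrite cardsU1 xs.
  apply: removal_crit.
    split; first by rewrite AE inE; apply/orP; right; apply/imsetP; exists s.
    move=> t; rewrite AE !inE => /orP[/xD xt st|/imsetP[u uL ->] su].
      by case/negP: xt; apply: (subsetP st); rewrite !inE eqxx.
    congr (_ |: _); apply: smax => //.
    apply/subsetP => v vs; have := subsetP su v; rewrite !inE vs orbT => /(_ isT).
    by case/orP => [/eqP vx|//]; rewrite -vx vs in xs.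
  apply: IH; first by move=> t /setDP[/xL].
  apply/setP => t; rewrite AE !inE; apply/andP/orP.
    case=> H /orP[->|]; first by left.
    case/imsetP => u uL tu; right; apply/imsetP; exists u => //.
    by rewrite !inE uL andbT; apply: contra H => /eqP uE; rewrite tu uE.
  case=> [tD|/imsetP[u]].
    split; last by rewrite tD.
    by apply/eqP => tE; have := xD _ tD; rewrite tE !inE eqxx.
  rewrite !inE => /andP[us uL] ->.
  split; last by apply/orP; right; apply/imsetP; exists u.
  apply: contra us => /eqP E; have xu := xL _ uL.
  by rewrite -(setU1K xu) E setU1K.
Qed.

Lemma tree_removal A c : down_closed A -> tree A c -> removal A c.
Proof.
move=> Ad HA; elim: HA Ad => {A c} [b A Ab Ad|_|x A c c' _ IH1 _ IH2 Ad].
- exact: removal_cone Ab.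
- rewrite -[0](@cards0 V); apply: removal_crit.
    by split=> [|t]; rewrite !inE // => /eqP.
  by rewrite setDv; exact: removal_nil.
- apply: (@removal_star x (lk x A) c (del x A)).
  + exact: IH1 (down_closed_lk Ad).
  + exact: IH2 (down_closed_del Ad).
  + by move=> s; rewrite inE => /andP[].
  + by move=> s; rewrite inE => /andP[].
  + apply/setP => s; rewrite !inE; apply/idP/orP => [sA|].
      have [xs|xs] := boolP (x \in s); last by left; rewrite sA.
      right; apply/imsetP; exists (s :\ x); last by rewrite setD1K.
      by rewrite !inE eqxx /= setD1K.
    by case=> [/andP[]//|/imsetP[u]]; rewrite inE => /andP[_ +] ->.
Qed.

Lemma collapse_sub e A L : collapse e A L -> L \subset A.
Proof.
by elim=> // {}A t b {}L _ _ _ IH; apply: subset_trans IH (subsetDl _ _).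
Qed.

Lemma down_closed_collapse e A L : down_closed A -> collapse e A L -> down_closed L.
Proof.
move=> + AL; elim: AL => // {}A t b {}L tb _ _ IH Ad.
by apply: IH; apply: down_closed_pair.
Qed.

(** A pair with [e <= #|t|] stays free when sets of size at most [e] are added, since such a set
    contains [t] only if it equals [t]. *)
Lemma collapse_add e A L S : collapse e A L ->
  (forall s, s \in S -> #|s| <= e) -> [disjoint A & S] ->
  collapse e (A :|: S) (L :|: S).
Proof.
move=> AL Se; elim: AL => [{}A _|{}A t b {}L [bt tA btA tmax] et _ IH AS].
  exact: collapse_refl.
have notS s : s \in A -> s \notin S.
  by move=> sA; rewrite (disjointFr AS sA).
apply: (@collapse_step _ _ t b) => //.
  split; rewrite ?inE ?tA ?btA // => s; rewrite inE => /orP[|sS ts].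
    exact: tmax.
  left; apply/esym/eqP; rewrite eqEcard ts; exact: leq_trans (Se _ sS) et.
have -> : (A :|: S) :\: [set t; b |: t] = A :\: [set t; b |: t] :|: S.
  apply/setP => s; rewrite !inE andb_orr; congr (_ || _).
  by apply/andb_idl => sS; apply/negP => /orP[]/eqP sE;
    move: sS; rewrite sE; apply/negP; exact: notS.
apply: IH; apply: disjointWl AS; exact: subsetDl.
Qed.

(* Pairs of size below [e] stay in [L] until the critical sets have been removed,
   so that the latter are maximal in [L]. *)
Lemma removal_normal (e : nat) A c : removal A c -> all (pred1 e) c ->
  exists L S, [/\ collapse e A L, #|S| = size c,
    forall s, s \in S -> maximal_in L s /\ #|s| = e & removal (L :\: S) [::]].
Proof.
elim=> {A c} [_|A t b c tb _ IH ce|A s c [sA smax] _ IH].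
- exists set0, set0; split=> //; first exact: collapse_refl.
  + by rewrite cards0.
  + by move=> s; rewrite inE.
  + by rewrite setDv; exact: removal_nil.
- have [L [S [AL Sc Smax LS]]] := IH ce.
  have [et|te] := leqP e #|t|.
    by exists L, S; split=> //; apply: collapse_step tb et AL.
  have [bt tA btA tmax] := tb.
  set P := [set t; b |: t] in AL *.
  have PA : P \subset A by apply/subsetP => s; rewrite !inE => /orP[]/eqP ->.
  have LA := collapse_sub AL.
  have LP : [disjoint L & P].
    by apply: disjointWl LA _; rewrite disjoints_subset setDE subsetIr.
  have SL : S \subset L by apply/subsetP => s /Smax[[]].
  have PS : (L :|: P) :\: S = (L :\: S) :|: P.
    rewrite setDUl; congr (_ :|: _); apply/setDidPl.
    by rewrite disjoint_sym; apply: disjointWl LP.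
  exists (L :|: P), S; split=> //.
  + have -> : A = (A :\: P) :|: P by rewrite -[LHS](setID A P) (setIidPr PA) setUC.
    apply: collapse_add => //.
      move=> s; rewrite !inE => /orP[]/eqP ->; first exact: ltnW.
      by rewrite cardsU1 bt.
    by rewrite disjoints_subset setDE subsetIr.
  + move=> s sS; have [[sL smax] se] := Smax _ sS; split=> //.
    split; first by rewrite inE sL.
    move=> u; rewrite inE => /orP[uL|uP] su; first exact: smax.
    apply/esym/eqP; rewrite eqEcard su se.
    by move: uP; rewrite !inE => /orP[]/eqP ->; rewrite ?cardsU1 ?bt // ltnW.
  + rewrite PS; apply: (@removal_pair _ t b).
      split; rewrite ?inE ?eqxx ?orbT // => s.
      rewrite inE => /orP[/setDP[sL _]|]; last by rewrite !inE => /orP[]/eqP ->; [left|right].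
      by apply: tmax; have := subsetP LA _ sL; rewrite inE => /andP[].
    rewrite -/P setDUl setDv setU0 (setDidPl _) //.
    exact: disjointWl (subsetDl _ _) LP.
- move=> /= /andP[/eqP se ce]; have [L [S [AL Sc Smax LS]]] := IH ce.
  have LA := collapse_sub AL.
  have sL : s \notin L by apply/negP => /(subsetP LA); rewrite !inE eqxx.
  have SL : S \subset L by apply/subsetP => u /Smax[[]].
  exists (s |: L), (s |: S); split.
  + rewrite -(setD1K sA) ![s |: _]setUC; apply: collapse_add => //.
      by move=> u; rewrite inE => /eqP ->; rewrite se.
    by rewrite disjoint_sym disjoints1 !inE eqxx.
  + rewrite cardsU1 Sc; suff -> : s \notin S by [].
    by apply: contra sL => /(subsetP SL).
  + move=> u; rewrite !inE => /orP[/eqP ->|uS].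
      split=> //; split; first by rewrite !inE eqxx.
      move=> v; rewrite !inE => /orP[/eqP -> //|vL]; apply: smax.
      by have := subsetP LA _ vL; rewrite inE => /andP[].
    have [[uL umax] ue] := Smax _ uS; split=> //; split; first by rewrite !inE uL orbT.
    move=> v; rewrite !inE => /orP[/eqP ->|vL]; last exact: umax.
    by move=> us; apply/esym/eqP; rewrite eqEcard us ue se leqnn.
  + suff -> : (s |: L) :\: (s |: S) = L :\: S by []; apply/setP => u; rewrite !inE.
    case: (eqVneq u s) => [->|_] /=; last by [].
    by rewrite (negPf sL) andbF.
Qed.

End families.

(** * Cyclically ordered families *)

Section cyclic.
Context {V : finType} (n : nat) (pt : nat -> V) (G : nat -> nat).
Hypotheses (n_gt0 : 0 < n)
  (pt_eq : forall i j, (pt i == pt j) = (i == j %[mod n]))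
  (pt_surj : forall v, exists i, pt i == v)
  (G_mono : forall i j, i <= j -> G i <= G j)
  (G_add : forall i, G (i + n) = G i + n)
  (G_gt : forall i, i < G i) (G_le : forall i, G i <= i + n).
Implicit Types (Y : {set V}) (i j k x y z : nat) (v : V).

Lemma pt_addM i c : pt (i + c * n) = pt i.
Proof. by apply/eqP; rewrite pt_eq addnC modnMDl. Qed.

Lemma pt_add i : pt (i + n) = pt i.
Proof. by have := pt_addM i 1; rewrite mul1n. Qed.

Lemma pt_congr i j : pt i = pt j -> i <= j -> exists c, j = i + c * n.
Proof.
move=> /eqP; rewrite pt_eq eq_sym => ijn ij; move: ijn.
rewrite eqn_mod_dvd // => /dvdnP[c cE]; exists c; lia.
Qed.

Lemma pt_inj i j : pt i = pt j -> i <= j -> j < i + n -> i = j.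
Proof. by move=> ptij ij; have [[|c] ->] := pt_congr ptij ij; lia. Qed.

Definition ix v : nat := xchoose (pt_surj v).
Lemma ixK v : pt (ix v) = v. Proof. exact: eqP (xchooseP (pt_surj v)). Qed.

(* The first index [k >= j] such that [pt k \in Y], when there is one. *)
Definition nxt Y j := j + find (fun k => pt (j + k) \in Y) (iota 0 n).

Lemma nxt_spec Y j i : pt i \in Y ->
  [/\ j <= nxt Y j, pt (nxt Y j) \in Y, nxt Y j < j + n
    & forall k, j <= k -> k < nxt Y j -> pt k \notin Y].
Proof.
move=> iY; pose k0 := ((i + j * n) - j) %% n.
have k0n : k0 < n by rewrite ltn_mod.
have jkY : pt (j + k0) \in Y.
  rewrite (_ : pt (j + k0) = pt i) //; apply/eqP; rewrite pt_eq modnDmr.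
  rewrite subnKC; first by rewrite addnC modnMDl.
  nia.
have hasP : has (fun k => pt (j + k) \in Y) (iota 0 n).
  by apply/hasP; exists k0 => //; rewrite mem_iota.
have findn := hasP; rewrite has_find size_iota in findn.
split.
- exact: leq_addr.
- by have := nth_find 0 hasP; rewrite nth_iota.
- by rewrite /nxt ltn_add2l.
- move=> k jk kn; have kf : k - j < find (fun k => pt (j + k) \in Y) (iota 0 n).
    by rewrite /nxt in kn; lia.
  have := before_find 0 kf; rewrite nth_iota; last by lia.
  by rewrite add0n subnKC // => ->.
Qed.

Lemma nxt_add Y j : nxt Y (j + n) = nxt Y j + n.
Proof.
rewrite /nxt addnAC; congr (_ + _ + _); apply: eq_find => k.
by rewrite addnAC pt_add.
Qed.

Definition g Y i := nxt Y (G i).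
Definition sc Y i := nxt Y i.+1.

(** * Rotation numbers of the maps [g Y] *)

Section nonempty.
Context (Y : {set V}) (y0 : nat) (Y0 : pt y0 \in Y).

Lemma nxt_ge j : j <= nxt Y j. Proof. by have [] := nxt_spec j Y0. Qed.
Lemma nxt_in j : pt (nxt Y j) \in Y. Proof. by have [] := nxt_spec j Y0. Qed.
Lemma nxt_lt j : nxt Y j < j + n. Proof. by have [] := nxt_spec j Y0. Qed.

Lemma nxt_min j k : pt k \in Y -> j <= k -> nxt Y j <= k.
Proof.
move=> kY jk; rewrite leqNgt; apply/negP => kn.
by have [_ _ _ /(_ _ jk kn)] := nxt_spec j Y0; rewrite kY.
Qed.

Lemma nxt_mono i j : i <= j -> nxt Y i <= nxt Y j.
Proof.
by move=> ij; apply: nxt_min (nxt_in j) _; apply: leq_trans ij (nxt_ge j).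
Qed.

Lemma sc_gt i : i < sc Y i. Proof. exact: nxt_ge. Qed.
Lemma sc_in i : pt (sc Y i) \in Y. Proof. exact: nxt_in. Qed.
Lemma sc_min i k : pt k \in Y -> i < k -> sc Y i <= k. Proof. exact: nxt_min. Qed.
Lemma sc_add i : sc Y (i + n) = sc Y i + n.
Proof. by rewrite /sc -addSn nxt_add. Qed.
Lemma sc_addM i c : sc Y (i + c * n) = sc Y i + c * n.
Proof.
by elim: c => [|c IH]; rewrite ?mul0n ?addn0 // mulSnr !addnA sc_add IH.
Qed.
Lemma sc_le i : sc Y i <= i + n.
Proof. by have := nxt_lt i.+1; rewrite /sc; lia. Qed.

Lemma g_ge i : G i <= g Y i. Proof. exact: nxt_ge. Qed.
Lemma g_gt i : i < g Y i. Proof. exact: leq_trans (G_gt i) (nxt_ge _). Qed.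
Lemma g_in i : pt (g Y i) \in Y. Proof. exact: nxt_in. Qed.
Lemma g_min i k : pt k \in Y -> G i <= k -> g Y i <= k. Proof. exact: nxt_min. Qed.
Lemma g_mono i j : i <= j -> g Y i <= g Y j.
Proof. by move=> ij; apply/nxt_mono/G_mono. Qed.
Lemma g_add i : g Y (i + n) = g Y i + n.
Proof. by rewrite /g G_add nxt_add. Qed.
Lemma g_addM i c : g Y (i + c * n) = g Y i + c * n.
Proof.
by elim: c => [|c IH]; rewrite ?mul0n ?addn0 // mulSnr !addnA g_add IH.
Qed.
Lemma g_le i : pt i \in Y -> g Y i <= i + n.
Proof. by move=> iY; apply: g_min (G_le i); rewrite pt_add. Qed.

Lemma iter_g_in k i : pt i \in Y -> pt (iter k (g Y) i) \in Y.
Proof. by case: k => // k _; rewrite iterS; exact: g_in. Qed.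
Lemma iter_g_addM k i c : iter k (g Y) (i + c * n) = iter k (g Y) i + c * n.
Proof. by elim: k => //= k ->; rewrite g_addM. Qed.
Lemma iter_g_mono k i j : i <= j -> iter k (g Y) i <= iter k (g Y) j.
Proof. by move=> ij; elim: k => //= k; exact: g_mono. Qed.
Lemma iter_g_ge k i : i <= iter k (g Y) i.
Proof. by elim: k => //= k IH; apply: leq_trans IH (ltnW (g_gt _)). Qed.

Lemma iter_wind_le k h w i : iter h (g Y) i <= i + w * n ->
  iter (k * h) (g Y) i <= i + (k * w) * n.
Proof.
move=> hw; elim: k => [|k IH]; first by rewrite !mul0n addn0.
rewrite mulSn iterD; apply: leq_trans (iter_g_mono h IH) _.
by rewrite iter_g_addM mulSn mulnDl; lia.
Qed.

Lemma iter_wind_ge k h w i : i + w * n <= iter h (g Y) i ->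
  i + (k * w) * n <= iter (k * h) (g Y) i.
Proof.
move=> hw; elim: k => [|k IH]; first by rewrite !mul0n addn0.
rewrite [k.+1 * h]mulSn iterD; apply: leq_trans (iter_g_mono h IH).
by rewrite iter_g_addM mulSn mulnDl; lia.
Qed.

Lemma iter_wind_eq k h w i : iter h (g Y) i = i + w * n ->
  iter (k * h) (g Y) i = i + (k * w) * n.
Proof.
move=> hw; apply/eqP; rewrite eqn_leq iter_wind_le ?iter_wind_ge //; lia.
Qed.

(** An orbit that closes up after [H] steps and [W] turns has rotation number [W / H]; gaining more
    than [w] turns in [h] steps means [w / h < W / H]. Both sides come from the position after
    [H * h] steps. *)
Lemma rotation_gt h w H W i : 0 < H -> iter H (g Y) i = i + W * n ->
  i + w * n < iter h (g Y) i -> H * w < h * W.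
Proof.
case: H => // H _ HW hw.
have HWh := iter_wind_eq h HW.
suff : i + (H.+1 * w) * n < iter (H.+1 * h) (g Y) i.
  by rewrite [H.+1 * h]mulnC HWh ltn_add2l ltn_mul2r n_gt0.
have := iter_g_mono h (iter_wind_ge H (ltnW hw)); rewrite iter_g_addM -iterD -mulSn.
by apply: leq_trans; rewrite mulSn mulnDl; lia.
Qed.

Lemma rotation_lt h w H W i : 0 < H -> iter H (g Y) i = i + W * n ->
  iter h (g Y) i < i + w * n -> h * W < H * w.
Proof.
case: H => // H _ HW hw.
have HWh := iter_wind_eq h HW.
suff : iter (H.+1 * h) (g Y) i < i + (H.+1 * w) * n.
  by rewrite [H.+1 * h]mulnC HWh ltn_add2l ltn_mul2r n_gt0.
have := iter_g_mono h (iter_wind_le H (ltnW hw)); rewrite iter_g_addM -iterD -mulSn.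
by move=> /leq_ltn_trans; apply; rewrite mulSn mulnDl; lia.
Qed.

Lemma rotation_eq h w H W i : 0 < H -> iter H (g Y) i = i + W * n ->
  iter h (g Y) i = i + w * n -> h * W = H * w.
Proof.
move=> _ HW hw; have := iter_wind_eq h HW; have := iter_wind_eq H hw.
by rewrite mulnC => -> /addnI/eqP; rewrite eqn_pmul2r // => /eqP.
Qed.

Lemma sc_ind (P : nat -> Prop) y : pt y \in Y -> P y ->
  (forall z, y <= z -> pt z \in Y -> P z -> P (sc Y z)) ->
  forall z, y <= z -> pt z \in Y -> P z.
Proof.
move=> yY Py scP z; have [d] := ubnP (z - y).
elim: d y yY Py scP => // d IH y yY Py scP zd.
rewrite leq_eqVlt => /orP[/eqP <- //|yz] zY.
have sz := sc_min zY yz; have ys := sc_gt y.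
apply: (IH (sc Y y) (sc_in y) (scP _ (leqnn y) yY Py)) => //; last by lia.
by move=> u su uY; apply: scP => //; lia.
Qed.

(** The map of the circle with lift [g Y]; by [gV_pt] the choice of the lift [ix v] is
    immaterial. *)
Definition gV v := pt (g Y (ix v)).

Lemma gV_pt i : gV (pt i) = pt (g Y i).
Proof.
rewrite /gV; have E := ixK (pt i).
have [le|/ltnW le] := leqP (ix (pt i)) i.
  by have [c iE] := pt_congr E le; rewrite [in RHS]iE g_addM pt_addM.
by have [c ->] := pt_congr (esym E) le; rewrite g_addM pt_addM.
Qed.

Lemma iter_gV k i : iter k gV (pt i) = pt (iter k (g Y) i).
Proof. by elim: k => //= k ->; rewrite gV_pt. Qed.

Lemma gV_in v : gV v \in Y. Proof. exact: g_in. Qed.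

Section surjective.
Hypothesis gV_surj : gV @: Y = Y.

Lemma gV_inj : {in Y &, injective gV}.
Proof. by apply/imset_injP; rewrite gV_surj. Qed.

(** A surjective [gV] permutes [Y] in cyclic order, so neighbours go to neighbours: if [g Y] skipped
    a point, a preimage of that point would lie strictly between [z] and [sc Y z]. *)
Lemma g_sc z : pt z \in Y -> g Y (sc Y z) = sc Y (g Y z).
Proof.
move=> zY; apply/eqP; rewrite eqn_leq; apply/andP; split; last first.
  apply: sc_min (g_in _) _; have := g_mono (ltnW (sc_gt z)).
  rewrite leq_eqVlt => /orP[/eqP E|//].
  have scE : pt z = pt (sc Y z) by apply: gV_inj; rewrite ?sc_in ?gV_pt ?E.
  have [[|c] cE] := pt_congr scE (ltnW (sc_gt z)); first by have := sc_gt z; lia.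
  by move: E; rewrite cE g_addM; lia.
have : pt (sc Y (g Y z)) \in gV @: Y by rewrite gV_surj sc_in.
case/imsetP => u uY; rewrite -(ixK u) gV_pt => E.
set i := ix u in E; pose c0 := g Y i.
(* Indices cannot be negative, so a multiple of [n] is added to bring the two lifts into the order
   that [pt_congr] expects. *)
have [c cE] : exists c, sc Y (g Y z) + c0 * n = g Y i + c * n.
  have le : g Y i <= sc Y (g Y z) + c0 * n by rewrite /c0; nia.
  have eqpt : pt (g Y i) = pt (sc Y (g Y z) + c0 * n) by rewrite pt_addM.
  by have [c ->] := pt_congr eqpt le; exists c.
rewrite -(leq_add2r (c0 * n)) cE -!g_addM -!sc_addM; apply: g_mono.
apply: sc_min; first by rewrite pt_addM ixK.
rewrite ltnNge; apply/negP => /g_mono; rewrite !g_addM -cE.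
by have := sc_gt (g Y z); lia.
Qed.

Lemma iter_g_sc k z : pt z \in Y -> iter k (g Y) (sc Y z) = sc Y (iter k (g Y) z).
Proof. by move=> zY; elim: k => //= k ->; rewrite g_sc // iter_g_in. Qed.

(** Iterates of [g Y] commute with [sc Y], so the identity spreads from [y] to its successor and on
    around the circle. *)
Lemma wind_all h w y z : pt y \in Y -> pt z \in Y ->
  iter h (g Y) y = y + w * n -> iter h (g Y) z = z + w * n.
Proof.
move=> yY zY hw.
suff all_ge u : y <= u -> pt u \in Y -> iter h (g Y) u = u + w * n.
  have le : y <= z + y * n by nia.
  by have := all_ge _ le; rewrite pt_addM iter_g_addM => /(_ zY); lia.
move=> yu uY; apply: (@sc_ind (fun u => iter h (g Y) u = u + w * n) y) => //.
by move=> u' _ u'Y E; rewrite iter_g_sc // E sc_addM.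
Qed.

End surjective.
End nonempty.

(** * Orbits after the deletion of a point *)

Section restriction.
Context (Y : {set V}) (x : nat) (xY : pt x \in Y).
Local Notation Yx := (Y :\ pt x).

Lemma g_del y0 i : pt y0 \in Yx -> pt (g Y i) != pt x -> g Yx i = g Y i.
Proof.
move=> Y0 gx; apply/eqP; rewrite eqn_leq; apply/andP; split.
  by apply: (g_min Y0) (g_ge xY i); rewrite !inE gx (g_in xY).
by apply: (g_min xY) (g_ge Y0 i); have := g_in Y0 i; rewrite inE => /andP[].
Qed.

Lemma g_del_hit y0 i : pt y0 \in Yx -> pt (g Y i) = pt x -> g Yx i = sc Y (g Y i).
Proof.
move=> Y0 gx; have gYx := g_in Y0 i.
have [gne gY] : pt (g Yx i) != pt x /\ pt (g Yx i) \in Y.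
  by move: gYx; rewrite !inE => /andP[].
apply/eqP; rewrite eqn_leq; apply/andP; split; last first.
  apply: (sc_min xY) => //; rewrite ltn_neqAle; apply/andP; split.
    by apply: contraNneq gne => <-; rewrite gx.
  exact: (g_min xY) (g_ge Y0 i).
apply: (g_min Y0); last by apply: leq_trans (g_ge xY i) (ltnW (sc_gt xY _)).
rewrite !inE (sc_in xY) andbT; apply/eqP => E.
have scE : pt (g Y i) = pt (sc Y (g Y i)) by rewrite E.
have [c cE] := pt_congr scE (ltnW (sc_gt xY _)).
have lt : g Y i < g Yx i.
  rewrite ltn_neqAle (g_min xY gY (g_ge Y0 i)) andbT.
  by apply: contraNneq gne => <-; rewrite gx.
have := sc_min xY gY lt; have := nxt_lt Y0 (G i); have := g_ge xY i.
by have := sc_gt xY (g Y i); rewrite cE /g; case: (c) => [|c']; nia.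
Qed.

Lemma iter_g_del y0 h y : pt y0 \in Yx -> 
  (forall i, 0 < i <= h -> pt (iter i (g Y) y) != pt x) ->
  iter h (g Yx) y = iter h (g Y) y.
Proof.
move=> Y0; elim: h => // h IH avoid; rewrite !iterS IH.
  by rewrite (g_del Y0) // -iterS avoid ?leqnn.
by move=> i /andP[i0 ih]; rewrite avoid // i0 (leq_trans ih).
Qed.

(** The orbits part only when a step would land on [x]; the new orbit is then diverted to the
    successor of [x], and nothing is claimed beyond that. *)
Lemma iter_g_del_hit y0 h y : pt y0 \in Yx ->
  iter h (g Yx) y = iter h (g Y) y \/
  exists2 i, i <= h & pt (iter i (g Yx) y) = pt (sc Y x).
Proof.
move=> Y0; elim: h => [|h [IH|[i ih iE]]]; first by left.
  have [hit|nhit] := eqVneq (pt (g Y (iter h (g Y) y))) (pt x); last first.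
    by left; rewrite !iterS IH (g_del Y0).
  right; exists h.+1 => //; rewrite iterS IH (g_del_hit Y0) //.
  have [le|/ltnW le] := leqP x (g Y (iter h (g Y) y)).
    by have [c ->] := pt_congr (esym hit) le; rewrite sc_addM pt_addM.
  by have [c ->] := pt_congr hit le; rewrite sc_addM pt_addM.
by right; exists i => //; apply: leqW.
Qed.

End restriction.

(** * Deleting vertices one by one *)

Section hereditary.
Context (K : {set {set V}}) (h w : nat -> nat).
Definition induced Y := [set s in K | s \subset Y].

(* The critical orbits make [w m] turns in [h m] steps: [h m = m] and [w m = 1]
   for the Čech complex, [h m = 2 m - 1] and [w m = m] for the Vietoris-Rips
   complex. *)
Definition link_type Y x (c : seq nat) : Prop :=
  [\/ c = [::],
      exists m, [/\ 0 < m, c = [:: (2 * m - 2)%N]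
                  & iter (h m) (g Y) x = x + w m * n]
    | exists m, [/\ 0 < m, c = [:: (2 * m - 1)%N],
        iter (h m) (g Y) (sc Y x) = x + w m * n,
        x + w m.+1 * n < iter (h m.+1) (g Y) x
      & forall i, i < h m -> pt (iter i (g Y) (sc Y x)) != pt x]].

Hypotheses (K_down : down_closed K) (K1 : forall v, [set v] \in K)
  (h_gt0 : forall m, 0 < m -> 0 < h m)
  (hw_decr : forall m m', 0 < m -> m < m' -> w m' * h m < w m * h m')
  (link_tree : forall Y x, pt x \in Y ->
     exists2 c, tree (lk (pt x) (induced Y)) c & link_type Y x c)
  (single_orbit : forall Y y m, 0 < m -> pt y \in Y ->
     iter (h m) (g Y) y = y + w m * n ->
     (forall v, v \in Y -> fconnect (gV Y) (pt y) v) -> Y \in K).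

Lemma induced_del Y v : del v (induced Y) = induced (Y :\ v).
Proof.
by apply/setP => s; rewrite !inE subsetD1 andbA.
Qed.

Lemma tree_induced Y v c c' : tree (lk v (induced Y)) c ->
  tree (induced (Y :\ v)) c' -> tree (induced Y) (map S c ++ c').
Proof. by move=> tc tc'; apply: tree_split tc _; rewrite induced_del. Qed.

Lemma tree_full Y y : pt y \in Y -> Y \in K -> tree (induced Y) [::].
Proof.
move=> yY YK; apply: (@tree_cone _ (pt y)) => s; rewrite !inE => /andP[sK sY].
have ysY : pt y |: s \subset Y by rewrite subUset sub1set yY.
by rewrite ysY andbT; apply: K_down YK ysY.
Qed.

(** In both cases with an unmatched face, [x] ends an orbit segment of positive length. Hence a
    point outside the image of [gV Y] can be deleted at no cost. *)
Lemma link_type_image Y x c : link_type Y x c -> pt x \in Y ->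
  c = [::] \/ pt x \in gV Y @: Y.
Proof.
have image m y : pt x \in Y -> pt y \in Y -> 0 < m ->
    iter (h m) (g Y) y = x + w m * n -> pt x \in gV Y @: Y.
  move=> xY yY m0 E; have hE := prednK (h_gt0 m0).
  rewrite -(pt_addM x (w m)) -E -hE iterS -gV_pt; apply: imset_f.
  exact: (iter_g_in xY).
move=> + xY; case=> [->|[m [m0 _ E]]|[m [m0 _ E _ _]]]; first by left.
  by right; apply: image E.
by right; apply: image E => //; apply: (sc_in xY).
Qed.

(** In the second case the rotation number is also [w m' / h m'], so [m' = m]. In the third, the
    orbit of [x] puts it above [w m'.+1 / h m'.+1] and that of the successor puts it below
    [w m' / h m']; no [m] lies strictly between [m'] and [m'.+1]. *)
Lemma link_type_periodic Y x c m : 0 < m -> pt x \in Y ->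
  iter (h m) (g Y) x = x + w m * n ->
  iter (h m) (g Y) (sc Y x) = sc Y x + w m * n ->
  link_type Y x c -> c = [::] \/ c = [:: (2 * m - 2)%N].
Proof.
move=> m0 xY xm sm; case=> [->|[m' [m'0 -> E]]|[m' [m'0 _ E1 E2 _]]]; first by left.
  right; congr [:: _ * _ - _].
  have := rotation_eq xY (h_gt0 m0) xm E => hw.
  have [mm|mm|//] := ltngtP m' m; [have := hw_decr m'0 mm|have := hw_decr m0 mm]; lia.
have := sc_gt xY x => xs.
have lt1 : iter (h m') (g Y) (sc Y x) < sc Y x + w m' * n by rewrite E1; lia.
have := rotation_lt xY (h_gt0 m0) sm lt1.
have := rotation_gt xY (h_gt0 m0) xm E2.
have [mm|mm|->] := ltngtP m' m; last by lia.
  move: mm; rewrite leq_eqVlt => /orP[/eqP ->|mm]; first by lia.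
  by have := hw_decr (ltn0Sn m') mm; lia.
by have := hw_decr m0 mm; lia.
Qed.

Lemma periodic_fconnect Y y m j : 0 < m -> pt y \in Y ->
  iter (h m) (g Y) y = y + w m * n -> pt (iter j (g Y) y) \in gV Y @: Y.
Proof.
move=> m0 yY E; have hE := prednK (h_gt0 m0).
have <- : pt (iter (j + h m) (g Y) y) = pt (iter j (g Y) y).
  by rewrite iterD E iter_g_addM pt_addM.
by rewrite -hE addnS iterS -gV_pt; apply/imset_f/(iter_g_in yY).
Qed.

(** For a permutation, a point that eventually enters a periodic orbit is already on it: injectivity
    allows stepping back. *)
Lemma fconnect_inj Y y m v i : gV Y @: Y = Y -> 0 < m -> pt y \in Y -> v \in Y ->
  iter (h m) (g Y) y = y + w m * n ->
  fconnect (gV Y) (pt y) (iter i (gV Y) v) -> fconnect (gV Y) (pt y) v.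
Proof.
move=> surj m0 yY vY E; elim: i => // i IH con; apply: IH.
have hE := prednK (h_gt0 m0).
have yper : iter (h m) (gV Y) (pt y) = pt y by rewrite iter_gV E pt_addM.
have iterin k u : u \in Y -> iter k (gV Y) u \in Y.
  by rewrite -(ixK u) iter_gV; apply: (iter_g_in yY).
set k := findex (gV Y) (pt y) (iter i.+1 (gV Y) v).
(* Adding a full period gives the iterate a predecessor on the orbit even when [k] is 0. *)
have : iter i.+1 (gV Y) v = iter (k + h m) (gV Y) (pt y).
  by rewrite iterD yper iter_findex.
rewrite -hE addnS !iterS.
by move/(gV_inj surj) -> => //; rewrite ?fconnect_iter ?iterin.
Qed.

(** While [gV Y] is not onto, deleting a point outside its image costs nothing and changes no orbit.
    When it is a permutation, all points turn like [y], so deleting a point off the orbit of [y]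
    costs at most one critical set, of size [2 * m - 1]. A single orbit is a simplex of [K]. If
    every point eventually enters the orbit of [y], the costly kind of deletion never occurs. *)
Lemma induced_periodic Y y m : 0 < m -> pt y \in Y ->
  iter (h m) (g Y) y = y + w m * n ->
  exists2 k, tree (induced Y) (nseq k (2 * m - 1)%N)
    & (forall v, v \in Y -> exists i, fconnect (gV Y) (pt y) (iter i (gV Y) v)) -> k = 0.
Proof.
have [N] := ubnP #|Y|; elim: N Y y => // N IH Y y YN m0 yY ym.
have card_del v : v \in Y -> #|Y :\ v| < N.
  by move=> vY; rewrite -ltnS (leq_trans _ YN) // ltnS (cardsD1 v Y) vY.
have [surj|nsurj] := eqVneq (gV Y @: Y) Y; last first.
  have : gV Y @: Y \proper Y.
    rewrite properEneq nsurj; apply/subsetP => _ /imsetP[v _ ->].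
    exact: (gV_in yY).
  case/properP => _ [v vY vim]; rewrite -(ixK v) in vY vim.
  set x := ix v in vY vim.
  have avoid i z : 0 < i -> pt z \in Y -> pt (iter i (g Y) z) != pt x.
    case: i => // i _ zY; apply: contraNneq vim => <-.
    by rewrite iterS -gV_pt; apply/imset_f/(iter_g_in yY).
  have yY' : pt y \in Y :\ pt x.
    rewrite !inE yY andbT; apply: contraNneq vim => <-.
    exact: (@periodic_fconnect Y y m 0).
  have gE k z : pt z \in Y -> iter k (g (Y :\ pt x)) z = iter k (g Y) z.
    by move=> zY; apply: (iter_g_del vY yY') => i /andP[i0 _]; apply: avoid.
  have [||k tk k0] := IH (Y :\ pt x) y _ m0 yY' _; rewrite ?card_del ?gE //.
  exists k.
    have [c tc ct] := link_tree vY.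
  have [cE|] := link_type_image ct vY; last by rewrite (negPf vim).
    by rewrite cE in tc; exact: (tree_induced tc tk).
  move=> U; apply: k0 => u; rewrite inE => /andP[_ uY].
  have [i ui] := U u uY; exists i; rewrite -(ixK u) in uY ui *.
  rewrite iter_gV gE // -iter_gV.
  by rewrite -(iter_findex ui) iter_gV -gE // -iter_gV fconnect_iter.
have [all_orb|] := boolP [forall v in Y, fconnect (gV Y) (pt y) v].
  exists 0 => //; apply: (tree_full yY); apply: single_orbit ym _ => //.
  by move=> v vY; apply: (forall_inP all_orb).
case/forall_inPn => v vY vorb; rewrite -(ixK v) in vY vorb *.
set x := ix v in vY vorb.
have avoid i : pt (iter i (g Y) y) != pt x.
  by apply: contraNneq vorb => <-; rewrite -iter_gV fconnect_iter.
have yY' : pt y \in Y :\ pt x by rewrite !inE yY (avoid 0).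
have [||k tk _] := IH (Y :\ pt x) y _ m0 yY' _; rewrite ?card_del //.
  by rewrite (iter_g_del vY yY').
have [c tc ct] := link_tree vY.
have type z : pt z \in Y -> iter (h m) (g Y) z = z + w m * n.
  by move=> zY; apply: (wind_all yY surj yY zY ym).
have noU : ~ (forall v, v \in Y ->
    exists i, fconnect (gV Y) (pt y) (iter i (gV Y) v)).
  move=> U; have [i /fconnect_inj con] := U _ vY.
  by rewrite (con m) in vorb.
have := link_type_periodic m0 vY (type _ vY) (type _ (sc_in yY x)) ct.
case=> cE; rewrite cE in tc.
  by exists k => [|/noU//]; apply: (tree_induced tc tk).
exists k.+1 => [|/noU//]; have := tree_induced tc tk => /=.
by rewrite (_ : (2 * m - 2).+1 = 2 * m - 1) //; lia.
Qed.

(** The new case is the third link type. Deleting [y] diverts the step that hit [y] to its successor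
    [s], so the orbit of [s] closes up. As all remaining points end in that orbit,
    [induced_periodic] adds no critical set to the one from the link. *)
Theorem induced_tree Y y : pt y \in Y -> exists2 c, tree (induced Y) c &
  [\/ c = [::], exists2 m, 0 < m & c = [:: 2 * m]
    | exists m k, 0 < m /\ c = nseq k (2 * m - 1)].
Proof.
have [N] := ubnP #|Y|; elim: N Y y => // N IH Y y YN yY.
have card_del v : v \in Y -> #|Y :\ v| < N.
  by move=> vY; rewrite -ltnS (leq_trans _ YN) // ltnS (cardsD1 v Y) vY.
have rem v : v \in Y -> tree (lk v (induced Y)) [::] ->
    exists2 c, tree (induced Y) c &
    [\/ c = [::], exists2 m, 0 < m & c = [:: 2 * m]
    | exists m k, 0 < m /\ c = nseq k (2 * m - 1)].
  move=> vY tv; have [E|[u uY]] := set_0Vmem (Y :\ v).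
    exists [::]; last by constructor 1.
    have YE : Y = [set v] by rewrite -(setD1K vY) E setU0.
    by rewrite -(ixK v) in YE vY *; apply: (tree_full vY); rewrite YE K1.
  rewrite -(ixK u) in uY; have [c tc ct] := IH _ _ (card_del _ vY) uY.
  by exists c => //; apply: (tree_induced tv tc).
have [surj|nsurj] := eqVneq (gV Y @: Y) Y; last first.
  have : gV Y @: Y \proper Y.
    rewrite properEneq nsurj; apply/subsetP => _ /imsetP[v _ ->].
    exact: (gV_in yY).
  case/properP => _ [v vY vim]; rewrite -(ixK v) in vY vim.
  have [c tc ct] := link_tree vY.
  have [cE|] := link_type_image ct vY; last by rewrite (negPf vim).
  by apply: rem vY _; rewrite -cE.
have [c tc [cE|[m [m0 cE E]]|[m [m0 cE E _ avoid]]]] := link_tree yY.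
- by apply: rem yY _; rewrite -cE.
- have [k tk _] := induced_periodic m0 yY E.
  by exists (nseq k (2 * m - 1)) => //; constructor 3; exists m, k.
set Y' := Y :\ pt y; set s := sc Y y in E avoid.
have sY' : pt s \in Y' by rewrite !inE (sc_in yY) (avoid 0) ?h_gt0.
have hE := prednK (h_gt0 m0).
have sm : iter (h m) (g Y') s = s + w m * n.
  rewrite -hE iterS (iter_g_del yY sY').
    rewrite (g_del_hit yY sY'); rewrite -iterS hE E ?pt_addM //.
    by rewrite sc_addM.
  by move=> i /andP[_ ih]; rewrite avoid // -hE.
have [k tk k0] := induced_periodic m0 sY' sm.
exists (map S c ++ nseq k (2 * m - 1)); first exact: tree_induced tc tk.
constructor 2; exists m => //; rewrite cE k0 /=; first by congr [:: _]; lia.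
(* The bound keeps out the next copy of [y], which is not a point of [Y']. *)
pose C z := z < y + n -> exists i, fconnect (gV Y') (pt s) (pt (iter i (g Y') z)).
have Cs : C s by move=> _; exists 0.
have pred z : y <= z -> pt z \in Y -> iter (h m) (g Y) (sc Y z) = z + w m * n.
  move=> yz zY; move: z yz zY.
  apply: (@sc_ind Y y yY (fun z => iter (h m) (g Y) (sc Y z) = z + w m * n) y) => //.
  move=> z yz zY zE; rewrite (iter_g_sc yY surj) ?(sc_in yY) // zE.
  exact: sc_addM.
have ys : y < s := sc_gt yY y.
(* In [Y], [h m] steps lead from [sc Y z] to a copy of [z]. In [Y'] the orbit does the same or meets
   [s] on its way, so the property passes from [z] to [sc Y z]. *)
have allC z : s <= z -> pt z \in Y -> C z.
  move=> sz zY; move: z sz zY.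
  apply: (@sc_ind Y y yY C s) => //; first exact: (sc_in yY).
  move=> z sz zY Cz scn.
  have [hE'|[i _ iE]] := iter_g_del_hit yY (h m) (sc Y z) sY'; last first.
    by exists i; rewrite iE.
  rewrite pred // in hE'; last by lia.
  have [|i ci] := Cz; first by have := sc_gt yY z; lia.
  by exists (i + h m); rewrite iterD hE' iter_g_addM pt_addM.
move=> v; rewrite !inE => /andP[vy vY].
pose z0 := y + (ix v + y * n - y) %% n.
have vz : pt z0 = v.
  rewrite -[RHS](ixK v); apply/eqP; rewrite pt_eq modnDmr subnKC; last by nia.
  by rewrite addnC modnMDl.
have zn : z0 < y + n by rewrite ltn_add2l ltn_mod.
have [||i ci] := allC z0 _ _ zn; rewrite ?vz //.
  apply: (sc_min yY); rewrite ?vz // ltn_neqAle leq_addr andbT.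
  by apply: contraNneq vy => yz; rewrite -vz -yz.
by exists i; rewrite -vz iter_gV.
Qed.

End hereditary.

Section positions.
Variable x : nat.
Local Notation X := (x + n).

Definition pos v := x + (ix v + x * n - x) %% n.

Lemma pos_ge v : x <= pos v. Proof. exact: leq_addr. Qed.
Lemma pos_lt v : pos v < X. Proof. by rewrite ltn_add2l ltn_mod. Qed.
Lemma posK v : pt (pos v) = v.
Proof.
rewrite -[RHS](ixK v); apply/eqP; rewrite pt_eq modnDmr subnKC; last by nia.
by rewrite addnC modnMDl.
Qed.
Lemma pos_pt i : x <= i -> i < X -> pos (pt i) = i.
Proof.
move=> xi iX; have := posK (pt i); have := pos_ge (pt i); have := pos_lt (pt i).
have [le|/ltnW le] := leqP (pos (pt i)) i => lt ge E.
  by apply: (pt_inj E le); lia.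
by apply/esym/(pt_inj (esym E) le); lia.
Qed.
Lemma pos_inj v i : pos v = i -> v = pt i. Proof. by move=> <-; rewrite posK. Qed.

End positions.

Section dominated.
Implicit Types A : {set {set V}}.

(** The link of [v] is a cone with apex [u], so splitting at [v] leaves nothing unmatched there. *)
Lemma tree_dominated A u v c : u != v ->
  (forall s, s \in A -> v \in s -> u |: s \in A) ->
  tree (del v A) c -> tree A c.
Proof.
move=> uv uA tc; rewrite -[c]/(map S [::] ++ c); apply: tree_split tc.
apply: (@tree_cone _ u) => s; rewrite !inE => /andP[vs vsA].
rewrite negb_or eq_sym uv vs /= setUCA; apply: uA vsA _.
by rewrite !inE eqxx.
Qed.

Lemma tree_dominated_set A u (D : {set V}) c : u \notin D ->
  (forall v s, v \in D -> s \in A -> v \in s -> u |: s \in A) ->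
  tree [set s in A | [disjoint s & D]] c -> tree A c.
Proof.
have [N] := ubnP #|D|; elim: N D A => // N IH D A DN uD uA tc.
have [D0|[v vD]] := set_0Vmem D.
  rewrite (_ : A = [set s in A | [disjoint s & D]]) //; apply/setP => s.
  by rewrite inE D0 disjoints_subset setC0 subsetT andbT.
have uv : u != v by apply: contraNneq uD => ->.
apply: (tree_dominated uv (uA v ^~ vD)); apply: (IH (D :\ v)).
- by rewrite -ltnS (leq_trans _ DN) // ltnS (cardsD1 v D) vD.
- by rewrite !inE negb_and uD orbT.
- move=> z s; rewrite !inE => /andP[_ zD] /andP[sA vs] zs.
  by rewrite (uA z) //= negb_or eq_sym uv.
- rewrite (_ : [set _ in _ | _] = [set s in A | [disjoint s & D]]) //.
  apply/setP => s; rewrite !inE -andbA; congr (_ && _).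
  rewrite ![[disjoint s & _]]disjoint_sym !disjoints_subset.
  by rewrite -[in RHS](setD1K vD) subUset sub1set inE.
Qed.

End dominated.

Section orbit_lift.
Context (f : nat -> nat) (f_add : forall i, f (i + n) = f i + n)
  (f_gt : forall i, i < f i) (y p : nat) (fp : iter p f y = y + n).

Lemma iter_f_addM k i c : iter k f (i + c * n) = iter k f i + c * n.
Proof.
elim: k => //= k ->; set j := iter k f i; elim: c => [|c IHc].
  by rewrite mul0n !addn0.
by rewrite mulSnr !addnA f_add IHc.
Qed.

Lemma iter_f_period c k : iter (k + c * p) f y = iter k f y + c * n.
Proof.
elim: c => [|c IH]; first by rewrite !mul0n !addn0.
rewrite mulSnr addnA iterD fp -[n in LHS]mul1n iter_f_addM IH; lia.
Qed.

Lemma iter_f_lt k l : (iter k f y < iter l f y) = (k < l).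
Proof.
have mono : {homo (fun k => iter k f y) : a b / a < b}.
  by apply: homo_ltn => [a b c|a]; [exact: ltn_trans|exact: f_gt].
by have [/mono->//|/mono lt|->] := ltngtP k l; last exact: ltnn; apply/negP; lia.
Qed.

(** As [p] steps of [f] amount to exactly one turn, all sufficiently high copies of a point on the
    orbit are iterates of [y]. By [iter_f_lt] the cyclic order then becomes the order of
    exponents. *)
Lemma orbit_lift z k : pt z = pt (iter k f y) ->
  exists C0, forall C, C0 <= C -> exists l, z + C * n = iter l f y.
Proof.
move=> E; have [le|/ltnW le] := leqP (iter k f y) z.
  have [c cE] := pt_congr (esym E) le; exists 0 => C _; exists (k + (c + C) * p).
  by rewrite iter_f_period cE; lia.
have [c cE] := pt_congr E le; exists c => C cC; exists (k + (C - c) * p).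
rewrite iter_f_period cE mulnBl; have : c * n <= C * n by rewrite leq_mul2r cC orbT.
lia.
Qed.

End orbit_lift.

(** * Čech complexes: sets missing an arc *)

Section arcs.
Context (K : {set {set V}}).
Hypothesis K_arc : forall s : {set V},
  reflect (exists i, forall j, i < j -> j < G i -> pt j \notin s) (s \in K).

Section arc_link.
Context (Y : {set V}) (x : nat) (xY : pt x \in Y).
Local Notation X := (x + n).

(* The link of [pt x] in [induced K Y] is [gap_sets x (sc Y x)], and the family is
   stable under the links and deletions that the greedy matching performs. *)
Definition gap_sets b t : {set {set V}} :=
  [set s : {set V} | [forall v in s, (v \in Y) && (t <= pos x v)] &&
    [exists i : 'I_X.+1, [&& b <= i, G i <= X
      & [forall v in s, ~~ (i < pos x v < G i)]]]].

Lemma gap_setsP b t (s : {set V}) : reflect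
  ((forall v, v \in s -> v \in Y /\ t <= pos x v) /\
   exists i, [/\ b <= i, G i <= X & forall v, v \in s -> ~~ (i < pos x v < G i)])
  (s \in gap_sets b t).
Proof.
rewrite inE; apply: (iffP andP) => -[H1 H2]; split.
- by move=> v vs; have /andP[] := forall_inP H1 v vs.
- have /existsP[i /and3P[bi iX H]] := H2; exists i; split=> //.
  exact/forall_inP.
- by apply/forall_inP => v /H1[-> ->].
- have [i [bi iX H]] := H2; apply/existsP.
  have iX1 : i < X.+1 by have := G_gt i; lia.
  by exists (Ordinal iX1); rewrite bi iX; apply/forall_inP.
Qed.

Lemma G_congr i i' : pt i = pt i' -> G i + i' = G i' + i.
Proof.
have G_addM j c : G (j + c * n) = G j + c * n.
  by elim: c => [|c IH]; rewrite ?mul0n ?addn0 // mulSnr !addnA G_add IH.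
move=> E; have [le|/ltnW le] := leqP i i'.
  by have [c ->] := pt_congr E le; rewrite G_addM; lia.
by have [c ->] := pt_congr (esym E) le; rewrite G_addM; lia.
Qed.

Lemma pt_neq_base j : x < j -> j < X -> pt j != pt x.
Proof.
move=> xj jX; apply/eqP => E.
by have := pt_inj (esym E) (ltnW xj) jX; lia.
Qed.

(** The missed arc can be translated so that it starts in [[x, x + n)]. It must then end by [x + n],
    or else it would contain that copy of [x]. *)
Lemma lk_gap_sets : lk (pt x) (induced K Y) = gap_sets x (sc Y x).
Proof.
apply/setP => s; rewrite [s \in lk _ _]inE [_ \in induced _ _]inE subUset sub1set xY /=.
apply/and3P/gap_setsP => [[xs /K_arc[i iE] /subsetP sY]|[sY [i [xi iX iE]]]].
  split.
    move=> v vs; split; first exact: sY.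
    apply: (sc_min xY); first by rewrite posK sY.
    rewrite ltn_neqAle pos_ge andbT; apply: contraNneq xs => E.
    by rewrite E posK.
  pose i' := pos x (pt i); have i'E : pt i = pt i' by rewrite posK.
  have avoid j : i' < j -> j < G i' -> pt j \notin pt x |: s.
    move=> i'j jG; have GE := G_congr i'E.
    have <- : pt (i + (j - i')) = pt j.
      have [le|/ltnW le] := leqP i i'.
        have [c cE] := pt_congr i'E le.
        have -> : j = i + (j - i') + c * n by lia.
        by rewrite pt_addM; congr pt; lia.
      have [c cE] := pt_congr (esym i'E) le.
      have -> : i + (j - i') = j + c * n by lia.
      by rewrite pt_addM.
    by apply: iE; lia.
  exists i'; split; first exact: pos_ge.
    rewrite leqNgt; apply/negP => GX.
    have := avoid X (pos_lt _ _) GX; rewrite pt_add !inE eqxx //.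
  move=> v vs; apply/negP => /andP[/avoid H /H].
  by rewrite posK !inE vs orbT.
have sx v : v \in s -> x < pos x v.
  by move=> /sY[_]; apply: leq_trans; exact: sc_gt xY x.
split.
- apply/negP => /sx; rewrite pos_pt //; lia.
- apply/K_arc; exists i => j ij jG.
  have := G_gt i => iG; have xj : x < j by lia.
  have jX : j < X by lia.
  rewrite !inE negb_or pt_neq_base //=; apply/negP => /iE.
  by rewrite pos_pt ?ij ?jG // ltnW.
- by apply/subsetP => v /sY[].
Qed.

(** Each matching step of [gap_sets_tree] replaces [(b, t)] by [(t, g Y b)], so the two starting
    indices are iterated in turn. At the end one of them lands exactly on [x + n] and the other one
    jumps over it. *)
Fixpoint arc_chain j b t : Prop :=
  if j is j'.+1 then arc_chain j' t (g Y b) else g Y b = X /\ X < g Y t.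

(** The points of [Y] strictly between [t] and [G b] are dominated by [t]: a set containing one of
    them misses an arc starting at or after it, so [t] can be added. Without these points, the link
    of [t] is the family for [(t, g Y b)], and the deletion of [t] consists of all sets of points
    from [g Y b] on. *)
Lemma gap_sets_tree b t : x <= b -> b < t -> t <= X -> pt t \in Y -> t <= g Y b ->
  exists2 c, tree (gap_sets b t) c
    & c = [::] \/ exists2 j, c = [:: j] & arc_chain j b t.
Proof.
have [N] := ubnP (X - b); elim: N b t => // N IH b t bN xb bt tX tY tgb.
have XY : pt X \in Y by rewrite pt_add.
have [GX|XG] := leqP (G b) X; last first.
  exists [::]; last by left.
  (* No arc fits, so the family is empty and any apex will do. *)
  apply: (@tree_cone _ (pt 0)) => s /gap_setsP[_ [i [bi iX _]]].
  by have := G_mono bi; lia.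
have gbX : g Y b <= X by apply: (g_min xY).
have in_gap (s : {set V}) : (forall v, v \in s -> v \in Y /\ t <= pos x v) ->
    (forall v, v \in s -> G b <= pos x v) -> s \in gap_sets b t.
  move=> H1 H2; apply/gap_setsP; split=> //; exists b; split=> // v /H2.
  by lia.
(* In the first case the arc at [b] is missed automatically: the family is a full simplex, or
   [[set set0]] when [t] has reached [x + n]. *)
have [Gbt|tGb] := leqP (G b) t.
  move: tX; rewrite leq_eqVlt => /orP[/eqP tX|tX].
    exists [:: 0]; last first.
      right; exists 0 => //=; split; last by rewrite -tX; apply: (g_gt xY).
      by apply/eqP; rewrite eqn_leq gbX -tX.
    rewrite (_ : gap_sets b t = [set set0]); first exact: tree_top.
    apply/setP => s; rewrite [in RHS]inE; apply/idP/eqP => [/gap_setsP[sY _]|->].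
      apply/setP => v; rewrite inE; apply/negP => /sY[_].
      by rewrite tX leqNgt pos_lt.
    by apply: in_gap => v; rewrite inE.
  exists [::]; last by left.
  apply: (@tree_cone _ (pt t)) => s /gap_setsP[sY _].
  have tsY v : v \in pt t |: s -> v \in Y /\ t <= pos x v.
    rewrite !inE => /orP[/eqP ->|/sY//]; split=> //.
    by rewrite pos_pt //; lia.
  by apply: in_gap => // v /tsY[_]; apply: leq_trans.
pose D := [set v in Y | t < pos x v < G b].
have tX' : t < X by lia.
have post : pos x (pt t) = t by rewrite pos_pt //; lia.
pose A := [set s in gap_sets b t | [disjoint s & D]].
have toA c : tree A c -> tree (gap_sets b t) c.
  apply: (@tree_dominated_set _ (pt t)).
    by rewrite inE post ltnn andbF.
  move=> v s; rewrite inE => /andP[vY /andP[tv vG]] /gap_setsP[sY [i [bi iX iE]]] vs.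
  have vi : pos x v <= i.
    by have := iE _ vs; have := G_mono bi; lia.
  apply/gap_setsP; split.
    by move=> u; rewrite !inE => /orP[/eqP ->|/sY//]; rewrite post.
  exists i; split=> // u; rewrite !inE => /orP[/eqP ->|/iE//].
  by rewrite post; lia.
have far v : v \in Y -> t <= pos x v -> v \notin D -> v != pt t -> g Y b <= pos x v.
  move=> vY tv vD vt; apply: (g_min xY); first by rewrite posK.
  have : t != pos x v by apply: contraNneq vt => E; rewrite (pos_inj (esym E)).
  by move: vD; rewrite !inE vY /=; lia.
have farD v : g Y b <= pos x v -> v \notin D.
  by move=> gv; rewrite inE; have := g_ge xY b; lia.
have lkA : lk (pt t) A = gap_sets t (g Y b).
  apply/setP => s; rewrite inE [in X in _ && X]inE.
  apply/and3P/gap_setsP => [[ts /gap_setsP[sY [i [bi iX iE]]] dis]|[sY [i [ti iX iE]]]].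
    split.
      move=> v vs; have vts : v \in pt t |: s by rewrite !inE vs orbT.
      have [vY tv] := sY _ vts; split=> //; apply: far => //.
        by rewrite (disjointFr dis).
      by apply: contraNneq ts => <-.
    exists i; split=> //.
      have := iE (pt t); rewrite !inE eqxx post => /(_ isT).
      by have := G_mono bi; lia.
    by move=> v vs; apply: iE; rewrite !inE vs orbT.
  have gG := g_ge xY b.
  split.
  - by apply/negP => /sY[_]; rewrite post; lia.
  - apply/gap_setsP; split.
      move=> v; rewrite !inE => /orP[/eqP ->|/sY[vY gv]]; first by rewrite post.
      by split=> //; lia.
    exists i; split=> //; first by lia.
    move=> v; rewrite !inE => /orP[/eqP ->|/iE//]; rewrite post; lia.
  - rewrite disjoints_subset; apply/subsetP => v; rewrite inE in_setC inE.
    case/orP => [/eqP ->|/sY[_ /farD//]].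
    by rewrite !inE post ltnn andbF.
have delA (s : {set V}) : s \in del (pt t) A ->
    forall v, v \in s -> v \in Y /\ g Y b <= pos x v.
  rewrite !inE => /andP[/andP[sg dis] ts] v vs.
  have /gap_setsP[sY _] : s \in gap_sets b t by rewrite inE.
  have [vY tv] := sY _ vs; split=> //; apply: far => //.
    by rewrite (disjointFr dis).
  by apply: contraNneq ts => <-.
have delA' (s : {set V}) :
    (forall v, v \in s -> v \in Y /\ g Y b <= pos x v) -> s \in del (pt t) A.
  move=> sY; have gG := g_ge xY b.
  rewrite inE [s \in A]inE -andbA; apply/and3P; split.
  - by apply: in_gap => v /sY[vY gv]; [split=> //|]; lia.
  - rewrite disjoints_subset; apply/subsetP => v /sY[_ /farD].
    by rewrite in_setC.
  - by apply/negP => /sY[_]; rewrite post; lia.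
have gbY : pt (g Y b) \in Y := g_in xY b.
have bG := G_gt b; have gG := g_ge xY b.
have [||||c tc ct] := IH t (g Y b) _ _ _ gbX gbY _; try lia.
  by apply: (g_mono xY); lia.
move: gbX; rewrite leq_eqVlt => /orP[/eqP gbX|gbX]; last first.
  exists (map S c ++ [::]).
    apply/toA/(@tree_split _ (pt t)); first by rewrite lkA.
    apply: (@tree_cone _ (pt (g Y b))) => s sd; apply: delA' => v.
    rewrite !inE => /orP[/eqP ->|]; last exact: delA.
    by rewrite pos_pt //; lia.
  by rewrite cats0; case: ct => [->|[j -> jc]]; [left|right; exists j.+1].
have del0 (s : {set V}) : s \in del (pt t) A -> s = set0.
  move=> /delA H; apply/setP => v; rewrite inE; apply/negP => /H[_].
  by rewrite gbX leqNgt pos_lt.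
(* No point of [Y] is left from [g Y b] on, so the deletion of [t] is [[set set0]]. If the arc at
   [t] still fits, [set0] is matched with [[set pt t]]; otherwise the link is empty and [set0] is
   critical. *)
have [GtX|XGt] := leqP (G t) X.
  exists [::]; last by left.
  apply/toA/(@tree_cone _ (pt t)) => s sA.
  have st : s \subset [set pt t].
    apply/subsetP => v vs; rewrite inE; apply/eqP/eqP.
    move: sA; rewrite inE => /andP[/gap_setsP[sY _] dis].
    apply: contraT => vt; have [vY tv] := sY _ vs.
    have := far _ vY tv; rewrite (disjointFr dis vs) => /(_ isT vt).
    by rewrite gbX leqNgt pos_lt.
  rewrite (setUidPl st) inE; apply/andP; split.
    apply/gap_setsP; split; first by move=> v /set1P ->; rewrite post.
    by exists t; split=> // [|v /set1P ->]; rewrite ?post ?ltnn // ltnW.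
  by rewrite disjoints1 inE post ltnn andbF.
exists (map S [::] ++ [:: 0]).
  apply/toA/(@tree_split _ (pt t)).
    rewrite lkA; apply: (@tree_cone _ (pt 0)) => s /gap_setsP[_ [i [ti iX _]]].
    by have := G_mono ti; lia.
  rewrite (_ : del _ _ = [set set0]); first exact: tree_top.
  apply/setP => s; rewrite [in RHS]inE; apply/idP/eqP => [/del0//|->].
  by apply: delA' => v; rewrite inE.
by right; exists 0 => //=; split=> //; apply: leq_trans XGt (g_ge xY t).
Qed.

Lemma arc_chain_even l b t : arc_chain (2 * l) b t ->
  iter l.+1 (g Y) b = X /\ X < iter l.+1 (g Y) t.
Proof.
elim: l b t => [|l IH] b t //.
rewrite (_ : 2 * l.+1 = (2 * l).+2); last by lia.
by move=> /= /IH; rewrite -!iterSr.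
Qed.

Lemma arc_chain_odd l b t : arc_chain (2 * l).+1 b t ->
  iter l.+1 (g Y) t = X /\ X < iter l.+2 (g Y) b.
Proof. by move=> /= /arc_chain_even; rewrite -iterSr. Qed.

End arc_link.

Lemma arc_link_tree Y x : pt x \in Y ->
  exists2 c, tree (lk (pt x) (induced K Y)) c & link_type id (fun=> 1) Y x c.
Proof.
move=> xY; have [||||c tc ct] := @gap_sets_tree Y x xY x (sc Y x) (leqnn x).
- exact: sc_gt xY x.
- exact: sc_le xY x.
- exact: sc_in xY x.
- by apply: (nxt_mono xY); exact: G_gt.
exists c; first by rewrite lk_gap_sets.
case: ct => [->|[j -> jc]]; first by constructor 1.
have [jodd|jeven] := boolP (odd j); last first.
  have jE : j = 2 * j./2 by have := odd_double_half j; rewrite (negPf jeven); lia.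
  rewrite jE in jc *; have [E _] := arc_chain_even xY jc.
  by constructor 2; exists (j./2).+1; split=> //; [congr [:: _]; lia|rewrite mul1n].
have jE : j = (2 * j./2).+1 by have := odd_double_half j; rewrite jodd; lia.
rewrite jE in jc *; have [E1 E2] := arc_chain_odd xY jc.
constructor 3; exists (j./2).+1; split; rewrite ?mul1n //; first by congr [:: _]; lia.
move=> i im; have sx := sc_gt xY x.
apply: (pt_neq_base xY).
  by apply: leq_trans sx _; apply: (iter_g_ge xY).
have iE := subnK (im : i.+1 <= (j./2).+1); rewrite -E1 -iE iterD.
by apply: leq_trans (iter_g_ge xY _ _); rewrite iterS; apply: (g_gt xY).
Qed.

(** The orbit visits [Y] in cyclic order during a single turn, so no point of [Y] lies strictly
    between [y] and [g Y y]: the arc at [y] is missed. *)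
Lemma arc_single_orbit Y y m : 0 < m -> pt y \in Y ->
  iter m (g Y) y = y + 1 * n ->
  (forall v, v \in Y -> fconnect (gV Y) (pt y) v) -> Y \in K.
Proof.
move=> m0 yY; rewrite mul1n => ym orb; apply/K_arc; exists y => j yj jG.
apply/negP => /orb con; move: (iter_findex con); rewrite iter_gV => /esym E.
have gadd i : g Y (i + n) = g Y i + n by exact: g_add.
have [C0 /(_ _ (leqnn C0))[l lE]] := orbit_lift gadd ym E.
have gE k := iter_f_period gadd ym C0 k.
have := gE 0; have := gE 1; rewrite add0n add1n /= => g1 g0.
have gG := g_ge yY y.
(* The point would be an iterate strictly between two consecutive ones. *)
have := iter_f_lt (g_gt yY) ym (C0 * m) l; have := iter_f_lt (g_gt yY) ym l (C0 * m).+1.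
rewrite -lE iterS g0 -[in g Y (_ + _)]g0 g1; lia.
Qed.

Theorem arc_tree Y y : pt y \in Y -> exists2 c, tree (induced K Y) c &
  [\/ c = [::], exists2 m, 0 < m & c = [:: 2 * m]
    | exists m k, 0 < m /\ c = nseq k (2 * m - 1)].
Proof.
apply: (@induced_tree K id (fun=> 1)) => //.
- move=> s t /K_arc[i iE] ts; apply/K_arc; exists i => j ij jG.
  by apply: contra (iE j ij jG); apply: (subsetP ts).
- move=> v; apply/K_arc; exists (ix v) => j ij jG; rewrite inE.
  apply/eqP => E; have := G_le (ix v).
  have := pt_inj (etrans (ixK v) (esym E)) (ltnW ij); lia.
- by move=> m m' m0 mm; rewrite !mul1n.
- exact: arc_link_tree.
- exact: arc_single_orbit.
Qed.

End arcs.

(** * Vietoris-Rips complexes: cliques of short chords *)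

Section chords.
Context (K : {set {set V}}).
Hypotheses (G2 : forall i, i + n < G (G i))
  (K_flag : forall s : {set V},
     reflect (forall u v, u \in s -> v \in s -> [set u; v] \in K) (s \in K))
  (K1 : forall v, [set v] \in K)
  (K_chord : forall i j, i < j -> j < i + n ->
     ([set pt i; pt j] \in K) = (G j <= i + n) || (G i <= j)).
Implicit Types D : {set V}.

Let adj u v := [set u; v] \in K.

Lemma adjC u v : adj u v = adj v u. Proof. by rewrite /adj setUC. Qed.
Lemma adjxx u : adj u u. Proof. by rewrite /adj setUid. Qed.

Lemma flag_down : down_closed K.
Proof.
move=> s t /K_flag sK /subsetP ts; apply/K_flag => u v /ts us /ts vs.
exact: sK.
Qed.

Lemma flag_add u s : s \in K -> (forall v, v \in s -> adj u v) -> u |: s \in K.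
Proof.
move=> /K_flag sK us; apply/K_flag => v z; rewrite !inE.
move=> /orP[/eqP ->|vs] /orP[/eqP ->|zs].
- exact: adjxx.
- exact: us.
- by rewrite setUC; exact: us.
- exact: sK.
Qed.

Lemma tree_flag_cone D u : u \in D -> (forall v, v \in D -> adj u v) ->
  tree (induced K D) [::].
Proof.
move=> uD uadj; apply: (@tree_cone _ u) => s; rewrite !inE subUset sub1set uD.
move=> /andP[sK sD]; rewrite sD !andbT; apply: flag_add => // v vs.
by apply: uadj; apply: (subsetP sD).
Qed.

Lemma tree_flag_dominated D u (D' : {set V}) c : u \in D -> u \notin D' ->
  (forall v (z : V), v \in D' -> v \in D -> z \in D -> adj v z -> adj u z) ->
  tree (induced K (D :\: D')) c -> tree (induced K D) c.
Proof.
move=> uD uD' dom tc; apply: (@tree_dominated_set _ u D') => //.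
  move=> v s vD'; rewrite !inE subUset sub1set uD => /andP[sK sD] vs.
  rewrite sD !andbT; apply: flag_add => // z zs.
  apply: (dom v) => //; try exact: (subsetP sD).
  by move/K_flag: sK; apply.
rewrite (_ : [set _ in _ | _] = induced K (D :\: D')) //.
by apply/setP => s; rewrite !inE subsetD andbA.
Qed.

Lemma lk_flag D u : u \in D ->
  lk u (induced K D) = induced K [set v in D | (v != u) && adj u v].
Proof.
move=> uD; apply/setP => s; rewrite !inE subUset sub1set uD /=.
apply/and3P/andP => [[us usK sD]|[sK /subsetP sD]].
  split; first by apply: flag_down usK _; apply: subsetUr.
  apply/subsetP => v vs; rewrite inE (subsetP sD) //=; apply/andP; split.
    by apply: contraNneq us => <-.
  by move/K_flag: usK; apply; rewrite !inE ?eqxx ?vs ?orbT.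
split.
- by apply/negP => /sD; rewrite !inE eqxx andbF.
- by apply: flag_add => // v /sD; rewrite !inE => /and3P[].
- by apply/subsetP => v /sD; rewrite inE => /andP[].
Qed.

Section chord_link.
Context (Y : {set V}) (x : nat) (xY : pt x \in Y).
Local Notation X := (x + n).

(* Neighbours of [pt x] on either side: from index [a] on ahead of [x], and from
   index [b] on behind [x + n]. *)
Definition sides a b := [set v in Y |
  ((a <= pos x v) && (G (pos x v) <= X)) || (b <= pos x v)].

Lemma adj_lt u v : pos x u < pos x v ->
  adj u v = (G (pos x v) <= pos x u + n) || (G (pos x u) <= pos x v).
Proof.
move=> uv; rewrite /adj -{1}(posK x u) -{1}(posK x v) K_chord //.
by have := pos_lt x v; have := pos_ge x u; lia.
Qed.

Lemma G_X : G X = G x + n. Proof. exact: G_add. Qed.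

Lemma lk_sides : lk (pt x) (induced K Y) = induced K (sides (sc Y x) (g Y x)).
Proof.
rewrite lk_flag //; congr (induced K _); apply/setP => v; rewrite !inE.
have [vY|//] := boolP (v \in Y); rewrite /=.
have xv := pos_ge x v; have vX := pos_lt x v.
have px : pos x (pt x) = x by rewrite pos_pt //; lia.
have [->|vx] /= := eqVneq v (pt x).
  rewrite px; have := sc_gt xY x; have := g_gt xY x; lia.
have xv' : x < pos x v.
  by rewrite ltn_neqAle xv andbT; apply: contraNneq vx => E; rewrite (pos_inj (esym E)).
have sv : sc Y x <= pos x v by apply: (sc_min xY); rewrite ?posK.
rewrite adj_lt px // sv; congr (_ || _).
apply/idP/idP => [|gv]; last by apply: leq_trans (g_ge xY x) gv.
by apply: (g_min xY); rewrite posK.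
Qed.

(** The two sides exchange roles at each step; [g Y b] has passed [x + n] and is brought back by one
    turn. *)
Fixpoint chord_chain j a b : Prop :=
  if j is j'.+1 then [/\ G a <= X, b < X & chord_chain j' (g Y b - n) (g Y a)]
  else b = X /\ X < G a.

(** Each side is a clique. If neither [a] nor [b] is adjacent to everything, the vertices ahead of
    [x] not adjacent to [b] are dominated by [a], and those behind not adjacent to [a] are dominated
    by [b]. Once they are deleted, [a] misses only [b] and [b] only [a]: the deletion of [b] is a
    cone with apex [a], and the link of [b] has the same two-sided form. *)
Lemma sides_tree a b : x < a -> pt a \in Y -> g Y x <= b -> b <= X -> pt b \in Y ->
  exists2 c, tree (induced K (sides a b)) c
    & c = [::] \/ exists2 j, c = [:: j] & chord_chain j a b.
Proof.
have [N] := ubnP (X - b); elim: N a b => // N IH a b bN xa aY gxb bX bY.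
have XY : pt X \in Y by rewrite pt_add.
have Gxb : G x <= b := leq_trans (g_ge xY x) gxb.
have GX := G_X; have Gx2 := G2 x; have Gx1 := G_gt x.
have X0 v : pos x v < X := pos_lt x v.
have x0 v : x <= pos x v := pos_ge x v.
have adjAA u v : pos x u < pos x v -> G (pos x v) <= X -> adj u v.
  by move=> uv vX; rewrite adj_lt //; have := x0 u; lia.
have adjBB u v : pos x u < pos x v -> b <= pos x u -> adj u v.
  move=> uv bu; rewrite adj_lt //; have := G_mono (ltnW (X0 v)); lia.
have same u v : pos x u = pos x v -> adj u v.
  by move=> E; rewrite -(posK x u) E posK adjxx.
(* Otherwise [G (G x) <= x + n], against [G2]; so the two sides are disjoint. *)
have AB i : G i <= X -> i < b.
  by move=> iX; rewrite ltnNge; apply/negP => bi; have := G_mono (leq_trans Gxb bi); lia.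
have adjA u v : G (pos x u) <= X -> G (pos x v) <= X -> adj u v.
  move=> uX vX; have [uv|vu|/same//] := ltngtP (pos x u) (pos x v).
    exact: adjAA.
  by rewrite adjC; exact: adjAA.
have adjB u v : b <= pos x u -> b <= pos x v -> adj u v.
  move=> bu bv; have [uv|vu|/same//] := ltngtP (pos x u) (pos x v).
    exact: adjBB.
  by rewrite adjC; exact: adjBB.
have sidesP v : v \in sides a b ->
    v \in Y /\ ((a <= pos x v /\ G (pos x v) <= X) \/ b <= pos x v).
  by rewrite inE => /andP[vY /orP[/andP[]|]]; tauto.
have posa : G a <= X -> pos x (pt a) = a.
  by move=> aX; rewrite pos_pt //; [lia|have := G_gt a; lia].
have posb : b < X -> pos x (pt b) = b by move=> bX'; rewrite pos_pt //; lia.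
have aS : G a <= X -> pt a \in sides a b.
  by move=> aX; rewrite inE aY posa //= leqnn aX.
have bS : b < X -> pt b \in sides a b.
  by move=> bX'; rewrite inE bY posb //= leqnn orbT.
have [aX|Xa] := leqP (G a) X; last first.
  have noA v : v \in sides a b -> b <= pos x v.
    by move=> /sidesP[_ [[/G_mono av vX]|//]]; lia.
  move: bX; rewrite leq_eqVlt => /orP[/eqP bX|bX'].
    exists [:: 0]; last by right; exists 0.
    suff -> : induced K (sides a b) = [set set0] by exact: tree_top.
    apply/setP => s; rewrite !inE; apply/andP/eqP => [[_ /subsetP sS]|->].
      by apply/setP => v; rewrite inE; apply/negP => /sS /noA; have := X0 v; lia.
    by split; [apply: flag_down (K1 (pt 0)) _; exact: sub0set|exact: sub0set].
  exists [::]; last by left.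
  by apply: (tree_flag_cone (bS bX')) => v /noA vb; apply: adjB; rewrite ?posb.
move: (bX); rewrite leq_eqVlt => /orP[/eqP bXE|bX'].
  exists [::]; last by left.
  apply: (tree_flag_cone (aS aX)) => v /sidesP[_ [[_ vX]|]].
    by apply: adjA; rewrite ?posa.
  by have := X0 v; lia.
have ab : a < b := AB a aX.
have [Gab|bGa] := leqP (G a) b.
  exists [::]; last by left.
  apply: (tree_flag_cone (aS aX)) => v /sidesP[_ [[_ vX]|bv]].
    by apply: adjA; rewrite ?posa.
  by rewrite adj_lt posa //; lia.
have [Gba|aGb] := leqP (G b) (a + n).
  exists [::]; last by left.
  apply: (tree_flag_cone (bS bX')) => v /sidesP[_ [[av vX]|bv]].
    by rewrite adjC adj_lt posb //; [lia|exact: AB].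
  by apply: adjB; rewrite ?posb.
(* Within [sides a b], these are the vertices ahead of [x], other than [a], that are not adjacent to
   [b]; [DB] is the analogue behind [x + n]. *)
pose DA := [set v | (a < pos x v) && (pos x v + n < G b)].
pose DB := [set v | (b < pos x v) && (pos x v < G a)].
pose S1 := sides a b :\: DA; pose S2 := S1 :\: DB.
have GbX : G b <= b + n := G_le b.
have toS c : tree (induced K S2) c -> tree (induced K (sides a b)) c.
  move=> tc; apply: (@tree_flag_dominated _ (pt a) DA); rewrite ?aS //.
  - by rewrite inE posa // ltnn.
  - move=> v z; rewrite inE => /andP[av vG] vS /sidesP[_ [[_ zX] _|bz]].
      by apply: adjA; rewrite ?posa.
    have vb : pos x v < pos x z by lia.
    rewrite adj_lt // => H; rewrite adj_lt posa //; last by lia.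
    by have := G_mono bz; have := G_mono (ltnW av); lia.
  apply: (@tree_flag_dominated _ (pt b) DB).
  - by rewrite inE bS // andbT inE posb // negb_and; lia.
  - by rewrite inE posb // ltnn.
  - move=> v z; rewrite inE => /andP[bv vG] vS; rewrite in_setD inE => /andP[zA].
    case/sidesP => _ [[az zX]|bz]; last by move=> _; apply: adjB; rewrite ?posb.
    have zb := AB _ zX.
    rewrite adjC adj_lt; last by lia.
    move=> H; rewrite adjC adj_lt posb //.
    have [E|za] := eqVneq (pos x z) a; last by lia.
    by rewrite E in H; have := G_mono (ltnW bv); lia.
  exact: tc.
have gb := g_ge xY b; have ga := g_ge xY a.
have lkS : lk (pt b) (induced K S2) = induced K (sides (g Y b - n) (g Y a)).
  rewrite lk_flag; last by rewrite !inE posb // bY; lia.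
  congr (induced K _); apply/setP => v; rewrite !inE.
  have [vY|] := boolP (v \in Y); last by rewrite /= !andbF.
  have gaE : (g Y a <= pos x v) = (G a <= pos x v).
    by apply/idP/idP => H; [lia|apply: (g_min xY); rewrite ?posK].
  have gbE : (g Y b - n <= pos x v) = (G b <= pos x v + n).
    apply/idP/idP => H; first by lia.
    by rewrite leq_subLR addnC; apply: (g_min xY) => //; rewrite pt_add posK.
  rewrite gaE gbE.
  have [vb|bv|vb] := ltngtP (pos x v) b.
  - have -> : v != pt b.
      by apply/eqP => E; move: vb; rewrite E posb // ltnn.
    have mono : a <= pos x v -> G a <= G (pos x v) by exact: G_mono.
    by rewrite adjC adj_lt posb //=; lia.
  - have -> : v != pt b.
      by apply/eqP => E; move: bv; rewrite E posb // ltnn.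
    have -> : adj (pt b) v by apply: adjB; rewrite ?posb // ltnW.
    have : ~~ (G (pos x v) <= X) by apply/negP => /AB; lia.
    by rewrite /=; lia.
  - have -> : v == pt b by rewrite (pos_inj vb).
    have : ~~ (G (pos x v) <= X) by apply/negP => /AB; lia.
    by rewrite /=; lia.
have delS : tree (del (pt b) (induced K S2)) [::].
  rewrite induced_del; apply: (@tree_flag_cone _ (pt a)).
    have abV : pt a != pt b.
      by apply/eqP => E; have := posa aX; rewrite E posb; lia.
    by rewrite in_setD1 abV 2!in_setD aS // !inE posa //; lia.
  move=> v; rewrite in_setD1 in_setD in_setD => /and4P[vb vB _ /sidesP[_ [[_ vX]|bv]]].
    by apply: adjA; rewrite ?posa.
  have bv' : b < pos x v.
    rewrite ltn_neqAle bv andbT; apply: contraNneq vb => E.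
    by rewrite (pos_inj (esym E)).
  rewrite adj_lt posa //; last by lia.
  by move: vB; rewrite inE bv' /=; lia.
have [||||||c tc ct] := IH (g Y b - n) (g Y a).
- by lia.
- by lia.
- have E := g_in xY b; rewrite -(pt_add (g Y b - n)) subnK //; lia.
- by apply: (g_mono xY); lia.
- by apply: (g_min xY).
- exact: g_in xY a.
exists (map S c ++ [::]).
  by apply/toS/(@tree_split _ (pt b)); rewrite ?lkS.
by rewrite cats0; case: ct => [->|[j -> jc]]; [left|right; exists j.+1].
Qed.

Lemma iter_g_sub k i : n <= i -> iter k (g Y) (i - n) = iter k (g Y) i - n.
Proof.
move=> ni; have := iter_g_addM Y k (i - n) 1; rewrite mul1n subnK // => ->.
by rewrite addnK.
Qed.

Lemma g_ge_n i : x <= i -> x + n <= g Y (g Y i).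
Proof.
move=> xi; have := G2 x; have := g_mono xY xi; have := g_ge xY x.
have := g_ge xY (g Y i) => H1 H2 H3 H4.
by have := G_mono (leq_trans H2 H3); lia.
Qed.

(** Two steps of the chain replace [(a, b)] by [(g Y (g Y a) - n, g Y (g Y b) - n)]; this is the
    origin of the [l] turns. *)
Lemma chord_chain_even l a b : x <= a -> g Y x <= b -> chord_chain (2 * l) a b ->
  iter (2 * l) (g Y) b = X + l * n /\ X + l * n < iter (2 * l).+1 (g Y) a.
Proof.
elim: l a b => [|l IH] a b xa gb.
  rewrite muln0 mul0n addn0 => -[-> Xa]; split=> //=.
  by apply: leq_trans Xa (g_ge xY a).
rewrite (_ : 2 * l.+1 = (2 * l).+2); last by lia.
move=> [_ _ [_ _]].
have gga := g_ge_n xa.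
have ggb : g Y x + n <= g Y (g Y b).
  have := g_mono xY (g_mono xY gb).
  by have := g_mono xY (g_ge_n (leqnn x)); rewrite g_add; lia.
have gb' : X <= g Y b.
  have := g_mono xY gb; have := g_ge_n (leqnn x); lia.
have E : g Y (g Y b - n) = g Y (g Y b) - n by rewrite -[LHS]/(iter 1 _ _) iter_g_sub //; lia.
move=> /IH []; rewrite ?E; try by lia.
rewrite !iter_g_sub; try by lia.
have := iter_g_ge xY (2 * l) (g Y (g Y b)).
have := iter_g_ge xY (2 * l).+1 (g Y (g Y a)).
by rewrite -!iterSr mulSn; lia.
Qed.

Lemma chord_chain_odd l a b : x <= a -> g Y x <= b -> chord_chain (2 * l).+1 a b ->
  iter (2 * l).+1 (g Y) a = X + l * n /\ X + l.+1 * n < iter (2 * l).+2 (g Y) b.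
Proof.
move=> xa gb [_ _ ch]; have gb' : X <= g Y b.
  have := g_mono xY gb; have := g_ge_n (leqnn x); lia.
have [] := chord_chain_even _ _ ch; first by lia.
  exact: (g_mono xY).
rewrite iter_g_sub; last by lia.
by rewrite -!iterSr mulSn => -> H; split=> //; lia.
Qed.

(** Until the chain ends, both indices lie strictly between [x] and [x + n] up to whole turns. This
    is the last clause of the third link type. *)
Lemma chord_chain_avoid j a b : x < a -> g Y x <= b -> chord_chain j a b ->
  forall i, i < j -> pt (iter i (g Y) a) != pt x /\ pt (iter i (g Y) b) != pt x.
Proof.
elim: j a b => // j IH a b xa gb [aX bX ch] [|i] ij.
  split; apply: (pt_neq_base xY) => //=; first by have := G_gt a; lia.
  by have := g_gt xY x; lia.
have gb' : X <= g Y b.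
  have := g_mono xY gb; have := g_ge_n (leqnn x); lia.
have gb2 : X < g Y b.
  by have := g_mono xY gb; have := g_ge xY (g Y x); have := G_mono (g_ge xY x);
    have := G2 x; lia.
have [||H1 H2] := IH _ _ _ _ ch i ij; first by lia.
  by apply: (g_mono xY); lia.
rewrite !iterSr; split=> //; move: H1; rewrite iter_g_sub; last by lia.
have : n <= iter i (g Y) (g Y b) by have := iter_g_ge xY i (g Y b); lia.
by move=> nI; rewrite -(pt_add (_ - n)) subnK.
Qed.

End chord_link.

Lemma chord_link_tree Y x : pt x \in Y ->
  exists2 c, tree (lk (pt x) (induced K Y)) c
    & link_type (fun m => 2 * m - 1) id Y x c.
Proof.
move=> xY.
have [c tc ct] := sides_tree xY (sc_gt xY x) (sc_in xY x) (leqnn _)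
  (g_le xY xY) (g_in xY x).
exists c; first by rewrite lk_sides.
have xs := sc_gt xY x.
case: ct => [->|[j -> jc]]; first by constructor 1.
have [jodd|jeven] := boolP (odd j); last first.
  have jE : j = 2 * j./2 by have := odd_double_half j; rewrite (negPf jeven); lia.
  rewrite jE in jc *; have [E _] := chord_chain_even xY (ltnW xs) (leqnn _) jc.
  constructor 2; exists (j./2).+1; split=> //; first by congr [:: _]; lia.
  rewrite (_ : 2 * _ - 1 = (2 * j./2).+1); last by lia.
  by rewrite iterSr E mulSn addnA.
have jE : j = (2 * j./2).+1 by have := odd_double_half j; rewrite jodd; lia.
rewrite jE in jc *; have [E1 E2] := chord_chain_odd xY (ltnW xs) (leqnn _) jc.
constructor 3; exists (j./2).+1.
rewrite (_ : 2 * (j./2).+1 - 1 = (2 * j./2).+1); last by lia.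
rewrite (_ : 2 * (j./2).+2 - 1 = (2 * j./2).+3); last by lia.
split=> //; first by rewrite E1 mulSn addnA.
- by rewrite iterSr; move: E2; rewrite !mulSn; lia.
- by move=> i ij; have [] := chord_chain_avoid xY xs (leqnn _) jc ij.
Qed.

(** Let [f] be two steps of [g Y] less one turn. Under [f] the orbit of [y] runs through [Y] in a
    single turn of [2 * m - 1] steps, and on it [g Y] is the [m]-th iterate of [f]. A nonadjacent
    pair would have fewer than [m] steps from [i] to [j] and fewer than [m] from [j] to [i + n],
    hence at most [2 * m - 2] for the whole turn. *)
Lemma chord_single_orbit Y y m : 0 < m -> pt y \in Y ->
  iter (2 * m - 1) (g Y) y = y + m * n ->
  (forall v, v \in Y -> fconnect (gV Y) (pt y) v) -> Y \in K.
Proof.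
move=> m0 yY ym orb.
pose f i := g Y (g Y i) - n.
have gg i : i + n < g Y (g Y i).
  by have := G2 i; have := G_mono (g_ge yY i); have := g_ge yY (g Y i); lia.
have f_gt i : i < f i by rewrite /f; have := gg i; lia.
have f_add i : f (i + n) = f i + n.
  by rewrite /f !g_add; have := gg i; lia.
have iter_f k i : iter k f i + k * n = iter (2 * k) (g Y) i.
  elim: k i => [|k IH] i; first by rewrite muln0 addn0.
  rewrite (_ : 2 * k.+1 = (2 * k).+2); last by lia.
  rewrite !iterS -IH g_addM g_addM -/(iter _ _ _).
  by have := gg (iter k f i); rewrite /f mulSn; lia.
have fper : iter (2 * m - 1) f y = y + n.
  have := iter_f (2 * m - 1) y; rewrite (iter_wind_eq yY 2 ym) mulnBl; nia.
have f_y k : iter m f (iter k (g Y) y) = iter k.+1 (g Y) y.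
  have := iter_f m (iter k (g Y) y); rewrite -iterD.
  have -> : 2 * m + k = k.+1 + (2 * m - 1) by lia.
  by rewrite iterD ym iter_g_addM => /addIn.
have g_f k : iter k (g Y) y = iter (k * m) f y.
  by elim: k => [|k IH]; rewrite ?mul0n // -f_y IH mulSn iterD.
have lift z : pt z \in Y -> exists C0, forall C, C0 <= C ->
    exists l, z + C * n = iter l f y.
  move=> /orb con; move: (iter_findex con); rewrite iter_gV g_f => /esym.
  exact: (orbit_lift f_add fper).
have g_orbit l : g Y (iter l f y) = iter (l + m) f y.
  have g_fC i : g Y (f i) = f (g Y i).
    have := gg i => ?; rewrite /f; apply/eqP; rewrite -(eqn_add2r n) -g_add.
    by rewrite !subnK //; have := gg (g Y i); lia.
  have -> : g Y (iter l f y) = iter l f (g Y y).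
    by elim: l => //= l <-; rewrite g_fC.
  by rewrite iterD; congr iter; rewrite (f_y 0).
apply/K_flag => u v uY vY.
have [->|uv] := eqVneq u v; first exact: adjxx.
have flt := iter_f_lt f_gt fper.
have chord i j : i < j -> j < i + n -> pt i \in Y -> pt j \in Y ->
    [set pt i; pt j] \in K.
  move=> ij jn iY jY; rewrite K_chord //; apply: contraT.
  rewrite negb_or -!ltnNge => /andP[nj ni].
  have [C1 lift1] := lift _ iY; have [C2 lift2] := lift _ jY.
  have [a aE] := lift1 _ (leq_maxl C1 C2); have [b bE] := lift2 _ (leq_maxr C1 C2).
  have ab : a + (2 * m - 1) < b + m.
    rewrite -flt iterD fper -g_orbit -bE g_addM.
    rewrite -[n in iter a f (y + n)]mul1n (iter_f_addM f_add) -aE mul1n.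
    by have := g_ge yY j; lia.
  have : b < a + m.
    rewrite -flt -g_orbit -aE -bE g_addM.
    by have := g_ge yY i; lia.
  lia.
have pn := pos_lt (ix u) v; have up := pos_ge (ix u) v.
move: uY vY uv; rewrite -(ixK u) -(posK (ix u) v) => uY vY uv.
apply: chord => //; rewrite ltn_neqAle up andbT.
by apply: contraNneq uv => <-.
Qed.

Theorem chord_tree Y y : pt y \in Y -> exists2 c, tree (induced K Y) c &
  [\/ c = [::], exists2 m, 0 < m & c = [:: 2 * m]
    | exists m k, 0 < m /\ c = nseq k (2 * m - 1)].
Proof.
apply: (@induced_tree K (fun m => 2 * m - 1) id) => //.
- exact: flag_down.
- by move=> m; lia.
- by move=> m m' m0 mm /=; nia.
- exact: chord_link_tree.
- exact: chord_single_orbit.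
Qed.

End chords.
End cyclic.

From mathcomp Require Import all_boot all_order all_algebra finmap.
From mathcomp Require Import boolp classical_sets functions cardinality.
From mathcomp Require Import reals interval_inference topology.
From mathcomp Require Import normedtype realfun wedge_sigT.
From mathcomp Require Import ring lra.

Import Order.TTheory GRing.Theory Num.Theory.
Import numFieldNormedType.Exports.

Local Open Scope classical_set_scope.
Local Open Scope ring_scope.

(** * Continuity and homotopy *)

Section continuity.
Context {R : realType}.
Implicit Types T U : topologicalType.

Lemma continuous_ptws T (V : choiceType) (f : T -> {ptws V -> R}) :
  (forall v, continuous (fun x => f x v)) -> continuous f.
Proof.
move=> fc x; apply/cvg_sup => v.
exact: (@continuous_comp_initial _ _ _ (fun g : V -> R => g v) f (fc v)).
Qed.

Lemma continuous_eval (V : choiceType) (v : V) :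
  continuous (fun f : {ptws V -> R} => f v).
Proof. exact: proj_continuous. Qed.

Lemma continuous_val T (A : set T) : continuous (val : A -> T).
Proof. exact: initial_continuous. Qed.

Lemma continuous_set_type T U (A : set U) (f : T -> A) :
  continuous (val \o f) -> continuous f.
Proof. by move=> vf; apply: continuous_comp_initial. Qed.

Lemma paste_continuous T U (h : T -> R) (f g : T -> U) :
  continuous h ->
  {within [set x | h x <= 0], continuous f} ->
  {within [set x | 0 <= h x], continuous g} ->
  (forall x, h x = 0 -> f x = g x) ->
  continuous (fun x => if h x <= 0 then f x else g x).
Proof.
move=> hc fc gc fg.
have cl1 : closed [set x | h x <= 0] by apply: (closed_comp _ (@closed_le R 0)) => x _; exact: hc.
have cl2 : closed [set x | 0 <= h x] by apply: (closed_comp _ (@closed_ge R 0)) => x _; exact: hc.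
have E : [set x | h x <= 0] `|` [set x | 0 <= h x] = setT.
  by apply/seteqP; split=> // x _ /=; have [|/ltW] := leP (h x) 0; [left|right].
apply/continuous_subspace_setT; rewrite -E; apply: withinU_continuous => //.
  apply: subspace_eq_continuous fc => x; rewrite inE /= => hx.
  by rewrite /from_subspace /= hx.
apply: subspace_eq_continuous gc => x; rewrite inE /= => hx.
by rewrite /from_subspace /=; case: ifPn => // hx'; rewrite fg //; apply/eqP; rewrite eq_le hx hx'.
Qed.

Lemma pair_for_continuous T U1 U2 (f : T -> U1) (g : T -> U2) x :
  {for x, continuous f} -> {for x, continuous g} ->
  {for x, continuous (fun y => (f y, g y))}.
Proof.
by move=> fc gc; apply: (@cvg_pair _ _ _ (nbhs x) (nbhs (f x)) (nbhs (g x))).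
Qed.

Lemma max_for_continuous T (f g : T -> R) x :
  {for x, continuous f} -> {for x, continuous g} ->
  {for x, continuous (fun y => Num.max (f y) (g y))}.
Proof.
move=> fc gc; apply: (@continuous_comp _ _ _ (fun y => (f y, g y)) (fun p => Num.max p.1 p.2)).
  exact: pair_for_continuous.
exact: max_continuous.
Qed.

Lemma min_for_continuous T (f g : T -> R) x :
  {for x, continuous f} -> {for x, continuous g} ->
  {for x, continuous (fun y => Num.min (f y) (g y))}.
Proof.
move=> fc gc; apply: (@continuous_comp _ _ _ (fun y => (f y, g y)) (fun p => Num.min p.1 p.2)).
  exact: pair_for_continuous.
exact: min_continuous.
Qed.

Definition clamp (s : R) : R := Num.max 0 (Num.min s 1).

Lemma clamp_ge0 s : 0 <= clamp s. Proof. by rewrite le_max lexx. Qed.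
Lemma clamp_le1 s : clamp s <= 1.
Proof. by rewrite ge_max ler01 ge_min lexx orbT. Qed.
Lemma clamp0 s : s <= 0 -> clamp s = 0.
Proof. by move=> s0; rewrite /clamp; apply/max_idPl; rewrite ge_min s0. Qed.
Lemma clamp1 s : 1 <= s -> clamp s = 1.
Proof. by move=> s0; rewrite /clamp (min_idPr s0) (max_idPr ler01). Qed.

Lemma cst_for_continuous T U (c : U) (x : T) : {for x, continuous (fun _ : T => c)}.
Proof. exact: cvg_cst. Qed.

Lemma id_for_continuous T (x : T) : {for x, continuous (fun y : T => y)}.
Proof. exact: cvg_id. Qed.

Lemma add_for_continuous T (f g : T -> R) x :
  {for x, continuous f} -> {for x, continuous g} ->
  {for x, continuous (fun y => f y + g y)}.
Proof. by move=> fc gc; apply: (@cvgD _ _ _ (nbhs x)). Qed.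

Lemma opp_for_continuous T (f : T -> R) x :
  {for x, continuous f} -> {for x, continuous (fun y => - f y)}.
Proof. by move=> fc; apply: (@cvgN _ _ _ (nbhs x)). Qed.

Lemma mul_for_continuous T (f g : T -> R) x :
  {for x, continuous f} -> {for x, continuous g} ->
  {for x, continuous (fun y => f y * g y)}.
Proof. by move=> fc gc; apply: (@cvgM _ _ (nbhs x)). Qed.

Lemma inv_for_continuous T (f : T -> R) x : f x != 0 ->
  {for x, continuous f} -> {for x, continuous (fun y => (f y)^-1)}.
Proof. by move=> fx fc; apply: (@cvgV _ _ (nbhs x)). Qed.

Lemma sum_for_continuous T (I : Type) (r : seq I) (P : pred I) (f : I -> T -> R) x :
  (forall i, {for x, continuous (f i)}) ->
  {for x, continuous (fun y => \sum_(i <- r | P i) f i y)}.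
Proof.
move=> fc; elim: r => [|i r IH].
  have -> : (fun y => \sum_(i <- [::] | P i) f i y) = fun=> 0.
    by apply/funext => y; rewrite big_nil.
  exact: cst_for_continuous.
have -> : (fun y => \sum_(j <- i :: r | P j) f j y) =
    (fun y => (if P i then f i y else 0) + \sum_(j <- r | P j) f j y).
  by apply/funext => y; rewrite big_cons; case: (P i); rewrite ?add0r.
apply: add_for_continuous IH; case: (P i); first exact: fc.
exact: cst_for_continuous.
Qed.

Lemma bigmin_for_continuous T (I : Type) (r : seq I) (P : pred I) (a : R)
    (f : I -> T -> R) x :
  (forall i, {for x, continuous (f i)}) ->
  {for x, continuous (fun y => \big[Num.min/a]_(i <- r | P i) f i y)}.
Proof.
move=> fc; elim: r => [|i r IH].
  have -> : (fun y => \big[Num.min/a]_(i <- [::] | P i) f i y) = fun=> a.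
    by apply/funext => y; rewrite big_nil.
  exact: cst_for_continuous.
have [Pi|Pi] := boolP (P i); last first.
  rewrite (_ : (fun _ => _) = (fun y => \big[Num.min/a]_(j <- r | P j) f j y)) //.
  by apply/funext => y; rewrite big_cons (negPf Pi).
rewrite (_ : (fun _ => _) =
    (fun y => Num.min (f i y) (\big[Num.min/a]_(j <- r | P j) f j y))).
  exact: min_for_continuous.
by apply/funext => y; rewrite big_cons Pi.
Qed.

Lemma eval_for_continuous T (V : choiceType) (f : T -> {ptws V -> R}) v x :
  {for x, continuous f} -> {for x, continuous (fun y => f y v)}.
Proof.
move=> fc; apply: (@continuous_comp _ _ _ f (fun g : {ptws V -> R} => g v)) => //.
exact: continuous_eval.
Qed.

Lemma comp_for_continuous T U U' (f : T -> U) (h : U -> U') x :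
  continuous h -> {for x, continuous f} -> {for x, continuous (fun y => h (f y))}.
Proof. by move=> hc fc; apply: continuous_comp fc (hc _). Qed.

Lemma continuous_forW T U (f : T -> U) :
  (forall x, {for x, continuous f}) -> continuous f.
Proof. by []. Qed.

Lemma clamp_continuous : continuous clamp.
Proof.
move=> s; apply: (@max_for_continuous R (fun=> 0) (fun y => Num.min y 1) s).
  exact: cst_for_continuous.
apply: min_for_continuous; first exact: id_for_continuous.
exact: cst_for_continuous.
Qed.

End continuity.

Ltac cont_step := lazymatch goal with
  | |- {for _, continuous (fun y => (@?f y) + (@?g y))} =>
    apply: (@add_for_continuous _ _ f g)
  | |- {for _, continuous (fun y => (@?f y) * (@?g y))} =>
    apply: (@mul_for_continuous _ _ f g)
  | |- {for _, continuous (fun y => - (@?f y))} => apply: (@opp_for_continuous _ _ f)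
  | |- {for _, continuous (fun y => (@?f y)^-1)} => apply: (@inv_for_continuous _ _ f)
  | |- {for _, continuous (fun y => Num.max (@?f y) (@?g y))} =>
    apply: (@max_for_continuous _ _ f g)
  | |- {for _, continuous (fun y => Num.min (@?f y) (@?g y))} =>
    apply: (@min_for_continuous _ _ f g)
  | |- {for _, continuous (fun y => clamp (@?f y))} =>
    apply: (@comp_for_continuous _ _ _ f clamp _ clamp_continuous)
  | |- {for _, continuous (fun y => (@?f y, @?g y))} =>
    apply: (@pair_for_continuous _ _ _ f g)
  | |- {for _, continuous (fun y => \sum_(i <- _ | _) _)} =>
    apply: sum_for_continuous => ?
  | |- {for _, continuous (fun y => \big[_/_]_(i <- _ | _) _)} =>
    apply: bigmin_for_continuous => ?
  | |- {for _, continuous (fun y => y.1)} => exact: cvg_fst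
  | |- {for _, continuous (fun y => y.2)} => exact: cvg_snd
  | |- {for _, continuous (fun y => y)} => exact: id_for_continuous
  | |- {for _, continuous (fun y => _)} => exact: cst_for_continuous
  end.
Ltac cont := apply: continuous_forW => ?; repeat cont_step.

Section homotopy.
Context {R : realType}.
Implicit Types T U W : topologicalType.

Lemma homotopicI T U (f g : T -> U) (H : T * R -> U) : continuous H ->
  (forall x, H (x, 0) = f x) -> (forall x, H (x, 1) = g x) -> homotopic R f g.
Proof. by move=> Hc H0 H1; exists H; split=> //; apply: continuous_subspaceT. Qed.

(** Freezing the time outside [[0, 1]] by [clamp] makes the homotopy continuous everywhere, so that
    it can be composed without regard to subspaces. *)
Lemma homotopicE T U (f g : T -> U) : homotopic R f g ->
  exists H : T * R -> U, [/\ continuous H, forall x s, s <= 0 -> H (x, s) = f x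
    & forall x s, 1 <= s -> H (x, s) = g x].
Proof.
move=> [H [Hc H0 H1]]; exists (fun p => H (p.1, clamp p.2)); split.
- pose A := [set: T] `*` `[(0 : R), 1]%classic.
  have mA (p : T * R) : (p.1, clamp p.2) \in A.
    by rewrite inE; split=> //=; rewrite in_itv /= clamp_ge0 clamp_le1.
  pose h (p : T * R) : A := exist _ (p.1, clamp p.2) (mA p).
  have hc : continuous h.
    apply: continuous_set_type => p; apply: pair_for_continuous; first exact: cvg_fst.
    by apply: (@continuous_comp _ _ _ snd clamp); [exact: cvg_snd|exact: clamp_continuous].
  have sc : continuous (sigL A H) by apply/subspace_sigL_continuousP.
  by move=> p; apply: (@continuous_comp _ _ _ h (sigL A H)); [exact: hc|exact: sc].
- by move=> x s s0; rewrite /= clamp0.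
- by move=> x s s0; rewrite /= clamp1.
Qed.

Lemma homotopic_eq T U (f g : T -> U) : continuous f -> f =1 g -> homotopic R f g.
Proof.
move=> fc fg; apply: (@homotopicI _ _ _ _ (fun p => f p.1)) => // p.
by apply: (@continuous_comp _ _ _ fst f); [exact: cvg_fst|exact: fc].
Qed.

Lemma homotopic_sym T U (f g : T -> U) : homotopic R f g -> homotopic R g f.
Proof.
move=> /homotopicE[H [Hc H0 H1]].
apply: (@homotopicI _ _ _ _ (fun p => H (p.1, 1 - p.2))) => [p|x|x].
- apply: (@continuous_comp _ _ _ (fun p : T * R => (p.1, 1 - p.2)) H); last exact: Hc.
  apply: pair_for_continuous; first exact: cvg_fst.
  apply: add_for_continuous; first exact: cst_for_continuous.
  by apply: opp_for_continuous; exact: cvg_snd.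
- by rewrite /= H1 // subr0.
- by rewrite /= H0 // subrr.
Qed.

Lemma homotopic_trans T U (f g h : T -> U) :
  homotopic R f g -> homotopic R g h -> homotopic R f h.
Proof.
move=> /homotopicE[H [Hc H0 H1]] /homotopicE[K [Kc K0 K1]].
apply: (@homotopicI _ _ _ _
  (fun p => if 2 * p.2 - 1 <= 0 then H (p.1, 2 * p.2) else K (p.1, 2 * p.2 - 1))).
- have c2 : continuous (fun p : T * R => 2 * p.2).
    by cont.
  have c21 : continuous (fun p : T * R => 2 * p.2 - 1).
    by cont.
  apply: paste_continuous => //.
  + apply: continuous_subspaceT => p.
    apply: (@continuous_comp _ _ _ (fun p : T * R => (p.1, 2 * p.2)) H); last exact: Hc.
    by apply: pair_for_continuous; [exact: cvg_fst|exact: c2].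
  + apply: continuous_subspaceT => p.
    apply: (@continuous_comp _ _ _ (fun p : T * R => (p.1, 2 * p.2 - 1)) K); last exact: Kc.
    by apply: pair_for_continuous; [exact: cvg_fst|exact: c21].
  + by move=> p E; rewrite H1 ?K0 //; lra.
- by move=> x /=; rewrite ifT; [rewrite H0 //; lra|lra].
- by move=> x /=; rewrite ifF; [rewrite K1 //; lra|apply/negbTE; rewrite -ltNge; lra].
Qed.

Lemma homotopic_comp (S : topologicalType) T U W (k : S -> T) (f g : T -> U) (h : U -> W) :
  continuous k -> continuous h -> homotopic R f g ->
  homotopic R (h \o f \o k) (h \o g \o k).
Proof.
move=> kc hc /homotopicE[H [Hc H0 H1]].
apply: (@homotopicI _ _ _ _ (fun p => h (H (k p.1, p.2)))) => [p|x|x] /=.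
- apply: (@continuous_comp _ _ _ (fun p : S * R => H (k p.1, p.2)) h); last exact: hc.
  apply: (@continuous_comp _ _ _ (fun p : S * R => (k p.1, p.2)) H); last exact: Hc.
  apply: pair_for_continuous; last exact: cvg_snd.
  by apply: (@continuous_comp _ _ _ fst k); [exact: cvg_fst|exact: kc].
- by rewrite H0.
- by rewrite H1.
Qed.

Lemma homotopy_equivalent_refl T : homotopy_equivalent R T T.
Proof.
have idc : continuous (@idfun T) by move=> x; exact: id_for_continuous.
by exists idfun, idfun; split=> //; apply: homotopic_eq.
Qed.

Lemma homotopy_equivalent_trans T U W : homotopy_equivalent R T U ->
  homotopy_equivalent R U W -> homotopy_equivalent R T W.
Proof.
move=> [f [g [fc gc gf fg]]] [f' [g' [f'c g'c gf' fg']]].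
have comp (A B C : topologicalType) (u : A -> B) (v : B -> C) :
    continuous u -> continuous v -> continuous (v \o u).
  by move=> uc vc x; apply: continuous_comp; [exact: uc|exact: vc].
exists (f' \o f), (g \o g'); split; [exact: comp|exact: comp| |].
- exact: homotopic_trans (homotopic_comp fc gc gf') gf.
- exact: homotopic_trans (homotopic_comp g'c f'c fg) fg'.
Qed.

End homotopy.

Section deformation.
Context {R : realType}.

(** [H] is given on the ambient space, where its continuity is easy to check; only its restriction
    to [A] with clamped time enters the homotopy. *)
Lemma retract_homotopy_equivalent (E : topologicalType) (A B : set E)
    (H : E * R -> E) : continuous H -> B `<=` A ->
  (forall x (s : R), A x -> 0 <= s -> s <= 1 -> A (H (x, s))) ->
  (forall x, H (x, 0) = x) -> (forall x, A x -> B (H (x, 1))) ->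
  (forall x, B x -> H (x, 1) = x) -> homotopy_equivalent R A B.
Proof.
move=> Hc BA HA H0 HB H1.
have fP (x : A) : H (val x, 1) \in B by apply/mem_set/HB/set_mem/valP.
have gP (x : B) : val x \in A by apply/mem_set/BA/set_mem/valP.
have hP (p : A * R) : H (val p.1, clamp p.2) \in A.
  by apply/mem_set/HA; rewrite ?clamp_ge0 ?clamp_le1 //; apply/set_mem/valP.
pose f (x : A) : B := exist (fun y => y \in B) _ (fP x).
pose g (x : B) : A := exist (fun y => y \in A) _ (gP x).
pose h (p : A * R) : A := exist (fun y => y \in A) _ (hP p).
have hc : continuous h.
  apply: continuous_set_type; apply: continuous_forW => p.
  apply: (@comp_for_continuous _ _ _ (fun p : A * R => (val p.1, clamp p.2)) H) => //.
  repeat cont_step.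
  apply: (@comp_for_continuous _ _ _ fst (val : A -> E)); last exact: cvg_fst.
  exact: continuous_val.
exists f, g; split.
- apply: continuous_set_type; apply: continuous_forW => x.
  apply: (@comp_for_continuous _ _ _ (fun x : A => (val x, 1 : R)) H) => //.
  by repeat cont_step; exact: continuous_val.
- by apply: continuous_set_type; exact: continuous_val.
- apply: homotopic_sym; apply: (homotopicI hc) => x; apply: val_inj => /=.
    by rewrite clamp0 // H0.
  by rewrite clamp1.
- have fgE : f \o g =1 idfun by move=> x; apply: val_inj => /=; apply/H1/set_mem/valP.
  have -> : f \o g = idfun by apply/funext.
  by apply: homotopic_eq => // x; exact: id_for_continuous.
Qed.

Lemma singleton_homotopy_equivalent (E : topologicalType) (A : set E) x0 :
  A = [set x0] -> homotopy_equivalent R A point_space.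
Proof.
move=> AE; have x0A : x0 \in A by rewrite AE inE.
have AE' z : A z -> x0 = z by rewrite AE.
pose x : A := exist (fun y => y \in A) _ x0A.
have cc (T U : topologicalType) (u : U) : continuous (fun _ : T => u).
  by move=> y; exact: cst_for_continuous.
exists (fun=> tt), (fun=> x); split; try exact: cc.
- apply: homotopic_eq; first exact: cc.
  by move=> y; apply: val_inj => /=; apply/AE'/set_mem/valP.
- by apply: homotopic_eq; [exact: cc|case].
Qed.

End deformation.

(** * Collapses of polyhedra *)

Section polyhedra.
Context {R : realType} {V : finType}.
Implicit Types (A L : {set {set V}}) (t : {set V}) (u : {ptws V -> R}).

Definition polyhedron A : set {ptws V -> R} :=
  [set u | [/\ forall v, 0 <= u v, \sum_(v : V) u v = 1
             & [set v | u v != 0]%SET \in A]].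

Lemma polyhedron_le1 A u v : polyhedron A u -> u v <= 1.
Proof.
move=> [u0 u1 _]; rewrite -u1 (bigD1 v) //= lerDl; exact: sumr_ge0.
Qed.

Lemma polyhedron_sub A L : L \subset A -> polyhedron L `<=` polyhedron A.
Proof. by move=> /fintype.subsetP LA u [u0 u1 uL]; split=> //; exact: LA. Qed.

(** On a polyhedron this is nonzero exactly when [t] lies in the support of [u]; the neutral element
    1 bounds all coordinates there. *)
Definition min_on t u : R := \big[Num.min/1]_(v in t) u v.

Lemma min_on_le t u v : v \in t -> min_on t u <= u v.
Proof. by move=> vt; rewrite /min_on (bigD1 v) //= ge_min lexx. Qed.

Lemma min_on_ge0 t u : (forall v, 0 <= u v) -> 0 <= min_on t u.
Proof.
move=> u0; rewrite /min_on; elim/big_ind: _ => //.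
by move=> x y x0 y0; rewrite le_min x0.
Qed.

Lemma min_on_attained t u w : w \in t -> u w <= 1 ->
  exists2 v, v \in t & min_on t u = u v.
Proof.
move=> wt uw; suff : min_on t u = 1 \/ exists2 v, v \in t & min_on t u = u v.
  by case=> // E; exists w => //; apply/le_anti; rewrite min_on_le // E uw.
rewrite /min_on; elim/big_ind: _ => [|x y Hx Hy|v vt]; first by left.
  by case: (leP x y).
by right; exists v.
Qed.

Lemma min_on_for_continuous (T : topologicalType) (f : T -> {ptws V -> R}) t x :
  {for x, continuous f} -> {for x, continuous (fun y => min_on t (f y))}.
Proof. by move=> fc; rewrite /min_on; repeat cont_step; apply: eval_for_continuous. Qed.

(** Mass flows at equal rates from the vertices of [t] to [b] until a coordinate on [t] vanishes.
    Where [m] is nonzero the support is [t] or [b |: t], so the motion stays in the polyhedron;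
    elsewhere it is stationary. *)
Lemma pair_homotopy_equivalent A t b : down_closed A -> free_pair A t b ->
  t != finset.set0 ->
  homotopy_equivalent R (polyhedron A) (polyhedron (A :\: [set t; b |: t])).
Proof.
move=> Ad [bt tA btA tmax] t0.
pose m u := min_on t u.
pose H (p : {ptws V -> R} * R) : {ptws V -> R} := fun v =>
  p.1 v - p.2 * m p.1 * (v \in t)%:R + p.2 * m p.1 * #|t|%:R * (v == b)%:R.
have m0H u s : m u = 0 -> H (u, s) = u.
  by move=> mu; apply/funext => v; rewrite /H /= mu; ring.
have supH u s v : v \notin b |: t -> H (u, s) v = u v.
  by rewrite !inE negb_or => /andP[/negPf vb /negPf vt]; rewrite /H /= vb vt !mulr0 subr0 addr0.
have [w wt] : exists w, w \in t by apply/set0Pn.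
have gt0 u : polyhedron A u -> m u != 0 ->
    [set v | u v != 0]%SET = t \/ [set v | u v != 0]%SET = b |: t.
  move=> [u0 _ uA] mu; apply: tmax uA _; apply/fintype.subsetP => v vt; rewrite inE.
  apply: contraNneq mu => uv; rewrite eq_le min_on_ge0 // andbT -uv.
  exact: min_on_le.
have HA u s : polyhedron A u -> 0 <= s -> s <= 1 -> polyhedron A (H (u, s)).
  move=> uA s0 s1; have [/m0H ->//|mu] := eqVneq (m u) 0.
  have [u0 u1 suA] := uA; have mu0 : 0 <= m u by exact: min_on_ge0.
  split.
  - move=> v; rewrite /H /=; apply: addr_ge0; last first.
      by rewrite !mulr_ge0.
    have [vt|vt] := boolP (v \in t); last by rewrite mulr0 subr0.
    rewrite mulr1 subr_ge0; apply: le_trans (min_on_le u vt).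
    by rewrite ler_piMl.
  - rewrite /H /= big_split /= big_split /= u1 sumrN -!mulr_sumr.
    have -> : \sum_v (v \in t)%:R = #|t|%:R :> R.
      by rewrite -sum1_card [in RHS]big_mkcond natr_sum; apply: eq_bigr => v _; case: ifP.
    have -> : \sum_v (v == b)%:R = 1 :> R.
      by rewrite (bigD1 b) //= eqxx big1 ?addr0 // => v /negPf ->.
    ring.
  - apply: Ad btA _; apply/fintype.subsetP => v; rewrite inE.
    apply: contraNT => vbt; rewrite supH // -[_ == _]negbK.
    have -> : (u v != 0) = (v \in [set v | u v != 0]%SET) by rewrite inE.
    have [->|->] := gt0 u uA mu; last exact: vbt.
    by move: vbt; rewrite !inE negb_or => /andP[].
apply: (@retract_homotopy_equivalent _ _ _ _ H) => //.
- apply: continuous_ptws => v; rewrite /H.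
  have c1 (p : {ptws V -> R} * R) : {for p, continuous (fun p : {ptws V -> R} * R => p.1)}.
    exact: cvg_fst.
  apply: continuous_forW => p; repeat cont_step; rewrite ?/m;
    by [apply: eval_for_continuous|apply: min_on_for_continuous|exact: cvg_snd].
- exact/polyhedron_sub/finset.subsetDl.
- by move=> u; apply/funext => v; rewrite /H /=; ring.
- move=> u uA; have Hu := HA u 1 uA ler01 (lexx _).
  have [u0 u1 suA] := Hu; split=> //; rewrite 2!inE suA andbT.
  have [|v vt vE] := @min_on_attained t u w wt; first exact: polyhedron_le1 uA.
  have Hv : H (u, 1) v = 0.
    have -> : H (u, 1) v = u v - m u.
      rewrite /H /= vt (_ : (v == b) = false) ?mulr0 ?addr0 ?mulr1 ?mul1r //.
      by apply: contraNF bt => /eqP <-.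
    by rewrite /m vE subrr.
  have vH : v \notin [set v | H (u, 1) v != 0]%SET by rewrite inE Hv eqxx.
  by rewrite !inE; apply: contraNN vH => /orP[]/eqP ->; rewrite ?inE vt ?orbT.
- move=> u [u0 u1]; rewrite inE => /andP[ut uA]; apply: m0H; apply/eqP.
  apply: contraNT ut => mu; rewrite !inE; apply/orP.
  by have [->|->] := gt0 u (And3 u0 u1 uA) mu; rewrite eqxx ?orbT; [left|right].
Qed.

Lemma collapse_homotopy_equivalent e A L : (0 < e)%N -> down_closed A ->
  collapse e A L -> homotopy_equivalent R (polyhedron A) (polyhedron L).
Proof.
move=> e0 + AL; elim: AL => [{}A _|{}A t b {}L tb et _ IH Ad].
  exact: homotopy_equivalent_refl.
have t0 : t != finset.set0 by rewrite -card_gt0 (leq_trans e0).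
apply: homotopy_equivalent_trans (pair_homotopy_equivalent Ad tb t0) _.
by apply: IH; apply: down_closed_pair.
Qed.

(** [set0] must leave in a pair with some vertex, at a moment when nothing but these two sets is
    left: the polyhedron is then a point. All earlier pairs are collapses with [t] nonempty. *)
Lemma removal_contractible A : down_closed A -> finset.set0 \in A ->
  removal A [::] -> homotopy_equivalent R (polyhedron A) point_space.
Proof.
move=> Ad A0 AL; move E: [::] AL => c AL; elim: AL E Ad A0 => {A c}
  [_ _|A t b c tb _ IH E Ad A0|//]; first by rewrite inE.
have [t0|t0] := eqVneq t finset.set0; last first.
  apply: homotopy_equivalent_trans (pair_homotopy_equivalent Ad tb t0) _.
  apply: IH => //; first exact: down_closed_pair.
  rewrite !inE A0 andbT negb_or eq_sym t0 eq_sym /=.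
  by apply/set0Pn; exists b; rewrite !inE eqxx.
case: tb => _ _; rewrite t0 finset.setU0 => bA tmax.
pose d : {ptws V -> R} := fun v => (v == b)%:R.
apply: (@singleton_homotopy_equivalent _ _ _ d); apply/seteqP; split=> u /=.
  move=> [u0 u1 uA]; have [E0|E0] := tmax _ uA (finset.sub0set _).
    have uz v : u v = 0 by apply/eqP; have := finset.in_set0 v; rewrite -E0 inE => /negbFE.
    by move: u1; rewrite big1 // => /eqP; rewrite eq_sym oner_eq0.
  have uz v : v != b -> u v = 0.
    by move=> vb; apply/eqP; have := finset.in_set1 v b; rewrite -E0 inE (negPf vb) => /negbFE.
  apply/funext => v; rewrite /d; have [->|/uz//] := eqVneq v b.
  by rewrite -u1 (bigD1 b) //= big1 ?addr0.
move=> ->; split.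
- by move=> v; rewrite /d ler0n.
- by rewrite (bigD1 b) //= /d eqxx big1 ?addr0 // => v /negPf ->.
- suff -> : [set v | d v != 0]%SET = [set b]%SET by [].
  by apply/finset.setP => v; rewrite !inE /d pnatr_eq0; case: (v == b).
Qed.

End polyhedra.

Section within.
Context {R : realType}.
Implicit Types T U W : topologicalType.

Lemma within_for T U (D : set T) (f : T -> U) :
  (forall x, D x -> {for x, continuous f}) -> {within D, continuous f}.
Proof. by move=> fc; apply: continuous_in_subspaceT => x; rewrite inE; exact: fc. Qed.

Lemma ptws_for_continuous T (V : choiceType) (f : T -> {ptws V -> R}) x :
  (forall v, {for x, continuous (fun y => f y v)}) -> {for x, continuous f}.
Proof.
move=> fc; apply/cvg_sup => v U [_ [[W oW <-]] Wfx /filterS]; apply.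
by apply: fc; exact: open_nbhs_nbhs.
Qed.

(** Corestriction to [A] with default [a0] off [A], so that piecewise formulas can be written before
    membership is known. *)
Definition into U (A : set U) (a0 : A) (u : U) : A := insubd a0 u.

Lemma intoK U (A : set U) (a0 : A) u : A u -> val (into a0 u) = u.
Proof. by move=> Au; rewrite /into insubdK //; exact/mem_set. Qed.

Lemma into_within T U (D : set T) (A : set U) (a0 : A) (g : T -> U) :
  {within D, continuous g} -> (forall x, D x -> A (g x)) ->
  {within D, continuous (fun x => into a0 (g x))}.
Proof.
move=> gc gA.
have gc' : {within D, continuous (fun x => val (into a0 (g x)))}.
  apply: subspace_eq_continuous gc => x; rewrite inE => Dx.
  by rewrite /from_subspace /= intoK //; apply/gA.
exact: (@continuous_set_type (subspace D) _ A _ gc').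
Qed.

Lemma comp_within T U W (D : set T) (f : T -> U) (g : U -> W) :
  continuous g -> {within D, continuous f} -> {within D, continuous (fun x => g (f x))}.
Proof.
by move=> gc fc x; apply: (@continuous_comp (subspace D)); [exact: fc|exact: gc].
Qed.

Lemma pair_within T U W (D : set T) (f : T -> U) (g : T -> W) :
  {within D, continuous f} -> {within D, continuous g} ->
  {within D, continuous (fun x => (f x, g x))}.
Proof.
by move=> fc gc x; apply: (@pair_for_continuous (subspace D)); [exact: fc|exact: gc].
Qed.

Lemma eq_within T U (D : set T) (f g : T -> U) : (forall x, D x -> f x = g x) ->
  {within D, continuous f} -> {within D, continuous g}.
Proof.
by move=> fg; apply: subspace_eq_continuous => x; rewrite inE; exact: fg.
Qed.

Lemma closed_cover_continuous T U (s : seq (set T)) (f : T -> U) :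
  (forall D, List.In D s -> closed D /\ {within D, continuous f}) ->
  (forall x, exists2 D, List.In D s & D x) -> continuous f.
Proof.
move=> Dc cover; pose F := foldr (fun D E => D `|` E) set0 s.
have [_ Fc] : closed F /\ {within F, continuous f}.
  rewrite /F {F cover}; elim: s Dc => [_|D s IH Dc] /=.
    by split; [exact: closed0|exact: continuous_subspace0].
  have [Dcl Dcon] := Dc D (or_introl erefl).
  have [|Fcl Fcon] := IH; first by move=> E Es; apply: Dc; right.
  by split; [exact: closedU|exact: withinU_continuous].
apply/continuous_subspace_setT; suff <- : F = setT by [].
apply/seteqP; split=> // x _; have [D Ds Dx] := cover x.
rewrite /F {F Fc Dc cover}; elim: s Ds => //= E s IH [->|Ds]; first by left.
by right; exact: IH.
Qed.

Lemma closed_le_for T (h : T -> R) : continuous h -> closed [set x | h x <= 0].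
Proof. by move=> hc; apply: (closed_comp _ (@closed_le R 0)) => x _; exact: hc. Qed.

Lemma contractibleE T : homotopy_equivalent R T point_space ->
  exists (a : T) (C : T * R -> T), [/\ continuous C,
    forall x s, s <= 0 -> C (x, s) = x & forall x s, 1 <= s -> C (x, s) = a].
Proof.
move=> [f [g [_ _ /homotopic_sym/homotopicE[C [Cc C0 C1]] _]]].
exists (g tt), C; split=> // x s s1; rewrite C1 //=.
by case: (f x).
Qed.

End within.

(** * Self-maps of the sphere preserving meridians *)

Section spheres.
Context {R : realType} {d : nat}.
Local Notation sphere := (sphere R d).
Local Notation base := (sphere_base R d).

Definition normalize (x : 'rV[R]_d.+1) : 'rV[R]_d.+1 :=
  \row_i (x ord0 i / Num.sqrt (\sum_j x ord0 j ^+ 2)).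

Lemma sumsq_gt0 (x : 'rV[R]_d.+1) : x != 0 -> 0 < \sum_j x ord0 j ^+ 2.
Proof.
move=> x0; rewrite lt_def sumr_ge0 ?andbT => [|i _]; last exact: sqr_ge0.
apply: contraNneq x0 => /eqP; rewrite psumr_eq0 => [|i _]; last exact: sqr_ge0.
move=> /allP x0; apply/eqP/rowP => i; rewrite mxE; apply/eqP.
by have := x0 i (mem_index_enum i); rewrite sqrf_eq0.
Qed.

Lemma normalize_sphere x : x != 0 -> sphere_set R d (normalize x).
Proof.
move=> /sumsq_gt0 x0; rewrite /sphere_set /= /normalize.
under eq_bigr => i _ do rewrite mxE expr_div_n sqr_sqrtr ?ltW //.
by rewrite -mulr_suml divff // gt_eqF.
Qed.

Lemma normalize_id x : sphere_set R d x -> normalize x = x.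
Proof.
by move=> x1; apply/rowP => i; rewrite mxE x1 sqrtr1 divr1.
Qed.

Lemma coord_for_continuous (T : topologicalType) (f : T -> 'rV[R]_d.+1) i x :
  {for x, continuous f} -> {for x, continuous (fun y => f y ord0 i)}.
Proof.
by move=> fc; apply: (@comp_for_continuous _ _ _ f (fun y : 'rV[R]_d.+1 => y ord0 i)) fc;
  exact: coord_continuous.
Qed.

Lemma rV_for_continuous (T : topologicalType) (f : T -> 'rV[R]_d.+1) x :
  (forall i, {for x, continuous (fun y => f y ord0 i)}) -> {for x, continuous f}.
Proof.
move=> fc A [P Pn PA].
have H : \forall y \near x, forall ij : 'I_1 * 'I_d.+1, P ij.1 ij.2 (f y ij.1 ij.2).
  apply: filter_forall => -[i j] /=; rewrite (ord1 i); apply: fc.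
  by have := Pn ord0 j; rewrite (ord1 ord0).
change (nbhs x (f @^-1` A)); apply: filterS H => y yP; apply: PA => i j.
exact: (yP (i, j)).
Qed.

Lemma sphere_neq0 (x : sphere) : val x != 0.
Proof.
apply/eqP => x0; have := set_mem (valP x); rewrite /sphere_set /= x0.
by under eq_bigr do rewrite mxE expr0n; rewrite big1_eq => /eqP; rewrite eq_sym oner_eq0.
Qed.

Lemma sphere_pole (x : sphere) : (forall i, i != ord0 -> val x ord0 i = 0) ->
  val x ord0 ord0 ^+ 2 = 1.
Proof.
move=> x0; rewrite -(set_mem (valP x) : \sum_i val x ord0 i ^+ 2 = 1) (bigD1 ord0) //=.
by rewrite big1 ?addr0 // => i /x0 ->; rewrite expr0n.
Qed.

(* Off the poles the segment from [phi x] to [x] cannot pass through the origin,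
   because the two points have positively proportional equatorial parts. *)
Lemma sphere_homotopy (phi : sphere -> sphere) : continuous phi ->
  (forall x : sphere, exists2 c, 0 <= c &
     forall i, i != ord0 -> val (phi x) ord0 i = c * val x ord0 i) ->
  (forall x : sphere, (forall i, i != ord0 -> val x ord0 i = 0) -> phi x = x) ->
  exists Psi : sphere * R -> sphere, [/\ continuous Psi,
    forall x, Psi (x, 0) = phi x, forall x, Psi (x, 1) = x
    & forall s, Psi (base, s) = base].
Proof.
move=> phic prop pole.
pose a (p : sphere * R) : 'rV[R]_d.+1 :=
  \row_i ((1 - clamp p.2) * val (phi p.1) ord0 i + clamp p.2 * val p.1 ord0 i).
have a0 p : a p != 0.
  case: p => x s; set s' := clamp s; have s0 : 0 <= s' := clamp_ge0 s.
  have s1 : s' <= 1 := clamp_le1 s.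
  apply/negP => /eqP aE.
  have aiE i : (1 - s') * val (phi x) ord0 i + s' * val x ord0 i = 0.
    by have /rowP/(_ i) := aE; rewrite !mxE.
  have [xp|/existsNP[i /not_implyP[i0 xi]]] :=
      pselect (forall i, i != ord0 -> val x ord0 i = 0).
    have /eqP := sphere_neq0 x; apply; apply/rowP => i; rewrite mxE.
    by have := aiE i; rewrite pole // -mulrDl subrK mul1r.
  have [c c0 cE] := prop x; have := aiE i; rewrite cE // mulrA -mulrDl => /eqP.
  rewrite mulf_eq0 (negPf (introN eqP xi)) orbF => /eqP E.
  have s'0 : s' = 0 by nra.
  have /eqP := sphere_neq0 (phi x); apply; apply/rowP => j; rewrite mxE.
  by have := aiE j; rewrite s'0; lra.
have aS p : normalize (a p) \in sphere_set R d.
  exact/mem_set/normalize_sphere.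
pose Psi p : sphere := exist (fun y => y \in sphere_set R d) _ (aS p).
exists Psi; split.
- apply: continuous_set_type; apply: continuous_forW => p.
  have ac i : {for p, continuous (fun p => a p ord0 i)}.
    rewrite (_ : (fun _ => _) = (fun p : sphere * R =>
      (1 - clamp p.2) * val (phi p.1) ord0 i + clamp p.2 * val p.1 ord0 i)).
      repeat cont_step; apply: coord_for_continuous.
        apply: (@comp_for_continuous _ _ _ (fun p : sphere * R => phi p.1) val).
          exact: continuous_val.
        by apply: (@comp_for_continuous _ _ _ fst phi) => //; exact: cvg_fst.
      apply: (@comp_for_continuous _ _ _ fst (val : sphere -> 'rV[R]_d.+1)).
        exact: continuous_val.
      exact: cvg_fst.
    by apply/funext => q; rewrite mxE.
  apply: rV_for_continuous => i.
  rewrite (_ : (fun _ => _) = (fun p => a p ord0 i / Num.sqrt (\sum_j a p ord0 j ^+ 2))).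
    apply: mul_for_continuous; first exact: ac.
    apply: inv_for_continuous; first by rewrite gt_eqF // sqrtr_gt0 sumsq_gt0.
    apply: (@comp_for_continuous _ _ _ (fun p => \sum_j a p ord0 j ^+ 2) Num.sqrt).
      exact: sqrt_continuous.
    by repeat cont_step; exact: (mul_for_continuous (ac _) (ac _)).
  by apply/funext => q; rewrite mxE.
- move=> x; apply: val_inj => /=; rewrite -[RHS]normalize_id; last exact/set_mem/valP.
  by congr normalize; apply/rowP => i; rewrite mxE /= clamp0 // subr0 mul1r mul0r addr0.
- move=> x; apply: val_inj => /=; rewrite -[RHS]normalize_id; last exact/set_mem/valP.
  by congr normalize; apply/rowP => i; rewrite mxE /= clamp1 // subrr mul0r mul1r add0r.
- move=> s; have bp : phi base = base.
    by apply: pole => i i0; rewrite /= mxE eqxx (negPf i0).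
  apply: val_inj => /=; rewrite -[RHS]normalize_id; last exact: set_mem (delta_in_sphere R d).
  by congr normalize; apply/rowP => i; rewrite mxE /= bp -mulrDl subrK mul1r.
Qed.

End spheres.

(** * Attaching cells to a contractible polyhedron *)

Section cells.
Context {R : realType} {V : finType} (L S : {set {set V}}) (d : nat).
Hypotheses (L_down : down_closed L)
  (S_max : forall s, s \in S -> maximal_in L s /\ #|s| = d.+1).
Local Notation E := {ptws V -> R}.
Local Notation X := (polyhedron L : set E).
Local Notation X' := (polyhedron (L :\: S) : set E).
Context (a0 : X') (C : X' * R -> X').
Hypotheses (C_cont : continuous C) (C0 : forall x (s : R), s <= 0 -> C (x, s) = x)
  (C1 : forall x (s : R), 1 <= s -> C (x, s) = a0).

Lemma incl_subproof (x : X') : val x \in X.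
Proof.
apply/mem_set; apply: polyhedron_sub (set_mem (valP x)).
exact: finset.subsetDl.
Qed.
Definition incl (x : X') : X := exist (fun y => y \in X) _ (incl_subproof x).
Definition P0 : X := incl a0.

Lemma incl_continuous : continuous incl.
Proof. by apply: continuous_set_type; exact: continuous_val. Qed.

Lemma full_support s (u : X) : s \in S -> min_on s (val u) != 0 ->
  [set v | val u v != 0]%SET = s.
Proof.
move=> sS ms; have [[sL smax] _] := S_max sS.
have [u0 _ uL] := set_mem (valP u); apply: smax uL _.
apply/fintype.subsetP => v vs; rewrite inE; apply: contraNneq ms => uv.
by rewrite eq_le min_on_ge0 // andbT -uv min_on_le.
Qed.

(** * Comparing one cell with a sphere *)

Section cell.
Context (s : {set V}) (sS : s \in S).
Let cs : #|s| = d.+1 := (S_max sS).2.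
Local Notation e := (d.+1%:R : R).

Let en (i : 'I_d.+1) : V := enum_val (cast_ord (esym cs) i).

Lemma en_in i : en i \in s. Proof. exact: enum_valP. Qed.
Lemma en_inj : injective en. Proof. by move=> i j /enum_val_inj /cast_ord_inj. Qed.
Lemma en_surj v : v \in s -> exists i, en i = v.
Proof.
move=> vs; exists (cast_ord cs (enum_rank_in vs v)).
by rewrite /en cast_ordK enum_rankK_in.
Qed.

Lemma sum_en (f : V -> R) : \sum_(v in s) f v = \sum_i f (en i).
Proof.
rewrite big_enum_val (reindex (cast_ord (esym cs))) //=.
by exists (cast_ord cs) => i _; rewrite ?cast_ordK ?cast_ordKV.
Qed.

Lemma min_on_en u : X u -> exists j, min_on s u = u (en j).
Proof.
move=> uX; have [|v /en_surj[j <-] E] := min_on_attained (en_in ord0) (u := u).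
  exact: polyhedron_le1 uX.
by exists j.
Qed.

Definition embed (w : 'I_d.+1 -> R) : E := fun v => \sum_i w i * (en i == v)%:R.

Lemma embed_en w j : embed w (en j) = w j.
Proof.
rewrite /embed (bigD1 j) //= eqxx mulr1 big1 ?addr0 // => i ij.
by rewrite (inj_eq en_inj) (negPf ij) mulr0.
Qed.

Lemma embed_out w v : v \notin s -> embed w v = 0.
Proof.
move=> vs; rewrite /embed big1 // => i _; have [E|] := eqVneq; last by rewrite mulr0.
by rewrite -E en_in in vs.
Qed.

Lemma embedP w u : (forall i, w i = u (en i)) -> (forall v, v \notin s -> u v = 0) ->
  embed w = u.
Proof.
move=> wu u0; apply/funext => v; have [/en_surj[i <-]|vs] := boolP (v \in s).
  by rewrite embed_en.
by rewrite embed_out ?u0.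
Qed.

Lemma sum_embed w : \sum_v embed w v = \sum_i w i.
Proof.
rewrite /embed exchange_big /=; apply: eq_bigr => i _.
by rewrite -mulr_sumr (bigD1 (en i)) //= eqxx big1 ?addr0 ?mulr1 // => v;
  rewrite eq_sym => /negPf ->.
Qed.

Lemma embed_for_continuous (T : topologicalType) (w : T -> 'I_d.+1 -> R) x :
  (forall i, {for x, continuous (fun y => w y i)}) ->
  {for x, continuous (fun y => embed (w y))}.
Proof.
move=> wc; apply: ptws_for_continuous => v; rewrite /embed.
by repeat cont_step; exact: wc.
Qed.

Lemma embed_cell w : (forall i, 0 <= w i) -> \sum_i w i = 1 -> X (embed w).
Proof.
move=> w0 w1; split.
- move=> v; have [/en_surj[i <-]|vs] := boolP (v \in s); first by rewrite embed_en.
  by rewrite embed_out.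
- by rewrite sum_embed.
- apply: L_down (S_max sS).1.1 _; apply/fintype.subsetP => v; rewrite inE.
  by apply: contraNT => vs; rewrite embed_out.
Qed.

Lemma embed_boundary w j : (forall i, 0 <= w i) -> \sum_i w i = 1 -> w j = 0 ->
  X' (embed w).
Proof.
move=> w0 w1 wj; have [u0 u1 uL] := embed_cell w0 w1; split=> //.
rewrite inE uL andbT; apply/negP => tS; have [_ tc] := S_max tS.
have ts : [set v | embed w v != 0]%SET \subset s :\ en j.
  apply/fintype.subsetP => v; rewrite !inE => vw; apply/andP; split.
    by apply: contraNneq vw => ->; rewrite embed_en wj.
  by apply: contraNT vw => vs; rewrite embed_out.
have := subset_leq_card ts; rewrite tc -cs (cardsD1 (en j) s) en_in.
by rewrite ltnn.
Qed.

(* The point of the cell with barycentric coordinates proportional to [k + w i],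
   scaled by 3 about the barycentre, and pushed along [C] once it leaves the
   cell. *)
Definition spread (k : R) (w : 'I_d.+1 -> R) : X :=
  let B := \sum_i w i in
  if 2 * B - e * k <= 0 then
    into P0 (embed (fun i => (k - 2 * B / e + 3 * w i) / (e * k + B)))
  else incl (C (into a0 (embed (fun i => w i / B)), (2 * B - e * k) / (e * k + B))).

Lemma e_gt0 : 0 < e. Proof. by rewrite ltr0n. Qed.

(** Only the proportions of [k] and [w] matter; this absorbs the factor between spherical and
    barycentric coordinates in [cell_of_sphereK]. *)
Lemma spread_scale (c k : R) w : 0 < c -> spread (c * k) (fun i => c * w i) = spread k w.
Proof.
move=> c0; have c0' : c != 0 by rewrite gt_eqF.
have quo (a b : R) : (c * a) / (c * b) = a / b.
  by rewrite invfM mulrACA divff // mul1r.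
rewrite /spread -mulr_sumr; set B := \sum_i w i.
have -> : 2 * (c * B) - e * (c * k) = c * (2 * B - e * k) by ring.
rewrite pmulr_rle0 //.
have -> : e * (c * k) + c * B = c * (e * k + B) by ring.
rewrite quo; have -> : (fun i => c * w i / (c * B)) = (fun i => w i / B).
  by apply/funext => i; rewrite quo.
congr (if _ then into _ (embed _) else _); apply/funext => i.
by rewrite -[RHS]quo; congr (_ / _); move: e^-1 => e'; ring.
Qed.

Section spread_value.
Context (k : R) (w : 'I_d.+1 -> R).
Hypotheses (w0 : forall i, 0 <= w i) (k0 : 0 < k).
Let B := \sum_i w i.

Lemma spread_B_ge0 : 0 <= B. Proof. by apply: sumr_ge0 => i _; exact: w0. Qed.

Lemma spread_den : 0 < e * k + B.
Proof. by have := spread_B_ge0; have := mulr_gt0 e_gt0 k0; lra. Qed.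

Lemma spread_inner_cell : 2 * B - e * k <= 0 ->
  X (embed (fun i => (k - 2 * B / e + 3 * w i) / (e * k + B))).
Proof.
move=> Bk; have D0 := spread_den; have e0 := e_gt0; apply: embed_cell.
  move=> i; apply: divr_ge0 (ltW D0); apply: addr_ge0; last by rewrite mulr_ge0.
  by rewrite subr_ge0 ler_pdivrMr //; lra.
rewrite -mulr_suml big_split /= -mulr_sumr -/B sumr_const card_ord -[(k - _) *+ _]mulr_natl.
have -> : e * (k - 2 * B / e) + 3 * B = e * k + B by field; rewrite gt_eqF.
by rewrite divff // gt_eqF.
Qed.

Lemma spread_outer_cell j : w j = 0 -> 0 <= 2 * B - e * k ->
  X' (embed (fun i => w i / B)).
Proof.
move=> wj Bk; have B0 : 0 < B by have := mulr_gt0 e_gt0 k0; lra.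
apply: (@embed_boundary _ j).
- by move=> i; rewrite divr_ge0 // ltW.
- by rewrite -mulr_suml divff // gt_eqF.
- by rewrite wj mul0r.
Qed.

Lemma spread_inner : 2 * B - e * k <= 0 ->
  val (spread k w) = embed (fun i => (k - 2 * B / e + 3 * w i) / (e * k + B)).
Proof. by move=> Bk; rewrite /spread Bk intoK //; exact: spread_inner_cell. Qed.

(** Also valid at [2 * B = e * k], where the scaled point is on the boundary of the cell and [C] has
    not yet started. Closed covers need both formulas there. *)
Lemma spread_outer j : w j = 0 -> 0 <= 2 * B - e * k ->
  spread k w = incl (C (into a0 (embed (fun i => w i / B)), (2 * B - e * k) / (e * k + B))).
Proof.
move=> wj Bk; rewrite /spread -/B; case: ifPn => // Bk'.
have E0 : 2 * B - e * k = 0 by lra.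
rewrite E0 mul0r C0 //; apply: val_inj => /=.
rewrite intoK; last exact: spread_inner_cell.
rewrite intoK; last exact: spread_outer_cell wj Bk.
have e0 := e_gt0; have B0 : 0 < B by have := mulr_gt0 e_gt0 k0; lra.
congr embed; apply/funext => i.
have -> : k - 2 * B / e = 0.
  by rewrite (_ : 2 * B = e * k); [field; rewrite gt_eqF|lra].
have -> : e * k + B = 3 * B by lra.
by rewrite add0r; field; rewrite gt_eqF.
Qed.

End spread_value.

Local Notation sphere := (sphere R d).
Local Notation base := (sphere_base R d).

Section from_sphere.
Variable x : 'rV[R]_d.+1.
(* The equatorial hyperplane is identified with the direction space of the cell:
   vectors modulo constants, normalized to have coordinate 0 at [ord0] by
   [equator] and minimum 0 by [above]. *)
Definition height : R := 1 - x ord0 ord0.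
Definition equator (i : 'I_d.+1) : R := if i == ord0 then 0 else x ord0 i.
Definition floor : R := \big[Num.min/0]_i equator i.
Definition above (i : 'I_d.+1) : R := equator i - floor.
Definition mass : R := \sum_i above i.

Lemma floor_le i : floor <= equator i.
Proof. by rewrite /floor (bigD1 i) //= ge_min lexx. Qed.

Lemma above_ge0 i : 0 <= above i. Proof. by rewrite subr_ge0 floor_le. Qed.

Lemma above_attained : exists j, above j = 0.
Proof.
suff : exists j, floor = equator j by case=> j E; exists j; rewrite /above E subrr.
rewrite /floor; elim/big_ind: _ => [|a b [i ->] [j ->]|i _]; last by exists i.
  by exists ord0; rewrite /equator eqxx.
by case: leP => _; [exists i|exists j].
Qed.

Lemma above_le_mass i : above i <= mass.
Proof. by rewrite /mass (bigD1 i) //= lerDl sumr_ge0 // => j _; exact: above_ge0. Qed.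

Lemma equator_mass i : `|equator i| <= mass.
Proof.
have E0 : equator ord0 = 0 by rewrite /equator eqxx.
have f0 : floor <= 0 by rewrite -E0 floor_le.
have := above_le_mass i; have := above_le_mass ord0; have := floor_le i.
rewrite /above E0 ler_norml; lra.
Qed.

Lemma mass_sqr : \sum_i equator i ^+ 2 <= e * mass ^+ 2.
Proof.
apply: le_trans (_ : \sum_(i < d.+1) mass ^+ 2 <= _); last first.
  by rewrite sumr_const card_ord -[_ ^+ 2 *+ _]mulr_natl.
apply: ler_sum => i _; rewrite -(real_normK (num_real (equator i))).
by apply: lerXn2r (equator_mass i); rewrite nnegrE ?normr_ge0 //;
  apply: le_trans (equator_mass i).
Qed.

Hypothesis x1 : sphere_set R d x.

Lemma equator_sqr : \sum_i equator i ^+ 2 = height * (2 - height).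
Proof.
have := x1; rewrite /sphere_set /= (bigD1 ord0) //= => E.
rewrite (bigD1 ord0) //= {1}/equator eqxx expr0n add0r.
under eq_bigr => i /negPf i0 do rewrite /equator i0.
by rewrite /height; lra.
Qed.

(** Near [base] the equatorial part is of the order of the square root of the height. A mass below
    [2 * (e * height)] would give [2 - height <= 4 * e ^+ 3 * height] by [equator_sqr] and
    [mass_sqr]. The factor 3 of [spread] makes the time of [C] tend to 2 at the boundary, so it is
    already at least 1 under the present bound. *)
Lemma mass_large : 0 < height -> height * (4 * e ^+ 3 + 1) <= 1 ->
  2 * (e * height) <= mass.
Proof.
move=> h0 h1; rewrite leNgt; apply/negP => small.
have B0 : 0 <= mass by apply: le_trans (above_le_mass ord0); exact: above_ge0.
have e0 := e_gt0; have := mass_sqr; rewrite equator_sqr => H.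
have H2 : mass ^+ 2 <= (2 * (e * height)) ^+ 2.
  have t0 : 0 <= 2 * (e * height) by lra.
  by rewrite ler_sqr ?nnegrE // ltW.
have H3 : height * (2 - height) <= height * (4 * e ^+ 3 * height).
  apply: le_trans H _; rewrite (_ : height * _ = e * (2 * (e * height)) ^+ 2); last by ring.
  by rewrite ler_pM2l.
by move: H3; rewrite ler_pM2l //; lra.
Qed.

End from_sphere.

(* By [mass_large], [spread] is [P0] at all heights below the threshold, so that
   the case distinction in [cell_of_sphere] matters only at [base]. *)
Definition threshold : R := (4 * e ^+ 3 + 1)^-1.
Lemma threshold_gt0 : 0 < threshold.
Proof.
by rewrite invr_gt0 addr_gt0 // mulr_gt0 // exprn_gt0 // e_gt0.
Qed.

Definition cell_of_sphere (x : sphere) : X :=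
  if height (val x) - threshold <= 0 then P0 else spread (height (val x)) (above (val x)).

Lemma cell_of_sphereE (x : sphere) : 0 < height (val x) ->
  cell_of_sphere x = spread (height (val x)) (above (val x)).
Proof.
move=> h0; rewrite /cell_of_sphere; case: ifPn => // h1.
have large : 2 * (e * height (val x)) <= mass (val x).
  apply: (mass_large (set_mem (valP x))) => //.
  have T0 : 0 < 4 * e ^+ 3 + 1 by rewrite addr_gt0 // mulr_gt0 // exprn_gt0 // e_gt0.
  by rewrite -ler_pdivlMr // div1r -subr_le0.
have [j aj] := above_attained (val x); have eh := mulr_gt0 e_gt0 h0.
have above0 := above_ge0 (val x).
rewrite (spread_outer above0 h0 aj) -/(mass _); last by lra.
rewrite C1 // ler_pdivlMr ?mul1r; last by lra.
by lra.
Qed.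

Lemma cell_of_sphere_base : cell_of_sphere base = P0.
Proof.
rewrite /cell_of_sphere ifT // /height /= mxE !eqxx subrr sub0r oppr_le0 ltW //.
exact: threshold_gt0.
Qed.

Lemma height_for_continuous (x : sphere) :
  {for x, continuous (fun x : sphere => height (val x))}.
Proof.
rewrite /height; repeat cont_step; apply: coord_for_continuous.
exact: continuous_val.
Qed.

Lemma above_for_continuous i (x : sphere) :
  {for x, continuous (fun x : sphere => above (val x) i)}.
Proof.
have eqc j : {for x, continuous (fun x : sphere => equator (val x) j)}.
  rewrite /equator; case: (j == ord0); first exact: cst_for_continuous.
  by apply: coord_for_continuous; exact: continuous_val.
rewrite /above /floor; apply: add_for_continuous; first exact: eqc.
by apply: opp_for_continuous; apply: bigmin_for_continuous => j.
Qed.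

Lemma mass_for_continuous (x : sphere) :
  {for x, continuous (fun x : sphere => mass (val x))}.
Proof. by rewrite /mass; repeat cont_step; exact: above_for_continuous. Qed.

Lemma cell_of_sphere_continuous : continuous cell_of_sphere.
Proof.
have th0 := threshold_gt0; have hc := height_for_continuous.
have ac := above_for_continuous; have mc := mass_for_continuous.
pose gap (x : sphere) := 2 * mass (val x) - e * height (val x).
have gapc : continuous gap by rewrite /gap; cont; [exact: mc|exact: hc].
(* Near [base], where the denominators tend to 0, the map is constant; [D2] and [D3] are the parts
   that the scaling keeps in the cell and moves out of it. *)
pose D1 := [set x : sphere | height (val x) - threshold <= 0].
pose D2 := [set x : sphere | threshold - height (val x) <= 0] `&` [set x | gap x <= 0].
pose D3 := [set x : sphere | threshold - height (val x) <= 0] `&` [set x | - gap x <= 0].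
have cl2 : closed [set x : sphere | threshold - height (val x) <= 0].
  by apply: closed_le_for; cont; exact: hc.
have den (x : sphere) : threshold - height (val x) <= 0 ->
    0 < height (val x) /\ e * height (val x) + mass (val x) != 0.
  move=> h1; have h0 : 0 < height (val x) by lra.
  by split=> //; rewrite gt_eqF // spread_den //; exact: above_ge0.
apply: (@closed_cover_continuous _ _ [:: D1; D2; D3]) => [D|x]; last first.
  have [h1|/ltW h1] := leP (height (val x)) threshold.
    by exists D1 => /=; [left|rewrite /D1 /= subr_le0].
  have [g1|/ltW g1] := leP (gap x) 0.
    by exists D2 => /=; [right; left|split; rewrite //= subr_le0].
  exists D3 => /=; [by right; right; left|split; rewrite /= ?oppr_le0 //].
  by rewrite subr_le0.
case=> [<-|[<-|[<-|[]]]]; split.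
- by apply: closed_le_for; cont; exact: hc.
- apply: (@eq_within _ _ _ (fun=> P0)) => [x|]; first by rewrite /cell_of_sphere => ->.
  by apply: within_for => x _; exact: cst_for_continuous.
- by apply: closedI cl2 _; apply: closed_le_for.
- apply: (@eq_within _ _ _ (fun x : sphere => into P0 (embed (fun i =>
      (height (val x) - 2 * mass (val x) / e + 3 * above (val x) i) /
      (e * height (val x) + mass (val x)))))).
    move=> x [/den[h0 _] g1]; rewrite cell_of_sphereE //; apply: val_inj.
    rewrite (spread_inner (above_ge0 _) h0 g1) intoK //.
    exact: (spread_inner_cell (above_ge0 _) h0 g1).
  apply: into_within => [|x [/den[h0 _] g1]]; last first.
    by apply: spread_inner_cell => //; exact: above_ge0.
  apply: within_for => x [/den[_ D0] _]; apply: embed_for_continuous => i.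
  by repeat cont_step => //; solve [exact: hc|exact: mc|exact: ac].
- by apply: closedI cl2 _; apply: closed_le_for; cont; exact: gapc.
- apply: (@eq_within _ _ _ (fun x : sphere => incl (C
     (into a0 (embed (fun i => above (val x) i / mass (val x))),
      gap x / (e * height (val x) + mass (val x)))))).
    move=> x [/den[h0 _] g1]; rewrite cell_of_sphereE //.
    have [j aj] := above_attained (val x).
    rewrite (spread_outer _ _ aj) //; first exact: above_ge0.
    by rewrite -/(mass _) -/(gap x) -oppr_le0.
  apply: comp_within; first exact: incl_continuous.
  apply: (comp_within C_cont); apply: pair_within.
    have B0 (x : sphere) : D3 x -> 0 < mass (val x).
      move=> [/den[h0 _]]; rewrite /= /gap; have := mulr_gt0 e_gt0 h0; lra.
    apply: into_within => [|x D3x].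
      apply: within_for => x D3x; apply: embed_for_continuous => i.
      by repeat cont_step; [exact: ac|rewrite gt_eqF // B0|exact: mc].
    have [j aj] := above_attained (val x); have [/den[h0 _] g1] := D3x.
    apply: (spread_outer_cell _ h0 aj); first exact: above_ge0.
    by rewrite -oppr_le0.
  apply: within_for => x [/den[_ D0] _]; repeat cont_step => //;
    solve [exact: hc|exact: mc|exact: gapc].
Qed.

Section to_sphere.
Variable u : E.
(* [sphere_row] is the inverse stereographic projection of [chord / min_on s u];
   the last term of [spread_sqr] vanishes on the cell and keeps [den] positive
   off it. *)
Definition chord (i : 'I_d.+1) : R := u (en i) - u (en ord0).
Definition spread_sqr : R := \sum_i chord i ^+ 2 + (1 - \sum_i u (en i)) ^+ 2.
Definition den : R := spread_sqr + min_on s u ^+ 2.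
Definition sphere_row : 'rV[R]_d.+1 :=
  \row_i (if i == ord0 then (spread_sqr - min_on s u ^+ 2) / den
          else 2 * min_on s u * chord i / den).

Lemma spread_sqr_ge0 : 0 <= spread_sqr.
Proof. by rewrite addr_ge0 ?sqr_ge0 // sumr_ge0 // => i _; rewrite sqr_ge0. Qed.

Lemma chord0 : chord ord0 = 0. Proof. by rewrite /chord subrr. Qed.

Hypothesis uX : X u.

(** If all terms vanished, the coordinates on [s] would be equal with minimum 0, yet sum to 1. *)
Lemma den_gt0 : 0 < den.
Proof.
rewrite lt_def addr_ge0 ?spread_sqr_ge0 ?sqr_ge0 // andbT.
apply/eqP => /eqP; rewrite paddr_eq0 ?spread_sqr_ge0 ?sqr_ge0 // sqrf_eq0.
rewrite /spread_sqr paddr_eq0 ?sqr_ge0 //; last by rewrite sumr_ge0 // => i _; rewrite sqr_ge0.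
rewrite sqrf_eq0 psumr_eq0 => [|i _]; last by rewrite sqr_ge0.
move=> /andP[/andP[/allP cE /eqP sumE] /eqP m0].
have uE i : u (en i) = u (en ord0).
  by apply/eqP; rewrite -subr_eq0 -sqrf_eq0; exact: cE (mem_index_enum i).
have [j mj] := min_on_en uX.
have u0 i : u (en i) = 0 by rewrite uE -(uE j) -mj.
by move: sumE; rewrite big1 // subr0 => /eqP; rewrite oner_eq0.
Qed.

Lemma cell_sum1 : min_on s u != 0 -> \sum_i u (en i) = 1.
Proof.
move=> m0; pose u' : X := exist (fun y => y \in X) _ (mem_set uX).
have [_ u1 _] := uX; have := full_support (u := u') sS m0 => /= supE.
rewrite -sum_en -u1 [RHS](bigID (mem s)) /= [X in _ + X]big1 ?addr0 // => v.
by rewrite -supE inE negbK => /eqP.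
Qed.

Lemma sphere_row_sphere : sphere_set R d sphere_row.
Proof.
have D0 := den_gt0; rewrite /sphere_set /= (bigD1 ord0) //= mxE eqxx.
have -> : \sum_(i | i != ord0) sphere_row ord0 i ^+ 2 =
    \sum_i (2 * min_on s u * chord i / den) ^+ 2.
  rewrite [RHS](bigD1 ord0) //= chord0 mulr0 mul0r expr0n add0r.
  by apply: eq_bigr => i /negPf i0; rewrite mxE i0.
under eq_bigr => i _ do rewrite mulrAC exprMn.
rewrite -mulr_sumr; have z2 : (0 : R) ^+ 2 = 0 by rewrite expr0n.
have [m0|m0] := eqVneq (min_on s u) 0.
  move: D0; rewrite /den m0 mulr0 mul0r z2 mul0r !addr0 subr0 => D0.
  by rewrite divff ?expr1n // gt_eqF.
have NE : spread_sqr = \sum_i chord i ^+ 2.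
  by rewrite /spread_sqr cell_sum1 // subrr expr0n addr0.
rewrite -NE; move: D0; rewrite /den.
move: spread_sqr (min_on s u) => N m D0.
by field; rewrite gt_eqF.
Qed.

Lemma sphere_row0 : min_on s u = 0 -> sphere_row = delta_mx ord0 ord0.
Proof.
move=> m0; have := den_gt0; rewrite /den m0 expr0n addr0 => D0.
apply/rowP => i; rewrite !mxE /den m0 expr0n addr0 subr0 eqxx /=.
by case: (i == ord0); rewrite ?mulr0 ?mul0r // divff // gt_eqF.
Qed.

End to_sphere.

Lemma sphere_of_cell_subproof (u : X) : sphere_row (val u) \in sphere_set R d.
Proof. exact/mem_set/sphere_row_sphere/set_mem/valP. Qed.
Definition sphere_of_cell (u : X) : sphere :=
  exist (fun y => y \in sphere_set R d) _ (sphere_of_cell_subproof u).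

Lemma sphere_of_cell0 (u : X) : min_on s (val u) = 0 -> sphere_of_cell u = base.
Proof.
by move=> m0; apply: val_inj; rewrite /= sphere_row0 //; exact/set_mem/valP.
Qed.

Lemma point_for_continuous v (u : X) : {for u, continuous (fun u : X => val u v)}.
Proof.
apply: (@eval_for_continuous R X V (val : X -> E)); exact: continuous_val.
Qed.

Lemma min_for_cont t (u : X) : {for u, continuous (fun u : X => min_on t (val u))}.
Proof.
apply: (@min_on_for_continuous R V X (val : X -> E)); exact: continuous_val.
Qed.

Lemma sphere_of_cell_continuous : continuous sphere_of_cell.
Proof.
apply: continuous_set_type; apply: continuous_forW => u; apply: rV_for_continuous => i.
have pc := point_for_continuous; have mc := @min_for_cont s.
have sqr_c (f : X -> R) : {for u, continuous f} -> {for u, continuous (fun y => f y ^+ 2)}.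
  by move=> fc; exact: (mul_for_continuous fc fc).
have cc j : {for u, continuous (fun u : X => chord (val u) j)}.
  by rewrite /chord; repeat cont_step; exact: pc.
have Nc : {for u, continuous (fun u : X => spread_sqr (val u))}.
  rewrite /spread_sqr; apply: add_for_continuous.
    by apply: sum_for_continuous => j; apply: sqr_c.
  by apply: sqr_c; repeat cont_step; exact: pc.
have m2c : {for u, continuous (fun u : X => min_on s (val u) ^+ 2)} by exact: sqr_c.
have Dc : {for u, continuous (fun u : X => den (val u))}.
  exact: (add_for_continuous Nc m2c).
have D0 : den (val u) != 0 by rewrite gt_eqF // den_gt0 //; exact/set_mem/valP.
rewrite (_ : (fun _ => _) = (fun u : X =>
  if i == ord0 then (spread_sqr (val u) - min_on s (val u) ^+ 2) / den (val u)
  else 2 * min_on s (val u) * chord (val u) i / den (val u))).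
  case: (i == ord0); apply: mul_for_continuous; try exact: inv_for_continuous.
    by apply: add_for_continuous => //; exact: opp_for_continuous.
  by repeat cont_step; [exact: mc|exact: cc].
by apply/funext => y; rewrite /= mxE.
Qed.

(** [chord u] and [u - min_on s u] differ by a constant on [s], and subtracting the minimum removes
    that constant. *)
Lemma above_homogeneous (x : 'rV[R]_d.+1) u c : X u -> 0 < c ->
  (forall i, i != ord0 -> x ord0 i = c * chord u i) ->
  above x = fun i => c * (u (en i) - min_on s u).
Proof.
move=> uX c0 xE; have eqE i : equator x i = c * chord u i.
  by rewrite /equator; have [->|/xE//] := eqVneq i ord0; rewrite chord0 mulr0.
have [j aj] := above_attained x; have [k mk] := min_on_en uX.
have fj : floor x = c * chord u j.
  by rewrite -eqE; apply/esym/eqP; rewrite -subr_eq0 -/(above x j) aj.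
have := floor_le x k; rewrite eqE fj ler_pM2l // /chord lerD2r => le1.
have ej : u (en j) = min_on s u.
  by apply/le_anti; rewrite min_on_le ?en_in // mk le1.
by apply/funext => i; rewrite /above eqE fj /chord -ej; ring.
Qed.

(** Stereographic projection undoes [sphere_row] up to the positive factor [c]; only the scaling by
    3 is left. *)
Lemma cell_of_sphereK (u : X) : min_on s (val u) != 0 ->
  cell_of_sphere (sphere_of_cell u) =
  spread (min_on s (val u)) (fun i => val u (en i) - min_on s (val u)).
Proof.
move=> m0; have uX := set_mem (valP u) : X (val u); have D0 := den_gt0 uX.
have m_gt0 : 0 < min_on s (val u).
  by rewrite lt_def m0 min_on_ge0 //; case: uX.
pose c := 2 * min_on s (val u) / den (val u).
have c0 : 0 < c by rewrite divr_gt0 // mulr_gt0.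
have hE : height (val (sphere_of_cell u)) = c * min_on s (val u).
  rewrite /height /= mxE eqxx /c; move: D0; rewrite /den => D0.
  by field; rewrite gt_eqF.
rewrite cell_of_sphereE hE; last exact: mulr_gt0.
rewrite (@above_homogeneous _ (val u) c) // ?spread_scale // => i /negPf i0.
by rewrite /= mxE i0 /c mulrAC.
Qed.

Lemma min_incl t (x : X') : t \in S -> min_on t (val (incl x)) = 0.
Proof.
move=> tS; apply/eqP; apply: contraT => m0.
have E := full_support tS m0; have [_ _] := set_mem (valP x).
by rewrite inE => /andP[+ _]; rewrite -/(val (incl x)) E tS.
Qed.

Lemma cell_of_sphere_cases (x : sphere) :
  (exists y, cell_of_sphere x = incl y) \/
  [/\ 0 < height (val x), 2 * mass (val x) - e * height (val x) <= 0 &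
      val (cell_of_sphere x) = embed (fun i =>
        (height (val x) - 2 * mass (val x) / e + 3 * above (val x) i) /
        (e * height (val x) + mass (val x)))].
Proof.
have [h0|h0] := ltP 0 (height (val x)); last first.
  left; exists a0; rewrite /cell_of_sphere ifT //.
  by have := threshold_gt0; lra.
rewrite cell_of_sphereE //.
have [g1|/ltW g1] := leP (2 * mass (val x) - e * height (val x)) 0.
  by right; split=> //; rewrite spread_inner //; exact: above_ge0.
have [j aj] := above_attained (val x); left.
rewrite (spread_outer _ h0 aj) //; last exact: above_ge0.
by eexists.
Qed.

(** The composite changes only the distance from the barycentre, so points move along meridians, as
    [sphere_homotopy] requires. Points pushed into [X'] go to [base], with [c = 0]. *)
Lemma sphere_of_cellK (x : sphere) : exists2 c, 0 <= c & forall i, i != ord0 ->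
  val (sphere_of_cell (cell_of_sphere x)) ord0 i = c * val x ord0 i.
Proof.
have [[y yE]|[h0 g1 yE]] := cell_of_sphere_cases x.
  exists 0 => // i /negPf i0; rewrite mul0r yE sphere_of_cell0 ?min_incl //.
  by rewrite /= mxE i0 andbF.
set u := val (cell_of_sphere x) in yE *.
have uX : X u := set_mem (valP _); have D0 := den_gt0 uX.
set D := e * height (val x) + mass (val x).
have D1 : 0 < D by apply: spread_den => //; exact: above_ge0.
exists (2 * min_on s u * 3 / (D * den u)).
  rewrite divr_ge0 // ?mulr_ge0 ?min_on_ge0 ?ltW //; by case: uX.
move=> i /negPf i0; rewrite /= -/u mxE i0.
have -> : chord u i = 3 * val x ord0 i / D.
  rewrite /chord yE !embed_en -/D /above {2}/equator eqxx /equator i0.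
  by field; rewrite gt_eqF //= gt_eqF // e_gt0.
by field; rewrite !gt_eqF.
Qed.

(** The pole opposite to [base] corresponds to the barycentre of the cell, which the scaling
    fixes. *)
Lemma sphere_of_cell_pole (x : sphere) : (forall i, i != ord0 -> val x ord0 i = 0) ->
  sphere_of_cell (cell_of_sphere x) = x.
Proof.
move=> x0; have eq0 i : equator (val x) i = 0.
  by rewrite /equator; case: eqVneq => // /x0.
have ab0 i : above (val x) i = 0.
  have [j aj] := above_attained (val x).
  by rewrite -aj /above !eq0.
have ma0 : mass (val x) = 0 by rewrite /mass big1.
apply: val_inj; apply/rowP => i; have [->|i0] := eqVneq i ord0; last first.
  have [c _ ->] := sphere_of_cellK x; rewrite // x0 // mulr0 //.
have /eqP := sphere_pole x0; rewrite -[1](expr1n _ 2) eqf_sqr => /orP[]/eqP xE.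
  have -> : x = base.
    apply: val_inj; apply/rowP => j; rewrite /= mxE eqxx /=.
    by have [->|/x0] := eqVneq j ord0.
  by rewrite cell_of_sphere_base sphere_of_cell0 // min_incl.
have hE : height (val x) = 2 by rewrite /height xE; lra.
have [[y yE]|[h0 g1 yE]] := cell_of_sphere_cases x.
  have h0 : 0 < height (val x) by rewrite hE.
  have g1 : 2 * mass (val x) - e * height (val x) <= 0.
    by rewrite ma0 hE; have := e_gt0; lra.
  have := cell_of_sphereE h0; have := spread_inner (above_ge0 (val x)) h0 g1 => E1 E2.
  have m0 := min_incl y sS; move: m0; rewrite -yE E2.
  have [j mj] := min_on_en (set_mem (valP (spread (height (val x)) (above (val x))))).
  rewrite mj E1 embed_en ab0 -/(mass _) ma0 hE mulr0 mul0r subr0 addr0 mulr0 addr0.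
  move=> /eqP; rewrite mulf_eq0 invr_eq0 mulf_eq0 !pnatr_eq0 //.
rewrite /= mxE eqxx xE; set u := val (cell_of_sphere x) in yE *.
have uX : X u := set_mem (valP _); have D0 := den_gt0 uX.
have uE j : u (en j) = e^-1.
  rewrite yE embed_en ab0 ma0 hE mulr0 mul0r subr0 mulr0 !addr0.
  by rewrite invfM mulrCA divff ?mulr1 // pnatr_eq0.
have N0 : spread_sqr u = 0.
  rewrite /spread_sqr big1 => [|j _]; last by rewrite /chord !uE subrr expr0n.
  under eq_bigr => j _ do rewrite uE.
  by rewrite sumr_const card_ord -[_ *+ _]mulr_natl divff ?pnatr_eq0 // subrr expr0n addr0.
move: D0; rewrite /den N0 add0r sub0r => D0.
by rewrite mulNr divff // gt_eqF.
Qed.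

Lemma min_cell_of_sphere t (x : sphere) : t \in S -> t != s ->
  min_on t (val (cell_of_sphere x)) = 0.
Proof.
move=> tS ts; have [[y ->]|[h0 g1 yE]] := cell_of_sphere_cases x; first exact: min_incl.
apply/eqP; apply: contraNT ts => m0; have E := full_support tS m0.
have [[tL tmax] _] := S_max tS; apply/eqP/esym/tmax; first exact: (S_max sS).1.1.
rewrite -E; apply/fintype.subsetP => v; rewrite inE yE; apply: contraNT => vs.
by rewrite embed_out.
Qed.

(** Zero exactly when [u] is in the interior of no cell but possibly [s]; as a continuous sum it
    makes this a closed condition. *)
Definition others (u : X) : R := \sum_(t in S :\ s) min_on t (val u).

Lemma min_val_ge0 t (u : X) : 0 <= min_on t (val u).
Proof. by apply: min_on_ge0; case: (set_mem (valP u)). Qed.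

Lemma othersP (u : X) : others u <= 0 <->
  (forall t, t \in S -> t != s -> min_on t (val u) = 0).
Proof.
have sum0 : 0 <= others u by apply: sumr_ge0 => t _; exact: min_val_ge0.
split=> [u0 t tS ts|H]; last first.
  rewrite /others big1 // => t; rewrite !inE => /andP[ts tS]; exact: H.
have : others u == 0 by rewrite eq_le u0.
rewrite psumr_eq0 => [/allP H|t' _]; last exact: min_val_ge0.
by have := H t (mem_index_enum t); rewrite !inE ts tS => /eqP.
Qed.

(* [push] scales the cell by [1 + 2 r] about its barycentre, which leads from the
   identity to [cell_of_sphere \o sphere_of_cell]. *)
Definition radius (p : X * R) : R :=
  (1 - e * min_on s (val p.1)) * (1 + 2 * clamp p.2) - 1.
Definition inner_push (p : X * R) : E := fun v =>
  - radius p / e * (v \in s)%:R +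
  (1 + 2 * clamp p.2) * (val p.1 v - min_on s (val p.1) * (v \in s)%:R).
Definition outer_push (p : X * R) : E := fun v =>
  (val p.1 v - min_on s (val p.1) * (v \in s)%:R) / (1 - e * min_on s (val p.1)).
Definition push (p : X * R) : X :=
  if radius p <= 0 then into P0 (inner_push p)
  else incl (C (into a0 (outer_push p), radius p)).

Lemma sum_indicator (c : R) : \sum_v c * (v \in s)%:R = e * c.
Proof.
rewrite -mulr_sumr mulrC -cs -sum1_card natr_sum; congr (_ * _).
by rewrite [RHS]big_mkcond; apply: eq_bigr => v _; case: ifP.
Qed.

Lemma sub_min_ge0 (u : X) v : 0 <= val u v - min_on s (val u) * (v \in s)%:R.
Proof.
have [vs|vs] := boolP (v \in s); first by rewrite mulr1 subr_ge0 min_on_le.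
by rewrite mulr0 subr0; case: (set_mem (valP u)).
Qed.

Lemma sum_sub_min (u : X) :
  \sum_v (val u v - min_on s (val u) * (v \in s)%:R) = 1 - e * min_on s (val u).
Proof.
by rewrite big_split /= sumrN sum_indicator; case: (set_mem (valP u)) => _ ->.
Qed.

(** On [X'] the result does not depend on [s]: every [push] runs [C] at double speed there. Hence
    the pushes of different cells agree where they meet. *)
Lemma push_boundary (u : X) r : min_on s (val u) = 0 -> others u <= 0 ->
  push (u, r) = incl (C (into a0 (val u), 2 * clamp r)).
Proof.
move=> m0 /othersP o0; have cr := clamp_ge0 r.
have uX' : X' (val u).
  have [u0 u1 uL] := set_mem (valP u); split=> //; rewrite inE uL andbT.
  apply/negP => tS; set t := [set v | _]%SET in tS.
  have mt : min_on t (val u) = 0.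
    by have [->//|ts] := eqVneq t s; exact: o0.
  have [v0 v0t] : exists v, v \in t.
    apply/set0Pn; rewrite -card_gt0; have [_ ->//] := S_max tS.
  have [|v vt vE] := @min_on_attained _ _ t (val u) _ v0t.
    exact: polyhedron_le1 (set_mem (valP u)).
  by move: vt; rewrite inE -vE mt eqxx.
rewrite /push /radius /= m0 mulr0 subr0 mul1r (_ : 1 + _ - 1 = 2 * clamp r); last by ring.
have oE : outer_push (u, r) = val u.
  by apply/funext => v; rewrite /outer_push /= m0 mul0r subr0 mulr0 subr0 divr1.
rewrite oE; case: ifPn => // r0.
have c0 : clamp r = 0 by lra.
apply: val_inj; rewrite c0 mulr0 C0 // intoK /= ?intoK //; last first.
  rewrite (_ : inner_push (u, r) = val u); first exact/set_mem/valP.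
  apply/funext => v; rewrite /inner_push /radius /= m0 c0.
  by rewrite !(mulr0, mul0r, subr0, addr0, mul1r, mulr1, subrr, oppr0, add0r).
apply/funext => v; rewrite /inner_push /radius /= m0 c0.
by rewrite !(mulr0, mul0r, subr0, addr0, mul1r, mulr1, subrr, oppr0, add0r).
Qed.

Lemma inner_pushP p : radius p <= 0 -> X (inner_push p).
Proof.
case: p => u r; rewrite /radius /= => r0; have cr := clamp_ge0 r; have e0 := e_gt0.
have [m0|m0] := eqVneq (min_on s (val u)) 0.
  rewrite (_ : inner_push (u, r) = val u); first exact/set_mem/valP.
  have c0 : clamp r = 0 by move: r0; rewrite m0; lra.
  apply/funext => v; rewrite /inner_push /radius /= m0 c0.
  by rewrite !(mulr0, mul0r, subr0, addr0, mul1r, mulr1, subrr, oppr0, add0r).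
split.
- move=> v; rewrite /inner_push; apply: addr_ge0.
    by rewrite mulr_ge0 // divr_ge0 ?oppr_ge0 // ltW.
  by rewrite mulr_ge0 ?sub_min_ge0 //=; lra.
- rewrite /inner_push big_split /= sum_indicator -mulr_sumr sum_sub_min /radius /=.
  have e0' : e != 0 by rewrite gt_eqF.
  by rewrite mulrCA divff // mulr1; ring.
- apply: L_down (S_max sS).1.1 _; apply/fintype.subsetP => v; rewrite inE.
  apply: contraNT => vs; rewrite /inner_push (negPf vs) /= !mulr0 subr0 add0r.
  have := full_support sS m0 => /finset.setP/(_ v); rewrite inE (negPf vs).
  by move=> /negbFE/eqP ->; rewrite mulr0.
Qed.

Lemma radius_gt (p : X * R) : 0 <= radius p -> 0 < 1 - e * min_on s (val p.1).
Proof.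
rewrite /radius; have := clamp_ge0 p.2 => c0 r0; rewrite ltNge; apply/negP => H.
have : (1 - e * min_on s (val p.1)) * (1 + 2 * clamp p.2) <= 0.
  by apply: mulr_le0_ge0 => //; lra.
by lra.
Qed.

(** The support can only shrink, so if it were in [S] it would be the full support of [u] by
    maximality. Cells other than [s] are excluded by [others], and on [s] the smallest coordinate
    has become 0. *)
Lemma outer_pushP p : others p.1 <= 0 -> 0 <= radius p -> X' (outer_push p).
Proof.
case: p => u r /othersP o0 /radius_gt /= B0; have [u0 u1 uL] := set_mem (valP u).
have supp : [set v | outer_push (u, r) v != 0]%SET \subset [set v | val u v != 0]%SET.
  apply/fintype.subsetP => v; rewrite !inE; apply: contraNN => /eqP uv.
  rewrite /outer_push /= uv; have [vs|_] := boolP (v \in s); last first.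
    by rewrite mulr0 subrr mul0r.
  have : min_on s (val u) <= 0 by rewrite -uv min_on_le.
  have := min_val_ge0 s u => m0 m1; have -> : min_on s (val u) = 0 by lra.
  by rewrite mul0r subrr mul0r.
split.
- by move=> v; rewrite divr_ge0 ?sub_min_ge0 // ltW.
- by rewrite /outer_push -mulr_suml sum_sub_min divff // gt_eqF.
- rewrite inE (L_down uL supp) andbT; apply/negP => tS.
  set t := [set v | outer_push _ v != 0]%SET in tS supp.
  have [[tL tmax] tc] := S_max tS; have tE := tmax _ uL supp.
  have mt : min_on t (val u) != 0.
    have [v0 v0t] : exists v, v \in t by apply/set0Pn; rewrite -card_gt0 tc.
    have [|v vt vE] := @min_on_attained _ _ t (val u) _ v0t.
      exact: polyhedron_le1 (set_mem (valP u)).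
    by rewrite vE; move: vt; rewrite -tE inE.
  have ts : t = s by apply/eqP; apply: contraNT mt => ts; rewrite o0.
  have [j mj] := min_on_en (set_mem (valP u)).
  have : en j \in t by rewrite ts en_in.
  by rewrite inE /outer_push /= en_in mj mulr1 subrr mul0r eqxx.
Qed.

Lemma push_outer p : others p.1 <= 0 -> 0 <= radius p ->
  push p = incl (C (into a0 (outer_push p), radius p)).
Proof.
move=> o0 r0; rewrite /push; case: ifPn => // r1.
have rE : radius p = 0 by lra.
rewrite rE C0 //; apply: val_inj; rewrite /= !intoK //.
- have B0 := radius_gt r0; apply/funext => v; rewrite /inner_push /outer_push rE.
  rewrite oppr0 !mul0r add0r mulrC; congr (_ * _).
  apply: (mulfI (gt_eqF B0 : _ == 0 = false)) || apply/(mulfI (negbT (gt_eqF B0))).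
  by rewrite divff ?gt_eqF //; move: rE; rewrite /radius; lra.
- exact: outer_pushP.
- exact: inner_pushP.
Qed.

Lemma push0 (u : X) : push (u, 0) = u.
Proof.
have c0 : clamp (0 : R) = 0 by exact: clamp0.
have m0 := min_val_ge0 s u; have e0 := e_gt0.
have rE : radius (u, 0) = - (e * min_on s (val u)).
  by rewrite /radius /= c0; ring.
rewrite /push rE oppr_le0 mulr_ge0 // 1?ltW //; apply: val_inj.
have iE : inner_push (u, 0) = val u.
  apply/funext => v; rewrite /inner_push rE /= c0 mulr0 addr0 mul1r opprK.
  have -> : e * min_on s (val u) / e = min_on s (val u).
    by rewrite mulrAC divff ?mul1r // gt_eqF.
  by rewrite addrC subrK.
by rewrite intoK iE //; exact/set_mem/valP.
Qed.

(** At time 1 the factor [1 + 2 * clamp p.2] is the 3 of [spread]; where the minimum is 0, [C] has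
    reached time 2 and hence [a0]. *)
Lemma push1 (u : X) : others u <= 0 -> push (u, 1) =
  if min_on s (val u) == 0 then P0
  else spread (min_on s (val u)) (fun i => val u (en i) - min_on s (val u)).
Proof.
move=> o0; have c1 : clamp (1 : R) = 1 by exact: clamp1.
case: eqVneq => [m0|m0]; first by rewrite push_boundary // c1 C1 //; lra.
set m := min_on s (val u) in m0 *; have e0 := e_gt0.
have s1 := cell_sum1 (set_mem (valP u)) m0.
have BE : \sum_i (val u (en i) - m) = 1 - e * m.
  by rewrite big_split /= s1 sumr_const card_ord -[(- m) *+ _]mulr_natl mulrN.
have rE : radius (u, 1) = 2 * (1 - e * m) - e * m by rewrite /radius /= c1 -/m; ring.
have out v : v \notin s -> val u v = 0.
  have /finset.setP/(_ v) := full_support sS m0; rewrite inE => E vs.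
  by move: E; rewrite (negPf vs) => /negbFE/eqP.
rewrite /push /spread BE rE.
have -> : e * m + (1 - e * m) = 1 by ring.
rewrite divr1; congr (if _ then into _ _ else incl (C (into _ _, _))).
- apply/esym/embedP => [i|v vs].
    rewrite /inner_push rE /= c1 en_in -/m divr1 !mulr1.
    by field; rewrite gt_eqF.
  by rewrite /inner_push (negPf vs) /= out // !mulr0 subr0 mulr0 addr0.
- apply/esym/embedP => [i|v vs].
    by rewrite /outer_push /= en_in -/m mulr1.
  by rewrite /outer_push (negPf vs) /= out // mulr0 subr0 mul0r.
Qed.

Lemma point_pair_for_continuous v (p : X * R) :
  {for p, continuous (fun p : X * R => val p.1 v)}.
Proof.
apply: (@eval_for_continuous R _ V (fun p : X * R => val p.1)).
by apply: (@comp_for_continuous _ _ _ fst (val : X -> E)); [exact: continuous_val|exact: cvg_fst].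
Qed.

Lemma min_pair_for_continuous t (p : X * R) :
  {for p, continuous (fun p : X * R => min_on t (val p.1))}.
Proof.
apply: (@min_on_for_continuous R V _ (fun p : X * R => val p.1)).
by apply: (@comp_for_continuous _ _ _ fst (val : X -> E)); [exact: continuous_val|exact: cvg_fst].
Qed.

Lemma radius_continuous : continuous radius.
Proof. by rewrite /radius; cont; exact: min_pair_for_continuous. Qed.

Definition push_domain (b : bool) : set (X * R) :=
  [set p | others p.1 <= 0] `&` [set p | if b then radius p <= 0 else - radius p <= 0].

Lemma push_domain_closed b : closed (push_domain b).
Proof.
apply: closedI.
  apply: closed_le_for; rewrite /others; cont; exact: min_pair_for_continuous.
case: b; apply: closed_le_for; first exact: radius_continuous.
by cont; exact: radius_continuous.
Qed.

Lemma push_within b : {within push_domain b, continuous push}.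
Proof.
have pc := point_pair_for_continuous; have mc := @min_pair_for_continuous s.
have rc := radius_continuous.
case: b.
  apply: (@eq_within _ _ _ (fun p => into P0 (inner_push p))).
    by move=> p [_ /= r0]; rewrite /push r0.
  apply: into_within => [|p [_ /inner_pushP//]].
  apply: within_for => p _; apply: ptws_for_continuous => v; rewrite /inner_push.
  by repeat cont_step;
    solve [exact: pc|exact: mc|exact: rc|by rewrite pnatr_eq0].
apply: (@eq_within _ _ _ (fun p => incl (C (into a0 (outer_push p), radius p)))).
  by move=> p [o0 /= r0]; rewrite push_outer // -oppr_le0.
apply: (comp_within incl_continuous); apply: (comp_within C_cont).
apply: pair_within; last by apply: within_for => p _; exact: rc.
apply: into_within => [|p [o0 /= r0]]; last by apply: outer_pushP; rewrite // -oppr_le0.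
apply: within_for => p [o0 /= r0]; apply: ptws_for_continuous => v; rewrite /outer_push.
by repeat cont_step;
  solve [exact: pc|exact: mc|by rewrite gt_eqF // radius_gt // -oppr_le0].
Qed.

End cell.

(** * Gluing the cells into a wedge of spheres *)

Section bouquet.
Context (k : nat) (Sk : #|S| = k.+1).
Local Notation sphere := (sphere R d).
Local Notation base := (sphere_base R d).
Local Notation W := (sphere_wedge R d k).

Let cl (i : 'I_k.+1) : {set V} := enum_val (cast_ord (esym Sk) i).
Let clS i : cl i \in S. Proof. exact: enum_valP. Qed.
Let cl_inj : injective cl. Proof. by move=> i j /enum_val_inj /cast_ord_inj. Qed.
Let cl_surj t : t \in S -> exists i, cl i = t.
Proof.
move=> tS; exists (cast_ord Sk (enum_rank_in tS t)).
by rewrite /cl cast_ordK enum_rankK_in.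
Qed.

Definition petal (i : 'I_k.+1) (x : sphere) : W :=
  @wedge_lift _ _ (fun _ : 'I_k.+1 => base) i x.

Lemma petal_continuous i : continuous (petal i).
Proof. exact: (@wedge_lift_continuous _ _ (fun _ : 'I_k.+1 => base) i). Qed.

Lemma petal_base i j : petal i base = petal j base.
Proof. exact: (@wedge_liftE _ _ (fun _ : 'I_k.+1 => base) j base i base). Qed.

Lemma petal_surj (z : W) : exists i x, z = petal i x.
Proof.
have : [set: W] z by [].
by rewrite /W -wedgeTE => -[i _ [x _ <-]]; exists i, x.
Qed.

Definition of_wedge : W -> X := wedge_fun (fun i => cell_of_sphere (clS i)).

Lemma of_wedge_petal i x : of_wedge (petal i x) = cell_of_sphere (clS i) x.
Proof.
by rewrite /of_wedge wedge_lift_funE // => j l; rewrite !cell_of_sphere_base.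
Qed.

Lemma of_wedge_continuous : continuous of_wedge.
Proof.
apply: wedge_fun_continuous => [i|i j]; first exact: cell_of_sphere_continuous.
by rewrite !cell_of_sphere_base.
Qed.

Definition support_index (u : X) : option 'I_k.+1 :=
  [pick i | min_on (cl i) (val u) != 0].

Lemma min_other (u : X) i j : min_on (cl i) (val u) != 0 -> j != i ->
  min_on (cl j) (val u) = 0.
Proof.
move=> mi ji; apply/eqP; apply: contraNT ji => mj; apply/eqP/cl_inj.
by rewrite -(full_support (clS i) mi) -(full_support (clS j) mj).
Qed.

Definition to_wedge (u : X) : W :=
  if support_index u is Some i then petal i (sphere_of_cell (clS i) u)
  else petal ord0 base.

Lemma to_wedgeE (u : X) i : (forall j, j != i -> min_on (cl j) (val u) = 0) ->
  to_wedge u = petal i (sphere_of_cell (clS i) u).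
Proof.
move=> H; rewrite /to_wedge /support_index; case: pickP => [j mj|m0].
  by have [->//|/H E] := eqVneq j i; rewrite E eqxx in mj.
rewrite sphere_of_cell0; first exact: petal_base.
by have /negbFE/eqP := m0 i.
Qed.

Lemma to_wedge_or (u : X) : to_wedge u = petal ord0 base \/
  exists j, to_wedge u = petal j (sphere_of_cell (clS j) u).
Proof.
by rewrite /to_wedge; case: (support_index u) => [j|]; [right; exists j|left].
Qed.

(** Inside an open cell a single petal is involved nearby. Elsewhere all petal maps send [u] to the
    base point, and finitely many neighbourhoods are intersected. *)
Lemma to_wedge_for_continuous (u : X) : {for u, continuous to_wedge}.
Proof.
have pc i : {for u, continuous (fun u => petal i (sphere_of_cell (clS i) u))}.
  apply: (@comp_for_continuous _ _ _ (sphere_of_cell (clS i)) (petal i)).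
    exact: petal_continuous.
  exact: sphere_of_cell_continuous.
have [i mi|m0] := pickP (fun i => min_on (cl i) (val u) != 0).
  have near_i : \forall y \near u, min_on (cl i) (val y) != 0.
    have m_gt0 : 0 < min_on (cl i) (val u) by rewrite lt_def mi min_val_ge0.
    have H : nbhs (min_on (cl i) (val u)) [set r : R | 0 < r].
      by apply: open_nbhs_nbhs; split; [exact: open_gt|].
    have nH : nbhs u [set y : X | 0 < min_on (cl i) (val y)] := @min_for_cont (cl i) u _ H.
    by apply: filterS nH => y /= y0; rewrite gt_eqF.
  have E y : min_on (cl i) (val y) != 0 -> to_wedge y = petal i (sphere_of_cell (clS i) y).
    by move=> my; apply: to_wedgeE => j; exact: min_other.
  rewrite /prop_for /continuous_at (E u mi) => A /(pc i) nA.
  change (nbhs u (to_wedge @^-1` A)).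
  have nA' : nbhs u [set y : X | A (petal i (sphere_of_cell (clS i) y))] := nA.
  by apply: filterS (filterI near_i nA') => y /= [/E -> ].
have u_base i : to_wedge u = petal i (sphere_of_cell (clS i) u).
  by apply: to_wedgeE => j _; have /negbFE/eqP := m0 j.
move=> A nA; change (nbhs u (to_wedge @^-1` A)).
have base_A : A (petal ord0 base).
  have := nbhs_singleton nA; rewrite (u_base ord0) sphere_of_cell0 //.
  by have /negbFE/eqP := m0 ord0.
have nAi i : nbhs u [set y : X | A (petal i (sphere_of_cell (clS i) y))].
  by apply: (pc i); rewrite -u_base.
have nAall : nbhs u [set y : X | forall i, A (petal i (sphere_of_cell (clS i) y))].
  exact: (@filter_forall X _ (fun i (y : X) => A (petal i (sphere_of_cell (clS i) y)))
    _ (nbhs_filter u) nAi).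
apply: filterS nAall => y yA /=.
by have [->|[j ->]] := to_wedge_or y.
Qed.

Lemma to_wedge_continuous : continuous to_wedge.
Proof. by move=> u; exact: to_wedge_for_continuous. Qed.

Definition push_index (p : X * R) : 'I_k.+1 := odflt ord0 (support_index p.1).
Definition push_all (p : X * R) : X := push (cl (push_index p)) p.

Lemma othersE (u : X) i : (forall j, j != i -> min_on (cl j) (val u) = 0) ->
  others (cl i) u <= 0.
Proof.
move=> H; apply/othersP => t /cl_surj[j <-]; rewrite (inj_eq cl_inj); exact: H.
Qed.

Lemma push_allE (u : X) r i : others (cl i) u <= 0 -> push_all (u, r) = push (cl i) (u, r).
Proof.
move=> oi; have H j : j != i -> min_on (cl j) (val u) = 0.
  by move=> ji; apply: (othersP (cl i) u).1; rewrite ?(inj_eq cl_inj).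
rewrite /push_all /push_index /support_index /=; case: pickP => [j mj|m0] /=.
  by have [->//|/H E] := eqVneq j i; rewrite E eqxx in mj.
have mz j : min_on (cl j) (val u) = 0 by have /negbFE/eqP := m0 j.
by rewrite !push_boundary // othersE.
Qed.

Lemma push_all_continuous : continuous push_all.
Proof.
pose D (ib : 'I_k.+1 * bool) := push_domain (cl ib.1) ib.2.
apply: (@closed_cover_continuous _ _ (map D (enum {: 'I_k.+1 * bool}))) => [A|[u r]].
  move=> /List.in_map_iff[[i b] [<- _]]; split; first exact: push_domain_closed.
  apply: (@eq_within _ _ _ (push (cl i))); last exact: push_within.
  by move=> [u r] [oi _]; apply/esym/push_allE.
have [i oi] : exists i, others (cl i) u <= 0.
  have [i mi|m0] := pickP (fun i => min_on (cl i) (val u) != 0).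
    by exists i; apply: othersE => j; exact: min_other.
  by exists ord0; apply: othersE => j _; have /negbFE/eqP := m0 j.
pose b := radius (cl i) (u, r) <= 0.
exists (D (i, b)).
  apply: List.in_map; have : (i, b) \in enum {: 'I_k.+1 * bool} by rewrite mem_enum.
  elim: (enum _) => //= a s IH; rewrite inE => /orP[/eqP <-|/IH]; [by left|by right].
split=> //=; rewrite /b; case: ifPn => //; rewrite -ltNge oppr_le0 => /ltW //.
Qed.

Lemma push_all1 (u : X) : push_all (u, 1) = of_wedge (to_wedge u).
Proof.
have [i mi|m0] := pickP (fun i => min_on (cl i) (val u) != 0).
  have oi : others (cl i) u <= 0 by apply: othersE => j; exact: min_other.
  rewrite (push_allE _ oi) push1 // (negPf mi) (@to_wedgeE _ i); last first.
    by move=> j; exact: min_other.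
  by rewrite of_wedge_petal cell_of_sphereK.
have mz j : min_on (cl j) (val u) = 0 by have /negbFE/eqP := m0 j.
have oi : others (cl ord0) u <= 0 by apply: othersE.
rewrite (push_allE _ oi) push1 // mz eqxx (@to_wedgeE _ ord0) //.
by rewrite of_wedge_petal sphere_of_cell0 // cell_of_sphere_base.
Qed.

Lemma to_of_wedge i x :
  to_wedge (of_wedge (petal i x)) = petal i (sphere_of_cell (clS i) (cell_of_sphere (clS i) x)).
Proof.
rewrite of_wedge_petal; apply: to_wedgeE => j ji; apply: min_cell_of_sphere => //.
by rewrite (inj_eq cl_inj).
Qed.

Lemma base_closed : closed [set base].
Proof.
rewrite (_ : [set base] = [set x : sphere | 1 - val x ord0 ord0 <= 0]).
  apply: closed_le_for; cont; apply: coord_for_continuous; exact: continuous_val.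
apply/seteqP; split=> [_ ->/=|x /= x0]; first by rewrite mxE !eqxx subrr.
have := set_mem (valP x); rewrite /sphere_set /= (bigD1 ord0) //= => x1.
have s0 : 0 <= \sum_(i < d.+1 | i != ord0) val x ord0 i ^+ 2.
  by apply: sumr_ge0 => i _; exact: sqr_ge0.
have xE : val x ord0 ord0 = 1 by nra.
have : \sum_(i < d.+1 | i != ord0) val x ord0 i ^+ 2 == 0.
  by rewrite -(inj_eq (addrI (val x ord0 ord0 ^+ 2))) x1 xE expr1n addr0.
rewrite psumr_eq0 => [/allP H|i _]; last exact: sqr_ge0.
apply: val_inj; apply/rowP => i; rewrite /= mxE eqxx /=.
have [->|i0] := eqVneq i ord0; first by rewrite xE.
by have := H i (mem_index_enum i); rewrite i0 sqrf_eq0 => /eqP.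
Qed.

(** The homotopies of [sphere_homotopy] fix the base point, so they glue petal by petal. *)
Lemma wedge_homotopy : homotopic R (to_wedge \o of_wedge) idfun.
Proof.
have psi i : {Psi : sphere * R -> sphere | [/\ continuous Psi,
    forall x, Psi (x, 0) = sphere_of_cell (clS i) (cell_of_sphere (clS i) x),
    forall x, Psi (x, 1) = x & forall r, Psi (base, r) = base]}.
  apply: cid; apply: (@sphere_homotopy R d
    (sphere_of_cell (clS i) \o cell_of_sphere (clS i))).
  - move=> x; apply: continuous_comp; first exact: cell_of_sphere_continuous.
    exact: sphere_of_cell_continuous.
  - exact: sphere_of_cellK.
  - exact: sphere_of_cell_pole.
pose K (i : 'I_k.+1) (r : R) (x : sphere) : W := petal i (sval (psi i) (x, r)).
have Kbase r i j : K i r base = K j r base.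
  rewrite /K; have [_ _ _ ->] := svalP (psi i); have [_ _ _ ->] := svalP (psi j).
  exact: petal_base.
have Kc : continuous (uncurry (fun r => wedge_fun (fun i => K i r) : W -> W)).
  apply: (@wedge_fun_joint_continuous _ _ (fun _ : 'I_k.+1 => base) R W K).
  - exact: finite_finset.
  - by move=> i; exact: base_closed.
  - by move=> r i j; exact: Kbase.
  - move=> i; have [Pc _ _ _] := svalP (psi i).
    have -> : uncurry (K i) = fun p : R * sphere => petal i (sval (psi i) (p.2, p.1)).
      by apply/funext => -[].
    apply: continuous_forW => p.
    apply: (@comp_for_continuous _ _ _
      (fun p : R * sphere => sval (psi i) (p.2, p.1)) (petal i)).
      exact: petal_continuous.
    apply: (@comp_for_continuous _ _ _ (fun p : R * sphere => (p.2, p.1)) (sval (psi i))).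
      exact: Pc.
    by repeat cont_step.
apply: (@homotopicI R W W _ _ (fun p => wedge_fun (fun i => K i p.2) p.1)) => [|z|z].
- apply: continuous_forW => p.
  apply: (@comp_for_continuous _ _ _ (fun p : W * R => (p.2, p.1))
    (uncurry (fun r => wedge_fun (fun i => K i r) : W -> W))); first exact: Kc.
  by repeat cont_step.
- have [i [x ->]] := petal_surj z; rewrite /= to_of_wedge wedge_lift_funE //.
  by rewrite /K; have [_ -> _ _] := svalP (psi i).
- have [i [x ->]] := petal_surj z; rewrite /= wedge_lift_funE //.
  by rewrite /K; have [_ _ -> _] := svalP (psi i).
Qed.

Lemma bouquet_homotopy_equivalent : homotopy_equivalent R X W.
Proof.
exists to_wedge, of_wedge; split.
- exact: to_wedge_continuous.
- exact: of_wedge_continuous.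
- apply: homotopic_sym; apply: (homotopicI push_all_continuous) => u.
    by rewrite /push_all push0.
  exact: push_all1.
- exact: wedge_homotopy.
Qed.

End bouquet.
End cells.

(** * From matchings to homotopy types *)

Section homotopy_types.
Context {R : realType}.

Lemma wedge1_homotopy_equivalent d :
  homotopy_equivalent R (sphere_wedge R d 0) (sphere R d).
Proof.
pose X (_ : 'I_1) : topologicalType := sphere R d.
pose p0 (i : 'I_1) : X i := sphere_base R d.
pose f : sphere_wedge R d 0 -> sphere R d := wedge_fun (fun _ => @idfun (sphere R d)).
pose g : sphere R d -> sphere_wedge R d 0 := @wedge_lift _ X p0 ord0.
have gc : continuous g by exact: (@wedge_lift_continuous _ X p0 ord0).
have fc : continuous f.
  by apply: wedge_fun_continuous => [i x|//]; exact: id_for_continuous.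
have fg x : f (g x) = x by rewrite /f /g wedge_lift_funE.
have gf z : g (f z) = z.
  have : [set: sphere_wedge R d 0] z by [].
  by rewrite -wedgeTE => -[i _ [x _ <-]]; rewrite (ord1 i) -/(g x) fg.
exists f, g; split=> //; apply: homotopic_eq => // x.
- by apply: continuous_comp; [exact: fc|exact: gc].
- by apply: continuous_comp; [exact: gc|exact: fc].
Qed.

Context {V : finType}.
Implicit Types (A : {set {set V}}) (K : simplicial_complex V).

Lemma tree_contractible A : down_closed A -> finset.set0 \in A -> tree A [::] ->
  homotopy_equivalent R (@polyhedron R V A) point_space.
Proof. by move=> Ad A0 /(tree_removal Ad); exact: removal_contractible. Qed.

Lemma tree_wedge A d k : down_closed A -> finset.set0 \in A ->
  tree A (nseq k.+1 d.+1) -> homotopy_equivalent R (@polyhedron R V A) (sphere_wedge R d k).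
Proof.
move=> Ad A0 /(tree_removal Ad)/removal_normal -/(_ d.+1) [].
  by rewrite all_nseq /= eqxx.
rewrite size_nseq => L [S [AL Sk Smax LS]].
have Ld := down_closed_collapse Ad AL.
apply: homotopy_equivalent_trans (collapse_homotopy_equivalent (ltn0Sn d) Ad AL) _.
have LSd : down_closed (L :\: S).
  move=> s t; rewrite !inE => /andP[sS sL] ts; rewrite (Ld s) // andbT.
  apply: contra sS => tS; have [[_ tmax] _] := Smax _ tS.
  by rewrite (tmax _ sL ts).
have L0 : finset.set0 \in L :\: S.
  rewrite inE; apply/andP; split.
    by apply/negP => /Smax[_]; rewrite cards0.
  have [s sS] : exists s, s \in S by apply/set0Pn; rewrite -card_gt0 Sk.
  by apply: Ld (Smax _ sS).1.1 _; exact: finset.sub0set.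
have [a0 [C [Cc C0 C1]]] := contractibleE (removal_contractible (R := R) LSd L0 LS).
exact: (bouquet_homotopy_equivalent Ld Smax Cc C0 C1).
Qed.

(** The complexes have no empty simplex, whereas the matchings need one. *)
Definition faces K : {set {set V}} :=
  [set s | (s == finset.set0) || `[< simplex K s >]].

Lemma realizationE K : realization R K = @polyhedron R V (faces K) :> topologicalType.
Proof.
rewrite /realization.
suff -> : [set t : {ptws V -> R} | [/\ forall v, 0 <= t v, \sum_(v : V) t v = 1
     & simplex K [set v | t v != 0]%SET]] = polyhedron (faces K) by [].
apply/seteqP; split=> u /= [u0 u1 uK]; split=> //.
  by rewrite inE; apply/orP; right; apply/asboolP.
move: uK; rewrite inE => /orP[/eqP uE|/asboolP//].
have uz v : u v = 0.
  by apply/eqP; have := finset.in_set0 v; rewrite -uE inE => /negbFE.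
by move: u1; rewrite big1 // => /eqP; rewrite eq_sym oner_eq0.
Qed.

Lemma faces_down K : down_closed (faces K).
Proof.
move=> s t; rewrite !inE => /orP[/eqP ->|/asboolP sK ts].
  by rewrite finset.subset0 => ->.
by have [//|t0] := eqVneq t finset.set0; apply/asboolP; apply: simplex_face sK ts t0.
Qed.

Lemma tree_point_sphere_or_wedge K c : tree (faces K) c ->
  [\/ c = [::], exists2 m, (0 < m)%N & c = [:: (2 * m)%N]
    | exists m k, (0 < m)%N /\ c = nseq k (2 * m - 1)%N] ->
  point_sphere_or_wedge R (realization R K).
Proof.
rewrite realizationE => tK; have Kd := @faces_down K.
have K0 : finset.set0 \in faces K by rewrite inE eqxx.
case=> [cE|[[|m] m0 cE]|[[|m] [k [m0 cE]]]] //.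
- by constructor 1; apply: tree_contractible; rewrite // -cE.
- constructor 2; exists m.
  have mE : (2 * m.+1 = m.*2.+2)%N by rewrite mul2n doubleS.
  apply: homotopy_equivalent_trans (wedge1_homotopy_equivalent _).
  by apply: tree_wedge => //; rewrite /= -mE -cE.
- have mE : (2 * m.+1 - 1 = m.*2.+1)%N by rewrite mul2n doubleS subn1.
  (* Without critical sets the complex is contractible; otherwise their number is a successor, as in
     [sphere_wedge]. *)
  rewrite mE in cE; case: k cE => [|k] cE.
    by constructor 1; apply: tree_contractible; rewrite // -[[::]]cE.
  by constructor 3; exists m, k; apply: tree_wedge => //; rewrite -cE.
Qed.

End homotopy_types.

Local Open Scope quotient_scope.
Local Open Scope ring_scope.

Lemma induced_setT (V : finType) (K : {set {set V}}) : induced K [set: V]%SET = K.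
Proof. by apply/setP => s; rewrite inE finset.subsetT andbT. Qed.

(** * Finite subsets of the circle *)

Section circle_points.
Context {R : realType}.

Lemma int_cases (m : int) : [\/ m = 0, 1 <= m%:~R :> R | m%:~R <= -1 :> R].
Proof.
have [m_lt0|m_gt0|->] := ltgtP m 0; last by constructor 1.
  by constructor 3; rewrite -[-1]/((-1)%:~R) ler_int -ltzD1 addNr.
by constructor 2; rewrite ler1z -gtz0_ge1.
Qed.

Lemma pi_addz (a : R) (m : int) : \pi_(circle R) (a + m%:~R) = \pi_(circle R) a.
Proof. by apply/circle_eqP; exists m; ring. Qed.

Definition coord (x : circle R) : R := repr x - (Num.floor (repr x))%:~R.

Lemma pi_coord x : \pi_(circle R) (coord x) = x.
Proof. by rewrite /coord -mulrNz pi_addz reprK. Qed.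

Lemma coord_ge0 x : 0 <= coord x.
Proof. by rewrite subr_ge0 Num.Theory.ge_floor. Qed.

Lemma coord_lt1 x : coord x < 1.
Proof. by have := Num.Theory.lt_succ_floor (repr x); rewrite /coord intrD; lra. Qed.

Lemma coord_inj : injective coord.
Proof. by move=> x y E; rewrite -(pi_coord x) E pi_coord. Qed.

Lemma mdist_piP (a b r : R) : r < 2^-1 ->
  reflect (exists m : int, `|a - b - m%:~R| <= r)
    (mdist (\pi_(circle R) a) (\pi_(circle R) b) <= r).
Proof.
move=> r2; have distE m : `|a - b - m%:~R| <= 2^-1 ->
    mdist (\pi_(circle R) a) (\pi_(circle R) b) = `|a - b - m%:~R|.
  move=> H; rewrite -(pi_addz b m) mdist_circleE opprD ?addrA //.
apply: (iffP idP) => [|[m mr]]; last by rewrite (distE m) //; lra.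
(* The integer nearest to [a - b]. *)
pose m := Num.floor (a - b + 2^-1).
have m1 : m%:~R <= a - b + 2^-1 := Num.Theory.ge_floor _.
have m2 : a - b + 2^-1 < (m + 1)%:~R := Num.Theory.lt_succ_floor _.
have H : `|a - b - m%:~R| <= 2^-1.
  by rewrite ler_norml; move: m2; rewrite intrD; lra.
by rewrite (distE m) // => mr; exists m.
Qed.

Context (X : {fset circle R}) (X0 : X != fset0).
Let n := #|{: X}|.

Lemma card_points_gt0 : (0 < n)%N.
Proof. by rewrite /n -cardfE cardfs_gt0. Qed.
Let n_gt0 := card_points_gt0.

Let x0 : X := [` xchooseP (fset0Pn _ X0) ]%fset.

Definition le_coord (x y : X) := coord (val x) <= coord (val y).
Definition cpoint i : X := nth x0 (sort le_coord (enum {: X})) (i %% n).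
Definition angle i : R := coord (val (cpoint i)) + (i %/ n)%:R.

Lemma cpoint_eq i j : (cpoint i == cpoint j) = (i == j %[mod n])%N.
Proof.
rewrite /cpoint nth_uniq ?sort_uniq ?enum_uniq //.
- by rewrite size_sort -cardE ltn_mod.
- by rewrite size_sort -cardE ltn_mod.
Qed.

Lemma cpoint_surj x : exists i, cpoint i == x.
Proof.
have xs : x \in sort le_coord (enum {: X}) by rewrite mem_sort mem_enum.
exists (index x (sort le_coord (enum {: X}))); rewrite /cpoint modn_small ?nth_index //.
by rewrite -index_mem size_sort -cardE in xs.
Qed.

Lemma pi_angle i : \pi_(circle R) (angle i) = val (cpoint i).
Proof. by rewrite /angle -[(i %/ n)%:R]/((Posz (i %/ n))%:~R) pi_addz pi_coord. Qed.

Lemma angleDn i : angle (i + n) = angle i + 1.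
Proof.
by rewrite /angle /cpoint modnDr divnDr // divnn n_gt0 natrD addrA.
Qed.

Lemma lt_angle : {mono angle : i j / (i < j)%N >-> i < j}.
Proof.
apply: leW_mono; apply: le_mono => i j ij.
have srt : sorted le_coord (sort le_coord (enum {: X})).
  by apply: sort_sorted => x y; exact: le_total.
have coord_le k l : (k %% n < l %% n)%N -> coord (val (cpoint k)) < coord (val (cpoint l)).
  move=> kl; rewrite lt_neqAle (inj_eq coord_inj) (inj_eq val_inj) cpoint_eq.
  rewrite ltn_eqF //=.
  have := @sorted_ltn_nth _ le_coord _ x0 _ srt (k %% n)%N (l %% n)%N.
  apply => //; rewrite ?inE ?size_sort -?cardE ?ltn_mod //.
  by move=> x y z; exact: le_trans.
have [lt_q|] := ltnP (i %/ n) (j %/ n).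
  have := coord_lt1 (val (cpoint i)); have := coord_ge0 (val (cpoint j)).
  by move: lt_q; rewrite -(ler_nat R) -natr1 /angle; lra.
move=> le_q; have eq_q : (i %/ n = j %/ n)%N.
  by apply/eqP; rewrite eqn_leq le_q leq_div2r // ltnW.
rewrite /angle eq_q ltrD2r coord_le //.
by move: ij; rewrite ltEnat /= {1}(divn_eq i n) {1}(divn_eq j n) eq_q ltn_add2l.
Qed.

Lemma le_angle : {mono angle : i j / (i <= j)%N >-> i <= j}.
Proof. by move=> i j; rewrite leNgt lt_angle -leqNgt. Qed.

Section jump.
Context (u : R) (u_gt0 : 0 < u) (u_le1 : u <= 1).

(** Since [u <= 1], the index [i + n] qualifies, so [n] candidates from [i.+1] on are enough. *)
Definition jump i :=
  (i.+1 + find (fun k => angle i + u <= angle (i.+1 + k)%N)%R (iota 0 n))%N.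

Lemma jump_gt i : (i < jump i)%N.
Proof. exact: leq_addr. Qed.

(** This adjunction between [jump] and [angle] yields the monotonicity, periodicity and upper bound
    of [jump]. *)
Lemma jump_le_angle i j : (jump i <= j)%N = (angle i + u <= angle j).
Proof.
pose P k := angle i + u <= angle (i.+1 + k)%N.
have hasP : has P (iota 0 n).
  apply/hasP; exists n.-1; first by rewrite mem_iota /= prednK.
  rewrite /P (_ : (i.+1 + n.-1)%N = (i + n)%N) ?angleDn ?lerD2l //.
  by move: n_gt0; lia.
have find_lt := hasP; rewrite has_find size_iota in find_lt.
apply/idP/idP => [|ij].
  have := nth_find 0%N hasP; rewrite nth_iota // add0n /P => Pf jj.
  by apply: le_trans Pf _; rewrite le_angle.
have ltij : (i < j)%N by rewrite -lt_angle; apply: lt_le_trans ij; rewrite ltrDl.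
rewrite leqNgt; apply/negP => jj.
have jf : (j - i.+1 < find P (iota 0 n))%N by move: jj; rewrite /jump -/P; lia.
have := before_find 0%N jf; rewrite nth_iota ?add0n; last by lia.
by rewrite /P subnKC // ij.
Qed.

Lemma jump_mono i j : (i <= j)%N -> (jump i <= jump j)%N.
Proof.
move=> ij; rewrite jump_le_angle; have := leqnn (jump j); rewrite jump_le_angle.
by apply: le_trans; rewrite lerD2r le_angle.
Qed.

Lemma jump_le i : (jump i <= i + n)%N.
Proof. by rewrite jump_le_angle angleDn lerD2l. Qed.

Lemma jumpD i : jump (i + n) = (jump i + n)%N.
Proof.
apply/eqP; rewrite eqn_leq; apply/andP; split.
  rewrite jump_le_angle !angleDn addrAC lerD2r -jump_le_angle //.
have [k kE] : exists k, jump (i + n) = (k + n)%N.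
  by exists (jump (i + n) - n)%N; have := jump_gt (i + n); lia.
rewrite kE leq_add2r jump_le_angle -(lerD2r 1) addrAC -!angleDn -kE.
by rewrite -jump_le_angle.
Qed.

End jump.

Context (r : R) (r_ge0 : 0 <= r) (r_lt : r < 2^-1).

Lemma near_angleP i j : reflect (exists m : int, `|angle i - angle j - m%:~R| <= r)
  (mdist (val (cpoint i)) (val (cpoint j)) <= r).
Proof. by rewrite -!pi_angle; exact: mdist_piP. Qed.

(** The disjuncts say that the arc from [i] to [j], respectively from [j] to [i + n], has length at
    most [r], expressed through the complementary length [1 - r]. *)
Lemma near_angle i j : (i < j)%N -> (j < i + n)%N ->
  (mdist (val (cpoint i)) (val (cpoint j)) <= r) =
  (jump (1 - r) j <= i + n)%N || (jump (1 - r) i <= j)%N.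
Proof.
have r0 := r_ge0; have r2 := r_lt.
have u0 : 0 < 1 - r by lra.
have u1 : 1 - r <= 1 by lra.
move=> ij jn; rewrite !jump_le_angle // angleDn.
have t0 : angle i < angle j by rewrite lt_angle.
have t1 : angle j < angle i + 1 by rewrite -angleDn lt_angle.
apply/near_angleP/orP => [[m]|[ijr|ijr]].
- rewrite ler_norml => mr.
  by case: (int_cases m) mr => [->|m1|m1] mr; [left|exfalso|right]; lra.
- by exists 0; rewrite ler_norml; lra.
- by exists (-1); rewrite ler_norml mulrN1z; lra.
Qed.

Lemma VR_facesP (s : {set X}) :
  reflect (forall x y, x \in s -> y \in s -> mdist (val x) (val y) <= r)
    (s \in faces (VR X r)).
Proof.
rewrite inE; apply: (iffP orP) => [[/eqP->|/asboolP[]//]|H].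
  by move=> x y; rewrite inE.
by have [->|s0] := eqVneq s finset.set0; [left | right; apply/asboolP].
Qed.

Lemma cech_facesP (s : {set X}) :
  reflect (exists z : circle R, forall x, x \in s -> mdist (val x) z <= r)
    (s \in faces (cech X r)).
Proof.
rewrite inE; apply: (iffP orP) => [[/eqP->|/asboolP[_ [z Hz]]]|[z Hz]].
- by exists (val x0) => x; rewrite inE.
- by exists z => x /Hz.
have [->|s0] := eqVneq s finset.set0; first by left.
by right; apply/asboolP; split => //; exists z => x /Hz.
Qed.

Lemma VR_tree : exists2 c, tree (faces (VR X r)) c &
  [\/ c = [::], exists2 m, (0 < m)%N & c = [:: (2 * m)%N]
    | exists m k, (0 < m)%N /\ c = nseq k (2 * m - 1)%N].
Proof.
have r0 := r_ge0; have r2 := r_lt.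
have u0 : 0 < 1 - r by lra.
have u1 : 1 - r <= 1 by lra.
have edge x y : ([set x; y]%SET \in faces (VR X r)) = (mdist (val x) (val y) <= r).
  apply/VR_facesP/idP => [|xy a b]; first by apply; rewrite !inE eqxx ?orbT.
  rewrite !inE => /orP[]/eqP-> /orP[]/eqP->; rewrite ?mdistxx //.
  by rewrite metric_sym.
have YT : cpoint 0 \in [set: X]%SET by rewrite inE.
have [] := @chord_tree _ _ cpoint (jump (1 - r)) n_gt0 cpoint_eq cpoint_surj
   (jump_mono u0 u1) (jumpD u0 u1) (jump_gt _) (jump_le u0 u1) (faces (VR X r))
   _ _ _ _ _ 0%N YT.
(* Two jumps exceed a full turn because [2 * (1 - r) > 1]. *)
- move=> i; rewrite ltnNge jump_le_angle // angleDn -ltNge.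
  have := leqnn (jump (1 - r) i); rewrite {1}jump_le_angle //.
  by lra.
- move=> s; apply: (iffP (VR_facesP s)) => H x y xs ys.
    by rewrite edge H.
  by rewrite -edge H.
- by move=> x; rewrite -[[set x]%SET]finset.setUid edge mdistxx.
- by move=> i j ij jn; rewrite edge near_angle.
by move=> c; rewrite induced_setT; exists c.
Qed.

(** The balls around [s] meet in [z] iff [s] lies in the closed arc of radius [r] about [z], that
    is, misses the complementary open arc of length [1 - 2 * r]. *)
Lemma cech_tree : exists2 c, tree (faces (cech X r)) c &
  [\/ c = [::], exists2 m, (0 < m)%N & c = [:: (2 * m)%N]
    | exists m k, (0 < m)%N /\ c = nseq k (2 * m - 1)%N].
Proof.
have r0 := r_ge0; have r2 := r_lt.
have u0 : 0 < 1 - 2 * r by lra.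
have u1 : 1 - 2 * r <= 1 by lra.
have YT : cpoint 0 \in [set: X]%SET by rewrite inE.
have [] := @arc_tree _ _ cpoint (jump (1 - 2 * r)) n_gt0 cpoint_eq cpoint_surj
   (jump_mono u0 u1) (jumpD u0 u1) (jump_gt _) (jump_le u0 u1) (faces (cech X r))
   _ _ 0%N YT.
- move=> s; apply: (iffP (cech_facesP s)) => [[z Hz]|[i Hi]].
    have [->|/finset.set0Pn[x xs]] := eqVneq s finset.set0.
      by exists 0%N => j _ _; rewrite inE.
    have [i0 /eqP i0x] := cpoint_surj x.
    have near i : cpoint i \in s -> exists m : int, `|angle i - coord z - m%:~R| <= r.
      by move=> /Hz; rewrite -pi_angle -{1}(pi_coord z) => /mdist_piP; apply.
    have [m mP] : exists m : int, `|angle i0 - coord z - m%:~R| <= r.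
      by apply: near; rewrite i0x.
    pose c := coord z + m%:~R.
    have cP : `|angle i0 - c| <= r by rewrite opprD addrA.
    (* The missed arc starts at the last point of [s] within [r] of the chosen lift [c] of [z]. *)
    pose P i := (cpoint i \in s) && (`|angle i - c| <= r).
    have exP : exists i, P i by exists i0; rewrite /P i0x xs.
    have ubP i : P i -> (i <= i0 + n)%N.
      move=> /andP[_]; rewrite -le_angle angleDn; move: cP; rewrite !ler_norml.
      by lra.
    case: (ex_maxnP exP ubP) => i /andP[is_ iP] imax.
    exists i => j ij jG; apply/negP => js; have [k kP] := near j js.
    have aij : angle i < angle j by rewrite lt_angle.
    have ajG : angle j < angle i + (1 - 2 * r).
      by rewrite ltNge -jump_le_angle // -ltnNge.
    pose l := k - m; have kE : k%:~R = m%:~R + l%:~R :> R.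
      by rewrite -intrD /l addrC subrK.
    move: kP iP; rewrite !ler_norml kE /c => kP iP.
    (* Points near another copy of [c] lie outside the arc; near [c] itself, maximality of [i] is
       contradicted. *)
    case: (int_cases l) => [l0|l1|l1]; [|exfalso; lra..].
    have : P j by rewrite /P js ler_norml /c; move: kP; rewrite l0; lra.
    by move=> /imax; rewrite leqNgt ij.
  (* The points of [s] have lifts between [angle i + 1 - 2 * r] and [angle i + 1]; this is the
     midpoint. *)
  exists (\pi_(circle R) (angle i + 1 - r)) => x xs.
  have [j0 /eqP j0x] := cpoint_surj x.
  have [j [ij jn jx]] : exists j, [/\ (i < j)%N, (j <= i + n)%N & cpoint j = x].
    pose j := (i.+1 + (j0 + i.+1 * n - i.+1) %% n)%N; exists j.
    have jn : ((j0 + i.+1 * n - i.+1) %% n < n)%N by rewrite ltn_mod.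
    split; rewrite /j; [lia | lia |].
    rewrite -j0x; apply/eqP; rewrite cpoint_eq modnDmr subnKC.
      by rewrite addnC modnMDl.
    by move: n_gt0; nia.
  have jG : (jump (1 - 2 * r) i <= j)%N.
    by rewrite leqNgt; apply/negP => /(Hi j ij); rewrite jx xs.
  move: jG jn; rewrite jump_le_angle // -le_angle angleDn => jG jn.
  rewrite -jx -pi_angle; apply/mdist_piP => //; exists 0.
  by rewrite ler_norml; lra.
by move=> c; rewrite induced_setT; exists c.
Qed.

End circle_points.

Theorem corollary9p6 (R : realType) (X : {fset circle R}) (r : R) :
  X != fset0 -> 0 <= r -> r < 2^-1 ->
  point_sphere_or_wedge R (realization R (cech X r)) /\
  point_sphere_or_wedge R (realization R (VR X r)).
Proof.
move=> X0 r_ge0 r_lt.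
have [c1 t1 c1E] := cech_tree X0 r_ge0 r_lt.
have [c2 t2 c2E] := VR_tree X0 r_ge0 r_lt.
by split; [exact: tree_point_sphere_or_wedge t1 c1E|
  exact: tree_point_sphere_or_wedge t2 c2E].
Qed.
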